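(* Let $(S_n^{(1)},S_n^{(2)})_{n\ge0}$ be a two-elephant walking model with memory parameters $p_1,p_2\in[0,1]$ such that $\alpha_1\alpha_2>0$, where $\alpha_i=2p_i-1$; if $\alpha_1=\alpha_2=1$ assume $X_1^{(1)}\ne X_1^{(2)}$, and if $\alpha_1=\alpha_2=-1$ assume $X_1^{(1)}=X_1^{(2)}$. Let $\lambda_\alpha:=\operatorname{sgn}(\alpha_2)\sqrt{\alpha_1\alpha_2}$ and, when $|\lambda_\alpha|>1/2$, let $W$ be the almost sure limit of $S_n^{(1)}/n^{|\lambda_\alpha|}$. Then: If $|\lambda_\alpha|\in(1/2,1)$, $$n^{|\lambda_\alpha|-\frac12}\Big(\frac{S_n^{(1)}}{n^{|\lambda_\alpha|}}-W\Big)\xrightarrow{D}\mathcal N\Big(0,\Big(1+\frac{\alpha_1}{\alpha_2}\Big)\frac{\sqrt{\alpha_1\alpha_2}}{4\alpha_1\alpha_2-1}\Big);$$ and if $|\lambda_\alpha|=1$, $$\sqrt n\Big(\frac{S_n^{(1)}}{n^{|\lambda_\alpha|}}-W\Big)\xrightarrow{D}L,$$ where the random variable $L$ has characteristic function $\mathbb E(e^{\mathrm i tL})=\mathbb E\exp\big(-\frac{(1-W^2)t^2}{3}\big)$, $t\in\mathbb R$.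
   Context: Two-elephant walking model: fix $p_1,p_2\in[0,1]$. Let $(\xi_n^{(1)})_{n\ge2}$ be i.i.d. Bernoulli($p_1$), $(\xi_n^{(2)})_{n\ge2}$ i.i.d. Bernoulli($p_2$), and $(u_n^{(1)})_{n\ge1}$, $(u_n^{(2)})_{n\ge1}$ independent with each $u_n^{(i)}$ uniform on $\{1,\dots,n\}$; all families mutually independent. Set $S_0^{(1)}=S_0^{(2)}=0$, let the initial steps $X_1^{(1)},X_1^{(2)}\in\{-1,1\}$ be given, and for $n\ge1$ $$X_{n+1}^{(1)}:=\xi^{(1)}_{n+1}X^{(2)}_{u_n^{(2)}}-(1-\xi^{(1)}_{n+1})X^{(2)}_{u_n^{(2)}},\qquad X_{n+1}^{(2)}:=\xi^{(2)}_{n+1}X^{(1)}_{u_n^{(1)}}-(1-\xi^{(2)}_{n+1})X^{(1)}_{u_n^{(1)}},$$ with $S_n^{(i)}:=\sum_{k=1}^nX_k^{(i)}$. When $|\lambda_\alpha|>1/2$ the limit $W=\lim_n S_n^{(1)}/n^{|\lambda_\alpha|}$ exists almost surely. $\xrightarrow{D}$ denotes convergence in distribution. *)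

(* Defs.v *)
From HB Require Import structures.
From mathcomp Require Import all_boot all_order all_algebra.
From mathcomp Require Import all_classical all_reals all_analysis.
Set Implicit Arguments. Unset Strict Implicit. Unset Printing Implicit Defensive.
Import Order.TTheory GRing.Theory Num.Def Num.Theory.
Import numFieldNormedType.Exports.
Local Open Scope classical_set_scope.
Local Open Scope ring_scope.

(* Index set of the driving randomness of the two-elephant model:
   xi^(1)_n, xi^(2)_n (n >= 2), u^(1)_n, u^(2)_n (n >= 1). *)
Inductive elephant_idx := Xi1 of nat | Xi2 of nat | U1 of nat | U2 of nat.

Definition elephant_valid (i : elephant_idx) : bool :=
  match i with
  | Xi1 n | Xi2 n => (2 <= n)%N
  | U1 n | U2 n => (1 <= n)%N
  end.

Definition elephant_idx_eq_dec (i j : elephant_idx) : {i = j} + {i <> j}.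
Proof. decide equality; exact: (decP eqP). Defined.

HB.instance Definition _ := hasDecEq.Build elephant_idx (compareP elephant_idx_eq_dec).

Definition elephant_family {T : Type} (xi1 xi2 u1 u2 : nat -> T -> nat)
  (i : elephant_idx) : T -> nat :=
  match i with
  | Xi1 n => xi1 n | Xi2 n => xi2 n | U1 n => u1 n | U2 n => u2 n
  end.

Definition partial_sum {T : Type} {R : realType} (X : nat -> T -> R) (n : nat) (t : T) : R :=
  \sum_(1 <= k < n.+1) X k t.

Definition mutually_independent_nat {d} {T : measurableType d} {R : realType}
  (P : probability T R) {I : eqType} (ok : pred I) (Y : I -> T -> nat) : Prop :=
  forall (J : seq I) (k : I -> nat), uniq J -> all ok J ->
    P (\bigcap_(j in [set j | j \in J]) (Y j @^-1` [set k j])) =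
    (\prod_(j <- J) P (Y j @^-1` [set k j]))%E.

(* Borel probability laws on R (sigma-algebra generated by the intervals ]a,b],
   i.e. the Borel sets; this is the measurable type of lebesgue_measure and of
   normal_prob). *)
Notation borel_law R := (probability (g_sigma_algebraType (R.-ocitv.-measurable)) R).

Definition cvg_in_distribution {d} {T : measurableType d} {R : realType}
  (P : probability T R) (Y : nat -> T -> R) (mu : borel_law R) : Prop :=
  forall f : R -> R, continuous f -> (exists M : R, forall x, `|f x| <= M) ->
    (fun n => \int[P]_t (f (Y n t))%:E)%E @ \oo --> (\int[mu]_x (f x)%:E)%E.

(* Main.v *)
(** With mu = |lambda| and rho = a1 / mu, the combinations A = S1 + rho S2 and B = S1 - rho S2
    have drifts mu A_k / k and - mu B_k / k, so that A_n / n^mu and n^mu B_n are almost martingales.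
    As S1 = (A + B) / 2, for n <= N the difference
      Y_(n, N) = n^(mu-1/2) (S1_n / n^mu - S1_N / N^mu)
    is n^(-1/2) B_n / 2 + n^(mu-1/2) (A_n / n^mu - A_N / N^mu) / 2 up to a term that vanishes as
    N -> oo.  For m << n << N this is, up to a small L1 error, a weighted sum of the centred steps
    at the times from m to N, where B_n contributes the weights before n and A those after n.
    The conditional variance of a step is close to 1 - (S1_m / m)^2, so telescoping conditional
    characteristic functions from N down to m, and then N -> oo by dominated convergence, give
      E cos (t + s Y_n) -> cos t E exp (- s^2 kappa V / 2), V = lim (1 - (S1_m / m)^2),
    where V = 1 if mu < 1 and V = 1 - W^2 if mu = 1.
    The walk up to a fixed time is a finite Markov chain, so the estimates only need an explicit
    expectation functional.  Tightness in L1 and the approximation of bounded continuous functions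
    by polynomials in sines turn the convergence of the cosine means into convergence in
    distribution; for mu = 1 the limit is the law of sqrt (kappa V) Z with Z a standard normal
    variable independent of V. *)

Require Import Defs.
From HB Require Import structures.
From mathcomp Require Import all_boot all_order all_algebra.
From mathcomp Require Import all_classical all_reals all_analysis.
From mathcomp Require Import measurable_realfun ring lra.
Import Order.TTheory GRing.Theory Num.Def Num.Theory.
Import numFieldNormedType.Exports.
Local Open Scope classical_set_scope.
Local Open Scope ring_scope.

Set Implicit Arguments.
Unset Strict Implicit.
Unset Printing Implicit Defensive.

(** * Elementary estimates *)

(** [W] depends on the whole future and the weights of the steps depend on n, so no single
    martingale carries the fluctuation. The horizon N removes [W], and the limits are taken in the
    order N, n, m: starting the weighted sum at m costs O(m / sqrt n), stopping it at N costs O((n /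
    N)^(mu - 1/2)), and freezing the conditional variance at time m costs a negative power of m.
    Freezing is what closes the telescoping: 1 - (S1_m / m)^2 is unaffected by later steps, so the
    Gaussian factor passes through every one-step mean. It is accurate because after m the squared
    drifts stay close to (S1_m / m)^2: for mu < 1 all of them tend to 0, for mu = 1 they share one
    limit. The phase t replaces complex numbers: t = 0 and t = - pi / 2 give the real and imaginary
    parts of the characteristic function. The constant is kappa = (1 + rho^2) / 4 * (1 / (2 mu + 1)
    + 1 / (2 mu - 1)), the two fractions being the normalised sums of squared weights before and
    after n. For mu = 1 it equals 2/3, whence the exponent - (1 - W^2) t^2 / 3. *)

Section elementary.
Context {R : realType}.
Implicit Types (x y a b r : R) (f : R -> R).

(** The Taylor bounds below follow by integrating one inequality at a time: each serves as the
    nonnegative derivative of the next. *)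
Lemma ge0_from_derive f (df : R -> R) x :
  (forall y, is_derive y 1 f (df y)) -> (forall y, 0 <= y -> 0 <= df y) ->
  0 <= f 0 -> 0 <= x -> 0 <= f x.
Proof.
move=> fdf df0 f0 x0.
have [c] : exists2 c, c \in `[0, x]%R & f x - f 0 = df c * (x - 0).
  apply: MVT_segment => //; apply: derivable_within_continuous => y _.
  by have [] := fdf y.
rewrite in_itv/= => /andP[c0 _] /eqP; rewrite subr_eq => /eqP ->.
by rewrite addr_ge0 // mulr_ge0 ?df0 // subr0.
Qed.

Lemma sin_le_id x : 0 <= x -> 0 <= x - sin x.
Proof.
apply: (@ge0_from_derive (fun x => x - sin x) (fun x => 1 - cos x)) => [y _|].
- by rewrite subr_ge0 cos_le1.
- by rewrite sin0 subr0.
Qed.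

Lemma cos_ge_quadratic x : 0 <= x -> 0 <= cos x - 1 + x ^+ 2 / 2.
Proof.
apply: (@ge0_from_derive (fun x => cos x - 1 + x ^+ 2 / 2)
  (fun x => x - sin x)) => [y|y|].
- by apply: is_derive_eq; rewrite /GRing.scale /=; lra.
- exact: sin_le_id.
- by rewrite cos0; lra.
Qed.

Lemma sin_ge_cubic x : 0 <= x -> 0 <= sin x - x + x ^+ 3 / 6.
Proof.
apply: (@ge0_from_derive (fun x => sin x - x + x ^+ 3 / 6)
  (fun x => cos x - 1 + x ^+ 2 / 2)) => [y|y|].
- by apply: is_derive_eq; rewrite /GRing.scale /=; lra.
- exact: cos_ge_quadratic.
- by rewrite sin0; lra.
Qed.

(** Starts a second chain, from [sin <= 1], which ends in the cubic upper bound of [cos]. *)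
Lemma cos_ge_linear x : 0 <= x -> 0 <= cos x - 1 + x.
Proof.
apply: (@ge0_from_derive (fun x => cos x - 1 + x) (fun x => 1 - sin x)) => [y|y _|].
- by apply: is_derive_eq; rewrite /GRing.scale /=; lra.
- by rewrite subr_ge0 sin_le1.
- by rewrite cos0; lra.
Qed.

Lemma sin_ge_quadratic x : 0 <= x -> 0 <= sin x - x + x ^+ 2 / 2.
Proof.
apply: (@ge0_from_derive (fun x => sin x - x + x ^+ 2 / 2)
  (fun x => cos x - 1 + x)) => [y|y|].
- by apply: is_derive_eq; rewrite /GRing.scale /=; lra.
- exact: cos_ge_linear.
- by rewrite sin0; lra.
Qed.

Lemma cos_le_cubic x : 0 <= x -> 0 <= 1 - x ^+ 2 / 2 + x ^+ 3 / 6 - cos x.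
Proof.
apply: (@ge0_from_derive (fun x => 1 - x ^+ 2 / 2 + x ^+ 3 / 6 - cos x)
  (fun x => sin x - x + x ^+ 2 / 2)) => [y|y|].
- by apply: is_derive_eq; rewrite /GRing.scale /=; lra.
- exact: sin_ge_quadratic.
- by rewrite cos0; lra.
Qed.

Lemma cos_taylor2 x : `|cos x - (1 - x ^+ 2 / 2)| <= `|x| ^+ 3 / 6.
Proof.
have cosE : cos x = cos `|x| by have [x0|x0] := leP 0 x; [rewrite ger0_norm|rewrite ltr0_norm// cosN].
have x2 : x ^+ 2 = `|x| ^+ 2 by rewrite real_normK ?num_real.
have := cos_ge_quadratic (normr_ge0 x); have := cos_le_cubic (normr_ge0 x).
have := exprn_ge0 3 (normr_ge0 x).
rewrite cosE x2; move: (`|x|) (cos `|x|) => u c.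
by move=> ? ? ?; rewrite ler_norml; apply/andP; split; lra.
Qed.

Lemma sin_taylor1 x : `|sin x - x| <= `|x| ^+ 3 / 6.
Proof.
wlog x0 : x / 0 <= x.
  move=> h; have [/h//|x0] := lerP 0 x.
  have := h (- x); rewrite sinN -opprD !normrN; apply; lra.
rewrite (ger0_norm x0).
have := sin_le_id x0; have := sin_ge_cubic x0; have := exprn_ge0 3 x0.
by move=> ? ? ?; rewrite ler_norml; apply/andP; split; lra.
Qed.

Lemma expRN_taylor1 a : 0 <= a -> `|expR (- a) - (1 - a)| <= a ^+ 2 / 2.
Proof.
move=> a0.
have := expR_ge1Dx (- a).
have : 0 <= 1 - a + a ^+ 2 / 2 - expR (- a).
  apply: (@ge0_from_derive (fun a => 1 - a + a ^+ 2 / 2 - expR (- a))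
    (fun a => expR (- a) - (1 - a))) a0 => [y|y _|].
  - by apply: is_derive_eq; rewrite /GRing.scale /=; lra.
  - by have := expR_ge1Dx (- y); lra.
  - by rewrite oppr0 expR0; lra.
by move=> ? ?; rewrite ler_norml; apply/andP; split; nra.
Qed.

Lemma expRN_lipschitz a b : 0 <= a -> 0 <= b -> `|expR (- a) - expR (- b)| <= `|a - b|.
Proof.
wlog ab : a b / a <= b.
  move=> h a0 b0; have [ab|/ltW ba] := leP a b; first exact: h.
  by rewrite distrC (distrC a); exact: h.
move=> a0 b0.
have ea : expR (- a) <= 1 by rewrite -(@expR0 R) ler_expR; lra.
have eb : expR (- b) = expR (- a) * expR (- (b - a)) by rewrite -expRD; congr expR; lra.
have := expR_ge1Dx (- (b - a)); have := expR_gt0 (- a).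
have : expR (- (b - a)) <= 1 by rewrite -(@expR0 R) ler_expR; lra.
rewrite eb; move: (expR (- a)) (expR (- (b - a))) ea => u v u1 v1 u0 v0.
have -> : `|a - b| = b - a by rewrite ler0_norm; lra.
have -> : `|u - u * v| = u * (1 - v).
  by rewrite ger0_norm; [lra|nra].
nra.
Qed.

(* Weighted AM-GM: the tangent of exp at [r * ln u], evaluated at [ln u] and at [0]. *)
Lemma powR_bernoulli_le1 u r : 0 < u -> 0 <= r <= 1 -> u `^ r <= 1 + r * (u - 1).
Proof.
move=> u0 /andP[r0 r1].
rewrite /powR gt_eqF // -{2}[u]lnK ?posrE //.
set L := ln u; set E := expR (r * L).
have h (y : R) : E * (1 + (y - r * L)) <= expR y.
  rewrite (_ : expR y = E * expR (y - r * L)); last by rewrite -expRD; congr expR; lra.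
  by rewrite ler_pM2l ?expR_gt0 // expR_ge1Dx.
have := h L; have := h 0; rewrite expR0 => h0 hL.
have := ler_wpM2l r0 hL; have := @ler_wpM2l _ (1 - r) _ _ _ h0.
rewrite subr_ge0 => /(_ r1); move: (expR L) => eL; nra.
Qed.

Lemma powR_bernoulli_ge1 u r : 0 < u -> 1 <= r -> 1 + r * (u - 1) <= u `^ r.
Proof.
move=> u0 r1; have r0 : 0 < r by lra.
have := @powR_bernoulli_le1 (u `^ r) r^-1 (powR_gt0 _ u0).
rewrite invr_ge0 (ltW r0) invf_le1 // r1 => /(_ isT).
rewrite -powRrM divff ?gt_eqF // powRr1 ?(ltW u0) // => h.
have := ler_wpM2l (ltW r0) h; rewrite mulrDr mulrA divff ?gt_eqF //.
move: (u `^ r) => v; lra.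
Qed.


End elementary.

(** * The expectation functional of the walk *)

Section walk.
Context {R : realType}.

(* The signs of all the steps of both walks, [true] standing for +1; only the indices from 1 up to
   the current time matter. *)
Definition state : Type := ((nat -> bool) * (nat -> bool))%type.
Implicit Types (w : state) (F G : state -> R).

Definition spin (b : bool) : R := if b then 1 else -1.

Definition pos1 (n : nat) w : R := \sum_(1 <= k < n.+1) spin (w.1 k).
Definition pos2 (n : nat) w : R := \sum_(1 <= k < n.+1) spin (w.2 k).

Definition push (n : nat) w (b c : bool) : state :=
  (fun i => if i == n then b else w.1 i, fun i => if i == n then c else w.2 i).

(** Measurability with respect to the first [n] steps, phrased as invariance under overwriting later
    ones. *)
Definition adapted (n : nat) F := forall w b c k, (n < k)%N -> F (push k w b c) = F w.

(* Mean of [g] at two independent centred signs, with [x] and [y] the means of the signs. *)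
Definition centred_mean (x y : R) (g : R -> R -> R) : R :=
  (1 + x) / 2 * ((1 + y) / 2) * g (1 - x) (1 - y) +
  (1 + x) / 2 * ((1 - y) / 2) * g (1 - x) (- 1 - y) +
  (1 - x) / 2 * ((1 + y) / 2) * g (- 1 - x) (1 - y) +
  (1 - x) / 2 * ((1 - y) / 2) * g (- 1 - x) (- 1 - y).

Lemma spin_norm b : `|spin b| = 1.
Proof. by case: b; rewrite /spin ?normrN normr1. Qed.

Lemma pos1_le n w : `|pos1 n w| <= n%:R.
Proof.
rewrite (le_trans (ler_norm_sum _ _ _))// (eq_bigr (fun=> 1)); last first.
  by move=> i _; rewrite spin_norm.
by rewrite big_const_nat iter_addr addr0 subn1.
Qed.

Lemma pos2_le n w : `|pos2 n w| <= n%:R.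
Proof. exact: (pos1_le n (w.2, w.1)). Qed.

Lemma pos1S n w : pos1 n.+1 w = pos1 n w + spin (w.1 n.+1).
Proof. by rewrite /pos1 big_nat_recr. Qed.

Lemma pos2S n w : pos2 n.+1 w = pos2 n w + spin (w.2 n.+1).
Proof. by rewrite /pos2 big_nat_recr. Qed.

Lemma pos1_adapted n : adapted n (pos1 n).
Proof.
move=> w b c k nk; apply: eq_big_nat => i /andP[_ ilt] /=.
by rewrite ltn_eqF // (leq_ltn_trans _ nk).
Qed.

Lemma pos2_adapted n : adapted n (pos2 n).
Proof.
move=> w b c k nk; apply: eq_big_nat => i /andP[_ ilt] /=.
by rewrite ltn_eqF // (leq_ltn_trans _ nk).
Qed.

Lemma adapted_leq n m F : (n <= m)%N -> adapted n F -> adapted m F.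
Proof. by move=> nm h w b c k mk; rewrite h // (leq_ltn_trans nm). Qed.

Context (a1 a2 : R) (start : state).
Context (a1_le1 : `|a1| <= 1) (a2_le1 : `|a2| <= 1).

(** The conditional mean of step [n + 1]: a uniformly chosen past step of the other walk has mean
    [pos2 n w / n], and keeping it with probability p1, reversing it otherwise, multiplies this by
    a1 = 2 p1 - 1. *)
Definition drift1 (n : nat) w : R := a1 * (pos2 n w / n%:R).
Definition drift2 (n : nat) w : R := a2 * (pos1 n w / n%:R).
Definition incr1 (n : nat) w : R := spin (w.1 n.+1) - drift1 n w.
Definition incr2 (n : nat) w : R := spin (w.2 n.+1) - drift2 n w.

(** The transition kernel: given the past, the two new signs are independent. *)
Definition step (n : nat) F w : R :=
  (1 + drift1 n w) / 2 * ((1 + drift2 n w) / 2) * F (push n.+1 w true true) +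
  (1 + drift1 n w) / 2 * ((1 - drift2 n w) / 2) * F (push n.+1 w true false) +
  (1 - drift1 n w) / 2 * ((1 + drift2 n w) / 2) * F (push n.+1 w false true) +
  (1 - drift1 n w) / 2 * ((1 - drift2 n w) / 2) * F (push n.+1 w false false).

(* Expectation over the first [n] steps; the first step of each walk is that of [start]. *)
Fixpoint walk_mean (n : nat) F : R :=
  if n is k.+1 then walk_mean k (if k is 0%N then F else step k F) else F start.

Local Notation E := walk_mean.

Lemma walk_meanS n F : (0 < n)%N -> E n.+1 F = E n (step n F).
Proof. by case: n. Qed.

Lemma avg_le1 n (s : R) : `|s| <= n%:R -> `|s / n%:R| <= 1.
Proof.
case: n => [|n] h; first by rewrite invr0 mulr0 normr0.
by rewrite normrM normfV normr_nat ler_pdivrMr ?ltr0n // mul1r.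
Qed.

Lemma drift1_le1 n w : `|drift1 n w| <= 1.
Proof. by rewrite normrM mulr_ile1 // avg_le1 // pos2_le. Qed.

Lemma drift2_le1 n w : `|drift2 n w| <= 1.
Proof. by rewrite normrM mulr_ile1 // avg_le1 // pos1_le. Qed.

Lemma drift1_adapted n : adapted n (drift1 n).
Proof. by move=> w b c k nk; rewrite /drift1 pos2_adapted. Qed.

Lemma drift2_adapted n : adapted n (drift2 n).
Proof. by move=> w b c k nk; rewrite /drift2 pos1_adapted. Qed.

Lemma incr1_push n w b c : incr1 n (push n.+1 w b c) = spin b - drift1 n w.
Proof. by rewrite /incr1 drift1_adapted //= eqxx. Qed.

Lemma incr2_push n w b c : incr2 n (push n.+1 w b c) = spin c - drift2 n w.
Proof. by rewrite /incr2 drift2_adapted //= eqxx. Qed.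

Lemma incr1_adapted n k : (n < k)%N -> adapted k (incr1 n).
Proof.
move=> nk w b c j kj; rewrite /incr1 drift1_adapted ?(ltn_trans nk) //=.
by rewrite ltn_eqF // (leq_ltn_trans nk).
Qed.

Lemma incr2_adapted n k : (n < k)%N -> adapted k (incr2 n).
Proof.
move=> nk w b c j kj; rewrite /incr2 drift2_adapted ?(ltn_trans nk) //=.
by rewrite ltn_eqF // (leq_ltn_trans nk).
Qed.

(** Reduces a one-step mean to an explicit four-term expression in the two centred signs, open to
    algebra and to pointwise bounds. *)
Lemma step_centred n F w g :
  (forall b c, F (push n.+1 w b c) = g (incr1 n (push n.+1 w b c)) (incr2 n (push n.+1 w b c))) ->
  step n F w = centred_mean (drift1 n w) (drift2 n w) g.
Proof. by move=> h; rewrite /step !h !incr1_push !incr2_push. Qed.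

Lemma step_const n F w v : (forall b c, F (push n.+1 w b c) = v) -> step n F w = v.
Proof. by move=> h; rewrite /step !h; lra. Qed.

Lemma centred_mean_le (x y : R) g h : `|x| <= 1 -> `|y| <= 1 ->
  (forall u v, `|u| <= 2 -> `|v| <= 2 -> g u v <= h u v) ->
  centred_mean x y g <= centred_mean x y h.
Proof.
rewrite !ler_norml => /andP[x0 x1] /andP[y0 y1] gh; rewrite /centred_mean.
have nn (z : R) : -1 <= z -> z <= 1 -> `|1 - z| <= 2 /\ `|-1 - z| <= 2.
  by move=> z0 z1; rewrite !ler_norml; split; lra.
have [? ?] := nn _ x0 x1; have [? ?] := nn _ y0 y1.
by rewrite !lerD // ler_wpM2l // ?gh // mulr_ge0 // mulr_ge0 //; lra.
Qed.

Lemma le_step n F G w : (forall w', F w' <= G w') -> step n F w <= step n G w.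
Proof.
have := drift1_le1 n w; have := drift2_le1 n w.
rewrite !ler_norml => /andP[y0 y1] /andP[x0 x1] FG; rewrite /step.
by rewrite !lerD // ler_wpM2l // mulr_ge0 // mulr_ge0 //; lra.
Qed.

Lemma le_walk_mean n F G : (forall w, F w <= G w) -> E n F <= E n G.
Proof.
elim: n F G => [|n IH] F G FG /=; first exact: FG.
by case: n IH => [|n] IH; apply: IH => // w; exact: le_step.
Qed.

Lemma eq_walk_mean n F G : (forall w, F w = G w) -> E n F = E n G.
Proof. by move=> FG; congr E; apply/funext. Qed.

Lemma walk_mean_lin n c F G : E n (fun w => c * F w + G w) = c * E n F + E n G.
Proof.
elim: n F G => [//|n IH] F G /=.
case: n IH => [|n] IH; first exact: IH.
by rewrite -IH; apply: eq_walk_mean => w; rewrite /step; lra.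
Qed.

Lemma walk_mean_cst n c : E n (fun=> c) = c.
Proof.
elim: n => [//|n IH] /=; case: n IH => [//|n] IH.
by rewrite -[RHS]IH; apply: eq_walk_mean => w; exact: step_const.
Qed.

Lemma walk_meanD n F G : E n (fun w => F w + G w) = E n F + E n G.
Proof.
rewrite -[E n F]mul1r -walk_mean_lin.
by apply: eq_walk_mean => w; rewrite mul1r.
Qed.

Lemma walk_meanZ n c F : E n (fun w => c * F w) = c * E n F.
Proof.
rewrite -[RHS]addr0 -[X in _ + X](walk_mean_cst n 0) -walk_mean_lin.
by apply: eq_walk_mean => w; rewrite addr0.
Qed.

Lemma walk_meanB n F G : E n (fun w => F w - G w) = E n F - E n G.
Proof.
rewrite addrC -mulN1r -walk_mean_lin.
by apply: eq_walk_mean => w; rewrite mulN1r addrC.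
Qed.

Lemma walk_mean_ge0 n F : (forall w, 0 <= F w) -> 0 <= E n F.
Proof. by move=> F0; rewrite -[leLHS](walk_mean_cst n); exact: le_walk_mean. Qed.

Lemma walk_mean_norm n F : `|E n F| <= E n (fun w => `|F w|).
Proof.
rewrite ler_norml; apply/andP; split; last by apply: le_walk_mean => w; rewrite ler_norm.
rewrite -mulN1r -walk_meanZ; apply: le_walk_mean => w.
by rewrite mulN1r lerNl ler_normr lexx orbT.
Qed.

Lemma walk_mean_sum (I : Type) (r : seq I) n (F : I -> state -> R) :
  E n (fun w => \sum_(i <- r) F i w) = \sum_(i <- r) E n (F i).
Proof.
elim: r => [|i r IH].
  by rewrite big_nil -[RHS](walk_mean_cst n); apply: eq_walk_mean => w; rewrite big_nil.
by rewrite big_cons -IH -walk_meanD; apply: eq_walk_mean => w; rewrite big_cons.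
Qed.

Lemma walk_mean_adapted m n F : (0 < m <= n)%N -> adapted m F -> E n F = E m F.
Proof.
move=> /andP[m0 /subnK <-] aF; elim: (n - m)%N => [//|k IH].
rewrite addSn walk_meanS ?addn_gt0 ?m0 ?orbT // -IH; apply: eq_walk_mean => w.
by apply: step_const => b c; rewrite aF // ltnS leq_addl.
Qed.

(** Stands in for Cauchy-Schwarz: [|x| <= x^2 / t + t], so a second moment of order t^2 gives a
    first moment of order t. *)
Lemma walk_mean_abs_le n F (t s : R) : 0 < t -> E n (fun w => F w ^+ 2) <= t ^+ 2 * s ->
  E n (fun w => `|F w|) <= t * (1 + s).
Proof.
move=> t0 h.
apply: (@le_trans _ _ (E n (fun w => t^-1 * F w ^+ 2 + t))).
  apply: le_walk_mean => w; rewrite -[X in X ^+ 2](mulr1) -(ler_pM2l t0) mulrDr.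
  rewrite mulrA divff ?gt_eqF // mul1r mulr1 -(real_normK (num_real (F w))).
  by have := sqr_ge0 (`|F w| - t); have := normr_ge0 (F w); nra.
rewrite walk_meanD walk_meanZ walk_mean_cst -(ler_pM2l t0) mulrDr mulrA divff ?gt_eqF //.
by rewrite mul1r; lra.
Qed.

(** * Weighted sums of centred steps *)

Section martingale.
Context (c1 c2 : nat -> R) (m : nat).
Context (m_gt0 : (0 < m)%N).

Definition mart (n : nat) w : R :=
  \sum_(m <= k < n) (c1 k * incr1 k w + c2 k * incr2 k w).

Lemma mart_adapted n : adapted n (mart n).
Proof.
move=> w b c k nk; apply: eq_big_nat => i /andP[_ ilt].
by rewrite (incr1_adapted ilt) // (incr2_adapted ilt).
Qed.

Lemma martS n w : (m <= n)%N -> mart n.+1 w = mart n w + (c1 n * incr1 n w + c2 n * incr2 n w).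
Proof. by move=> mn; rewrite /mart big_nat_recr. Qed.

(** Increments are orthogonal, and a centred sign has conditional variance [1 - drift^2 <= 1]. *)
Lemma mart_sqr_mean n : (m <= n)%N ->
  E n (fun w => mart n w ^+ 2) <= \sum_(m <= k < n) (c1 k ^+ 2 + c2 k ^+ 2).
Proof.
move=> /subnK <-; elim: (n - m)%N => [|j IH].
  rewrite add0n big_geq // (@eq_walk_mean _ _ (fun=> 0)) ?walk_mean_cst // => w.
  by rewrite /mart big_geq // expr0n.
have mj : (m <= j + m)%N by exact: leq_addl.
rewrite addSn big_nat_recr //; set n' := (j + m)%N in IH mj *.
rewrite walk_meanS ?(leq_trans m_gt0) //.
rewrite (le_trans _ (lerD IH (lexx _))) // -[X in _ <= _ + X](walk_mean_cst n') -walk_meanD.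
apply: le_walk_mean => w.
rewrite (@step_centred _ _ _ (fun u v => (mart n' w + (c1 n' * u + c2 n' * v)) ^+ 2)).
  rewrite /centred_mean.
  rewrite [leLHS](_ : _ = mart n' w ^+ 2 + (c1 n' ^+ 2 * (1 - drift1 n' w ^+ 2)
    + c2 n' ^+ 2 * (1 - drift2 n' w ^+ 2))); last by field.
  rewrite lerD2l lerD // ler_piMr ?sqr_ge0 // gerBl sqr_ge0 //.
by move=> b c; rewrite martS // mart_adapted.
Qed.

(* The variance [p^2 (1 - x^2) + q^2 (1 - y^2)] of the increment is compared with [V (p^2 + q^2)]. *)
Lemma cos_one_step (z V p q x y : R) : `|x| <= 1 -> `|y| <= 1 -> 0 <= V <= 1 ->
  `|centred_mean x y (fun u v => cos (z + (p * u + q * v)))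
    - cos z * expR (- (V * (p ^+ 2 + q ^+ 2) / 2))| <=
  8 / 3 * (`|p| + `|q|) ^+ 3 + (p ^+ 2 + q ^+ 2) ^+ 2 / 8 +
  (p ^+ 2 * `|V - (1 - x ^+ 2)| + q ^+ 2 * `|V - (1 - y ^+ 2)|) / 2.
Proof.
move=> x1 y1 /andP[V0 V1].
(* A centred sign is at most 2 in absolute value, so [|d| <= 2 (|p| + |q|)]; the cosine and sine
   expansions each cost [|d|^3 / 6]. *)
pose c3 := 8 / 3 * (`|p| + `|q|) ^+ 3.
(* Second-order expansion of [cos (z + d)]. Its sine term has mean zero since the signs are centred,
   and the cross term of the square vanishes by independence. *)
pose lin (u v : R) := cos z * (1 - (p * u + q * v) ^+ 2 / 2) - sin z * (p * u + q * v).
have lin_mean : centred_mean x y lin =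
    cos z * (1 - (p ^+ 2 * (1 - x ^+ 2) + q ^+ 2 * (1 - y ^+ 2)) / 2).
  by rewrite /centred_mean /lin; field.
have c1z : `|cos z| <= 1 by rewrite ler_norml cos_geN1 cos_le1.
have s1z : `|sin z| <= 1 by rewrite ler_norml sin_geN1 sin_le1.
have close (u v : R) : `|u| <= 2 -> `|v| <= 2 ->
    `|cos (z + (p * u + q * v)) - lin u v| <= c3.
  move=> u2 v2; rewrite cosD /lin; set d := p * u + q * v.
  have d_le : `|d| <= 2 * (`|p| + `|q|).
    rewrite (le_trans (ler_normD _ _)) // !normrM mulrDr.
    by rewrite lerD // mulrC ler_wpM2r.
  have d3 : `|d| ^+ 3 <= 8 * (`|p| + `|q|) ^+ 3.
    have -> : 8 * (`|p| + `|q|) ^+ 3 = (2 * (`|p| + `|q|)) ^+ 3 by ring.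
    by rewrite lerXn2r // nnegrE ?mulr_ge0 ?addr_ge0.
  have -> : cos z * cos d - sin z * sin d - (cos z * (1 - d ^+ 2 / 2) - sin z * d) =
    cos z * (cos d - (1 - d ^+ 2 / 2)) - sin z * (sin d - d) by ring.
  rewrite (le_trans (ler_normB _ _)) // !normrM.
  have := ler_pM (normr_ge0 _) (normr_ge0 _) c1z (cos_taylor2 d).
  have := ler_pM (normr_ge0 _) (normr_ge0 _) s1z (sin_taylor1 d).
  by rewrite /c3; lra.
have near_lin : `|centred_mean x y (fun u v => cos (z + (p * u + q * v)))
    - centred_mean x y lin| <= c3.
  have addc (e : R) : centred_mean x y (fun u v => lin u v + e) = centred_mean x y lin + e.
    by rewrite /centred_mean; field.
  rewrite ler_distl -(addc (- c3)) -(addc c3); apply/andP; split;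
  by apply: centred_mean_le => // u v u2 v2; have := close u v u2 v2; rewrite ler_distl => /andP[].
set Q := p ^+ 2 + q ^+ 2; have Q0 : 0 <= Q by rewrite addr_ge0 ?sqr_ge0.
have exp_err : `|cos z * (1 - V * Q / 2) - cos z * expR (- (V * Q / 2))| <= Q ^+ 2 / 8.
  rewrite -mulrBr normrM distrC.
  have VQ : 0 <= V * Q / 2 by rewrite divr_ge0 ?mulr_ge0.
  have := ler_pM (normr_ge0 _) (normr_ge0 _) c1z (expRN_taylor1 VQ).
  rewrite mul1r => /le_trans; apply.
  have : (V * Q) ^+ 2 <= Q ^+ 2 by rewrite lerXn2r ?nnegrE ?mulr_ge0 // ler_piMl.
  by rewrite expr_div_n; lra.
have var_err : `|centred_mean x y lin - cos z * (1 - V * Q / 2)| <=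
    (p ^+ 2 * `|V - (1 - x ^+ 2)| + q ^+ 2 * `|V - (1 - y ^+ 2)|) / 2.
  rewrite lin_mean -mulrBr normrM.
  have -> : 1 - (p ^+ 2 * (1 - x ^+ 2) + q ^+ 2 * (1 - y ^+ 2)) / 2 - (1 - V * Q / 2) =
    p ^+ 2 * (V - (1 - x ^+ 2)) / 2 + q ^+ 2 * (V - (1 - y ^+ 2)) / 2 by rewrite /Q; field.
  have h : `|p ^+ 2 * (V - (1 - x ^+ 2)) / 2 + q ^+ 2 * (V - (1 - y ^+ 2)) / 2| <=
    (p ^+ 2 * `|V - (1 - x ^+ 2)| + q ^+ 2 * `|V - (1 - y ^+ 2)|) / 2.
    have sq (a b : R) : `|a ^+ 2 * b / 2| = a ^+ 2 * `|b| / 2.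
      by rewrite 2!normrM (ger0_norm (sqr_ge0 _)) (ger0_norm (_ : 0 <= 2^-1)).
    by rewrite (le_trans (ler_normD _ _)) // !sq mulrDl.
  by have := ler_pM (normr_ge0 _) (normr_ge0 _) c1z h; rewrite mul1r.
rewrite (le_trans (ler_distD (centred_mean x y lin) _ _)) //.
have := ler_distD (cos z * (1 - V * Q / 2)) (centred_mean x y lin) (cos z * expR (- (V * Q / 2))).
by rewrite -/c3; lra.
Qed.

Definition avg1 (n : nat) w : R := pos1 n w / n%:R.

Lemma avg1_adapted n : adapted n (avg1 n).
Proof. by move=> w b c k nk; rewrite /avg1 pos1_adapted. Qed.

Lemma avg1_var_itv n w : 0 <= 1 - avg1 n w ^+ 2 <= 1.
Proof.
rewrite gerBl sqr_ge0 andbT subr_ge0 -(real_normK (num_real (avg1 n w))).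
by rewrite exprn_ile1 // avg_le1 // pos1_le.
Qed.

(** [Phi j] replaces the steps from j on by the Gaussian factor of their variance, computed with the
    value [V] frozen at m. It is the cosine of the full sum at j = N and a fixed cosine times the
    Gaussian factor at j = m. Since [V] and [rest] ignore the new step, passing from j + 1 to j
    costs one application of [cos_one_step]. *)
Lemma cos_mart_mean (N : nat) (th del : R) : (m <= N)%N ->
  (forall k, (m <= k < N)%N -> E k (fun w => `|drift1 k w ^+ 2 - avg1 m w ^+ 2|) <= del) ->
  (forall k, (m <= k < N)%N -> E k (fun w => `|drift2 k w ^+ 2 - avg1 m w ^+ 2|) <= del) ->
  `|E N (fun w => cos (th + mart N w)) - cos th *
     E m (fun w => expR (- ((1 - avg1 m w ^+ 2) * (\sum_(m <= k < N) (c1 k ^+ 2 + c2 k ^+ 2)) / 2)))|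
  <= \sum_(m <= k < N) (8 / 3 * (`|c1 k| + `|c2 k|) ^+ 3 + (c1 k ^+ 2 + c2 k ^+ 2) ^+ 2 / 8 +
        (c1 k ^+ 2 + c2 k ^+ 2) * del / 2).
Proof.
move=> mN h1 h2.
pose V w := 1 - avg1 m w ^+ 2.
pose rest j := \sum_(j <= k < N) (c1 k ^+ 2 + c2 k ^+ 2).
pose Phi j w := cos (th + mart j w) * expR (- (V w * rest j / 2)).
pose err k := 8 / 3 * (`|c1 k| + `|c2 k|) ^+ 3 + (c1 k ^+ 2 + c2 k ^+ 2) ^+ 2 / 8 +
        (c1 k ^+ 2 + c2 k ^+ 2) * del / 2.
have tele j : (m <= j <= N)%N -> `|E j (Phi j) - E m (Phi m)| <= \sum_(m <= k < j) err k.
  move=> /andP[/subnK <-]; elim: (j - m)%N => [|i IH] iN.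
    by rewrite add0n subrr normr0 big_geq.
  have mi : (m <= i + m)%N by exact: leq_addl.
  rewrite addSn in iN *; rewrite big_nat_recr //; set n := (i + m)%N in IH mi iN *.
  rewrite (le_trans (ler_distD (E n (Phi n)) _ _)) // addrC lerD //; first exact: IH (ltnW iN).
  rewrite walk_meanS ?(leq_trans m_gt0) // -walk_meanB.
  have restS : rest n = (c1 n ^+ 2 + c2 n ^+ 2) + rest n.+1 by rewrite /rest big_ltn.
  have ptw w : `|step n (Phi n.+1) w - Phi n w| <=
     8 / 3 * (`|c1 n| + `|c2 n|) ^+ 3 + (c1 n ^+ 2 + c2 n ^+ 2) ^+ 2 / 8 +
     (c1 n ^+ 2 / 2 * `|drift1 n w ^+ 2 - avg1 m w ^+ 2| +
     c2 n ^+ 2 / 2 * `|drift2 n w ^+ 2 - avg1 m w ^+ 2|).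
    set x := expR (- (V w * rest n.+1 / 2)).
    rewrite (@step_centred _ _ _ (fun u v => cos (th + mart n w + (c1 n * u + c2 n * v)) * x)); last first.
      move=> b c; rewrite /Phi /x martS // mart_adapted // addrA.
      by rewrite /V (adapted_leq mi (avg1_adapted (n := m))).
    have -> : centred_mean (drift1 n w) (drift2 n w)
        (fun u v => cos (th + mart n w + (c1 n * u + c2 n * v)) * x) =
      centred_mean (drift1 n w) (drift2 n w)
        (fun u v => cos (th + mart n w + (c1 n * u + c2 n * v))) * x.
      by rewrite /centred_mean; ring.
    have -> : Phi n w = cos (th + mart n w) *
       expR (- (V w * (c1 n ^+ 2 + c2 n ^+ 2) / 2)) * x.
      by rewrite /Phi /x -(mulrA (cos _)) -expRD restS; congr (_ * expR _); field.
    rewrite -mulrBl normrM.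
    have x1 : `|x| <= 1.
      have /andP[V0 _] := avg1_var_itv m w.
      rewrite /x ger0_norm ?expR_ge0 // -(@expR0 R) ler_expR oppr_le0 divr_ge0 // mulr_ge0 //.
      by apply: sumr_ge0 => k _; rewrite addr_ge0 ?sqr_ge0.
    rewrite (le_trans (ler_piMr (normr_ge0 _) x1)) //.
    rewrite (le_trans (cos_one_step _ _ _ (drift1_le1 n w) (drift2_le1 n w) (avg1_var_itv m w))) //.
    rewrite lerD2l.
    have dE (d : R) : 1 - avg1 m w ^+ 2 - (1 - d ^+ 2) = d ^+ 2 - avg1 m w ^+ 2 by ring.
    rewrite !dE; lra.
  rewrite (le_trans (walk_mean_norm _ _)) // (le_trans (le_walk_mean _ ptw)) //.
  rewrite walk_meanD walk_mean_cst walk_meanD !walk_meanZ /err lerD2l.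
  have nN : (m <= n < N)%N by rewrite mi iN.
  have := ler_wpM2l (sqr_ge0 (c1 n)) (h1 _ nN); have := ler_wpM2l (sqr_ge0 (c2 n)) (h2 _ nN).
  lra.
have := tele N; rewrite mN leqnn => /(_ isT).
rewrite (@eq_walk_mean N (Phi N) (fun w => cos (th + mart N w))); last first.
  by move=> w; rewrite /Phi /rest big_geq // mulr0 mul0r oppr0 expR0 mulr1.
rewrite (@eq_walk_mean m (Phi m) (fun w => cos th * expR (- (V w * rest m / 2)))); last first.
  by move=> w; rewrite /Phi /mart big_geq // addr0.
by rewrite walk_meanZ.
Qed.

End martingale.

End walk.

(** * Power sums *)

Section power_sums.
Context {R : realType}.
Implicit Types (r p mu : R) (k m n : nat).

Lemma natr_pos k : (0 < k)%N -> 0 < k%:R :> R.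
Proof. by rewrite ltr0n. Qed.

Lemma powR_natS r k : (0 < k)%N -> k.+1%:R `^ r = (1 + k%:R^-1) `^ r * k%:R `^ r.
Proof.
move=> k0; rewrite -powRM ?addr_ge0 ?invr_ge0 //; congr (_ `^ _).
by rewrite mulrDl mul1r mulVf ?gt_eqF ?natr_pos // -natr1 addrC.
Qed.

(** Bernoulli's inequality at 1 + 1/k and at its inverse brackets the ratio (k + 1)^mu / k^mu up to
    a relative error of order k^-2. *)
Lemma powR_step_bounds mu k : (0 < k)%N -> 0 <= mu <= 1 ->
  (1 + mu / k%:R) * (1 - mu / k%:R * (1 + k%:R^-1)^-1) >= 1 /\
  1 + mu * k%:R^-1 >= (1 + k%:R^-1) `^ mu /\
  ((1 + k%:R^-1) `^ mu)^-1 <= 1 - mu * (k%:R^-1 * (1 + k%:R^-1)^-1).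
Proof.
move=> k0 /andP[mu0 mu1]; have x0 : 0 < k%:R^-1 :> R by rewrite invr_gt0 natr_pos.
set x := k%:R^-1 in x0 *; have u0 : 0 < 1 + x by lra.
set y := (1 + x)^-1; have y0 : 0 < y by rewrite invr_gt0.
have xy : 1 - y = x * y.
  by rewrite /y; field; lra.
have h1 := @powR_bernoulli_le1 _ (1 + x) mu u0; rewrite mu0 mu1 in h1.
have h2 := @powR_bernoulli_le1 _ y mu y0; rewrite mu0 mu1 in h2.
have := h1 isT; have := h2 isT.
have -> : y `^ mu = ((1 + x) `^ mu)^-1.
  by rewrite /y -[X in X `^ mu]powR_inv1 ?(ltW u0) // -powRrM mulN1r powRN.
move=> {h1 h2} h2 h1; split; last by split; [lra|rewrite -xy; lra].
have -> : (1 + mu * x) * (1 - mu * x * y) = 1 + mu * x * (1 - y) - mu ^+ 2 * x ^+ 2 * y by ring.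
rewrite xy.
have : 0 <= mu * (1 - mu) * (x * x * y) by rewrite !mulr_ge0 //; lra.
by rewrite lerBrDr; lra.
Qed.

Lemma powR_step_le mu k : (0 < k)%N -> 0 <= mu <= 1 ->
  k.+1%:R `^ mu <= (1 + mu / k%:R) * k%:R `^ mu.
Proof.
by move=> k0 mu01; rewrite powR_natS // ler_wpM2r ?powR_ge0 //; have [_ []] := powR_step_bounds k0 mu01.
Qed.

Lemma powR_step_ge mu k : (0 < k)%N -> 0 <= mu <= 1 ->
  (1 + mu / k%:R) * k%:R `^ mu <= (1 + k%:R^-1 ^+ 2) * k.+1%:R `^ mu.
Proof.
move=> k0 mu01; have [_ [_ h]] := powR_step_bounds k0 mu01.
have x0 : 0 < k%:R^-1 :> R by rewrite invr_gt0 natr_pos.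
rewrite powR_natS // mulrA ler_wpM2r ?powR_ge0 //.
set x := k%:R^-1 in x0 h *; have u0 : 0 < 1 + x by lra.
rewrite -ler_pdivrMr ?powR_gt0 //.
have /andP[mu0 mu1] := mu01.
have m0 : 0 <= 1 + mu * x by rewrite addr_ge0 // mulr_ge0 // ltW.
rewrite (le_trans (ler_wpM2l m0 h)) //.
set y := (1 + x)^-1; have y0 : 0 < y by rewrite invr_gt0.
have xy : 1 - y = x * y by rewrite /y; field; lra.
have -> : (1 + mu * x) * (1 - mu * (x * y)) = 1 + mu * x * (1 - y) - mu ^+ 2 * x ^+ 2 * y by ring.
rewrite xy.
have y1 : y <= 1 by rewrite invf_le1 //; lra.
have q1 : x ^+ 2 * y <= x ^+ 2 by rewrite ler_piMr ?sqr_ge0.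
have q0 : 0 <= x ^+ 2 * y by rewrite mulr_ge0 ?sqr_ge0 // ltW.
have : mu * (x ^+ 2 * y) <= x ^+ 2 by apply: le_trans q1; rewrite ler_piMl.
have : 0 <= mu ^+ 2 * x ^+ 2 * y by rewrite !mulr_ge0 ?sqr_ge0 // ltW.
lra.
Qed.

(** Makes [k^mu * modeB k] almost a martingale: the power compensates the factor 1 - mu / k up to
    the summable relative error 2 / k^2. *)
Lemma powR_step_down mu k : (0 < k)%N -> 0 <= mu <= 1 ->
  `|k.+1%:R `^ mu * (1 - mu / k%:R) - k%:R `^ mu| <= 2 * k%:R^-1 ^+ 2 * k%:R `^ mu.
Proof.
move=> k0 mu01; have [_ [h1 h2]] := powR_step_bounds k0 mu01.
have x0 : 0 < k%:R^-1 :> R by rewrite invr_gt0 natr_pos.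
have x1 : k%:R^-1 <= 1 :> R by rewrite invf_le1 ?natr_pos // ler1n.
rewrite powR_natS //; have p0 := powR_gt0 mu (natr_pos k0).
set x := k%:R^-1 in x0 x1 h1 h2 *; have u0 : 0 < 1 + x by lra.
have /andP[mu0 mu1] := mu01.
have X0 := powR_gt0 mu u0; set X := (1 + x) `^ mu in X0 h1 h2 *.
have -> : X * k%:R `^ mu * (1 - mu * x) - k%:R `^ mu = (X * (1 - mu * x) - 1) * k%:R `^ mu by ring.
rewrite normrM (gtr0_norm p0) ler_pM2r //.
set y := (1 + x)^-1 in h2; have y0 : 0 < y by rewrite invr_gt0.
have y1 : y <= 1 by rewrite invf_le1 //; lra.
have xy : 1 - y = x * y by rewrite /y; field; lra.
have mx : mu * x <= 1 by rewrite mulr_ile1 // ltW.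
have mx0 : 0 <= mu * x by rewrite mulr_ge0 // ltW.
have X1 : 1 + mu * x * y <= X.
  have : 1 <= (1 - mu * (x * y)) * X by rewrite -ler_pdivrMr // div1r.
  have : 0 <= mu * x * y by rewrite mulr_ge0 // ltW.
  have : mu * x * y <= 1 by rewrite mulr_ile1 // ltW.
  set z := mu * x * y; have -> : mu * (x * y) = z by rewrite mulrA.
  move=> z1 z0 hX; have : 0 <= (X - 1) * (1 - z) - z + (X - 1) * z + z ^+ 2; nra.
have t0 : 0 <= 1 - mu * x by lra.
have up := ler_wpM2r t0 h1; have dn := ler_wpM2r t0 X1.
have e1 : (1 + mu * x) * (1 - mu * x) = 1 - (mu * x) ^+ 2 by ring.
have e2 : (1 + mu * x * y) * (1 - mu * x) = 1 - mu * x * (1 - y) - mu ^+ 2 * x ^+ 2 * y by ring.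
have q1 : x ^+ 2 * y <= x ^+ 2 by rewrite ler_piMr ?sqr_ge0.
have q0 : 0 <= x ^+ 2 * y by rewrite mulr_ge0 ?sqr_ge0 // ltW.
have b1 : mu * (x ^+ 2 * y) <= x ^+ 2 by apply: le_trans q1; rewrite ler_piMl.
have b2 : mu ^+ 2 * (x ^+ 2 * y) <= x ^+ 2.
  by apply: le_trans q1; rewrite ler_piMl // exprn_ile1.
rewrite ler_norml; apply/andP; split; last by have := sqr_ge0 (mu * x); have := sqr_ge0 x; lra.
by move: dn; rewrite e2 xy; lra.
Qed.

Lemma powR_mulr p k : 0 < p -> k%:R `^ (p + 1) = k%:R * k%:R `^ p :> R.
Proof. by move=> p0; rewrite -(@mulr_powRB1 _ _ (p + 1)) ?addrK //; lra. Qed.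

(** Tangent to the convex function x^(p+1) at k. With its companion, the tangent at k + 1, it
    replaces the comparison of a sum with an integral. *)
Lemma powR_diff_ge p k : 0 < p ->
  (p + 1) * k%:R `^ p <= k.+1%:R `^ (p + 1) - k%:R `^ (p + 1).
Proof.
case: k => [|k] p0.
  by rewrite !powR0 ?gt_eqF //; [rewrite mulr0 subr0 powR1 |lra].
have p1 : 1 <= p + 1 by lra.
have x0 : 0 < k.+1%:R^-1 :> R by rewrite invr_gt0 natr_pos.
have u0 : 0 < 1 + k.+1%:R^-1 :> R by rewrite addr_gt0.
rewrite (@powR_natS (p + 1) k.+1) //.
have := ler_wpM2r (powR_ge0 k.+1%:R (p + 1)) (powR_bernoulli_ge1 u0 p1).
rewrite mulrDl.
have -> : (p + 1) * (1 + k.+1%:R^-1 - 1) * k.+1%:R `^ (p + 1) = (p + 1) * k.+1%:R `^ p.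
  have k1 : k.+1%:R != 0 :> R by rewrite pnatr_eq0.
  rewrite powR_mulr //; move: (k.+1%:R `^ p) => v.
  by move: (k.+1%:R : R) k1 => t t0; field.
lra.
Qed.

Lemma powR_diff_le p k : 0 < p ->
  k.+1%:R `^ (p + 1) - k%:R `^ (p + 1) <= (p + 1) * k.+1%:R `^ p.
Proof.
case: k => [|k] p0.
  by rewrite (@powR0 _ (p + 1)) ?gt_eqF //; [rewrite subr0 !powR1 //; lra|lra].
have p1 : 1 <= p + 1 by lra.
have K0 : 0 < k.+2%:R :> R by rewrite natr_pos.
have u0 : 0 < k.+1%:R / k.+2%:R :> R by rewrite divr_gt0 ?natr_pos.
have := ler_wpM2r (powR_ge0 k.+2%:R (p + 1)) (powR_bernoulli_ge1 u0 p1).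
rewrite -powRM // ?divr_ge0 // mulfVK ?gt_eqF // mulrDl.
have -> : (p + 1) * (k.+1%:R / k.+2%:R - 1) * k.+2%:R `^ (p + 1) = - ((p + 1) * k.+2%:R `^ p).
  have k1 : k.+1%:R + 1 != 0 :> R by rewrite natr1 pnatr_eq0.
  rewrite powR_mulr //; move: (k.+2%:R `^ p) => v; rewrite -(natr1 k.+1).
  by move: (k.+1%:R : R) k1 => t t0; field.
lra.
Qed.

Lemma sum_powR_ge p m n : 0 < p -> (m <= n)%N ->
  n%:R `^ (p + 1) - m%:R `^ (p + 1) <= (p + 1) * \sum_(m <= k < n) k.+1%:R `^ p.
Proof.
move=> p0 mn; rewrite -(telescope_sumr (fun k => k%:R `^ (p + 1)) mn) mulr_sumr.
by apply: ler_sum => k _; exact: powR_diff_le.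
Qed.

Lemma sum_powR_le p m n : 0 < p -> (m <= n)%N ->
  (p + 1) * \sum_(m <= k < n) k.+1%:R `^ p <= n%:R `^ (p + 1) + (p + 1) * n%:R `^ p.
Proof.
move=> p0 mn.
have -> : \sum_(m <= k < n) k.+1%:R `^ p =
   \sum_(m <= k < n) k%:R `^ p + (n%:R `^ p - m%:R `^ p) :> R.
  rewrite -(telescope_sumr (fun k => k%:R `^ p) mn) -big_split /=.
  by apply: eq_bigr => k _; rewrite addrC subrK.
have h : (p + 1) * \sum_(m <= k < n) k%:R `^ p <= n%:R `^ (p + 1) - m%:R `^ (p + 1).
  rewrite -(telescope_sumr (fun k => k%:R `^ (p + 1)) mn) mulr_sumr.
  by apply: ler_sum => k _; exact: powR_diff_ge.
have := powR_ge0 (m%:R : R) (p + 1).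
have p1 : 0 <= p + 1 by lra.
have := mulr_ge0 p1 (powR_ge0 (m%:R : R) p).
by rewrite mulrDr mulrBr; lra.
Qed.

Lemma powRN_mulr r k : (0 < k)%N -> k%:R `^ (- (1 + r)) = k%:R `^ (- r) / k%:R :> R.
Proof.
move=> k0; rewrite opprD addrC powRD ?powR_inv1 //.
by rewrite pnatr_eq0 -lt0n k0 implybT.
Qed.

(** The same comparison for the decreasing power x^(-r), by Bernoulli's inequality at k / (k +
    1). *)
Lemma powRN_diff_ge r k : (0 < k)%N -> 0 < r <= 1 ->
  r * k.+1%:R `^ (- (1 + r)) <= k%:R `^ (- r) - k.+1%:R `^ (- r).
Proof.
move=> k0 /andP[r0 r1]; rewrite powRN_mulr //.
have K0 : 0 < k.+1%:R :> R by rewrite natr_pos.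
have u0 : 0 < k%:R / k.+1%:R :> R by rewrite divr_gt0 ?natr_pos.
have := @powR_bernoulli_le1 _ _ r u0; rewrite (ltW r0) r1 => /(_ isT).
rewrite powRM ?invr_ge0 // -powR_inv1 // -powRrM mulN1r.
have -> : 1 + r * (k%:R * k.+1%:R `^ (-1) - 1) = 1 - r / k.+1%:R :> R.
  by rewrite powR_inv1 // -(natr1 k); field; rewrite natr1 pnatr_eq0.
rewrite !powRN ?powRr1 //; set a := k%:R `^ r; set b := k.+1%:R `^ r.
have a0 : 0 < a by rewrite powR_gt0 // natr_pos.
have b0 : 0 < b by rewrite powR_gt0.
set t := r / k.+1%:R => h.
have t0 : 0 < t by rewrite divr_gt0.
have -> : r * (b^-1 / k.+1%:R) = b^-1 * t by rewrite /t; ring.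
rewrite lerBrDr -[X in _ + X]mulr1 -mulrDr.
have -> : a^-1 = b^-1 * (a / b)^-1 by field; rewrite !gt_eqF.
have ab : 0 < a / b by rewrite divr_gt0.
rewrite ler_pM2l ?invr_gt0 // -(ler_pM2r ab) mulVf ?gt_eqF //.
nra.
Qed.

Lemma powRN_diff_le r k : (0 < k)%N -> 0 < r <= 1 ->
  k%:R `^ (- r) - k.+1%:R `^ (- r) <= r * k%:R `^ (- (1 + r)).
Proof.
move=> k0 /andP[r0 r1]; rewrite powRN_mulr //.
have K0 : 0 < k%:R :> R by rewrite natr_pos.
have x0 : 0 < k%:R^-1 :> R by rewrite invr_gt0.
have u0 : 0 < 1 + k%:R^-1 :> R by lra.
have := @powR_bernoulli_le1 _ _ r u0; rewrite (ltW r0) r1 => /(_ isT).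
rewrite !powRN powR_natS //; set a := k%:R `^ r; set X := (1 + k%:R^-1) `^ r.
have a0 : 0 < a by rewrite powR_gt0.
have X0 : 0 < X by rewrite powR_gt0.
rewrite addrAC subrr add0r invfM; set t := r / k%:R => h.
have -> : r * (a^-1 / k%:R) = t * a^-1 by rewrite /t; ring.
rewrite -[X in X - _]mul1r -mulrBl ler_pM2r ?invr_gt0 //.
rewrite lerBlDr -lerBlDl -(ler_pM2r X0) mulVf ?gt_eqF //.
have t0 : 0 < t by rewrite mulr_gt0.
nra.
Qed.

Lemma sum_powRN_le r m n : (0 < m)%N -> (m <= n)%N -> 0 < r <= 1 ->
  r * \sum_(m <= k < n) k.+1%:R `^ (- (1 + r)) <= m%:R `^ (- r) - n%:R `^ (- r).
Proof.
move=> m0 mn r01; rewrite -opprB -(telescope_sumr (fun k => k%:R `^ (- r)) mn) mulr_sumr -sumrN.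
rewrite big_nat_cond [leRHS]big_nat_cond; apply: ler_sum => k /andP[/andP[mk _] _].
by rewrite opprB powRN_diff_ge // (leq_trans m0).
Qed.

Lemma sum_powRN_ge r m n : (0 < m)%N -> (m <= n)%N -> 0 < r <= 1 ->
  m%:R `^ (- r) - n%:R `^ (- r) - r * m%:R `^ (- (1 + r)) <=
  r * \sum_(m <= k < n) k.+1%:R `^ (- (1 + r)).
Proof.
move=> m0 mn r01.
have -> : \sum_(m <= k < n) k.+1%:R `^ (- (1 + r)) =
   \sum_(m <= k < n) k%:R `^ (- (1 + r)) + (n%:R `^ (- (1 + r)) - m%:R `^ (- (1 + r))) :> R.
  rewrite -(telescope_sumr (fun k => k%:R `^ (- (1 + r))) mn) -big_split /=.
  by apply: eq_bigr => k _; rewrite addrC subrK.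
have h : m%:R `^ (- r) - n%:R `^ (- r) <= r * \sum_(m <= k < n) k%:R `^ (- (1 + r)).
  rewrite -opprB -(telescope_sumr (fun k => k%:R `^ (- r)) mn) mulr_sumr -sumrN.
  rewrite big_nat_cond [leRHS]big_nat_cond; apply: ler_sum => k /andP[/andP[mk _] _].
  by rewrite opprB powRN_diff_le // (leq_trans m0).
have /andP[r0 _] := r01.
have := mulr_ge0 (ltW r0) (powR_ge0 (n%:R : R) (- (1 + r))).
by rewrite mulrDr mulrBr; lra.
Qed.

(** For k >= 1 one has 1 / k^2 <= 2 / k - 2 / (k + 1), which telescopes. *)
Lemma sum_inv_sqr_le m n : (0 < m)%N -> \sum_(m <= k < n) k%:R^-1 ^+ 2 <= 2 / m%:R :> R.
Proof.
move=> m0; have [nm|mn] := leqP n m; first by rewrite big_geq // divr_ge0.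
rewrite (@le_trans _ _ (\sum_(m <= k < n) (- (2 / k.+1%:R) - - (2 / k%:R)))) //; last first.
  rewrite (telescope_sumr (fun k => - (2 / k%:R)) (ltnW mn)) opprK gerDr oppr_le0.
  by rewrite divr_ge0.
rewrite big_nat_cond [leRHS]big_nat_cond; apply: ler_sum => k /andP[/andP[mk _] _].
have k0 : 1 <= k%:R :> R by rewrite ler1n (leq_trans m0).
rewrite -(natr1 k); set t := k%:R in k0 *.
have t0 : t != 0 by lra.
have t1 : t + 1 != 0 by lra.
rewrite -subr_ge0 [leRHS](_ : _ = (t - 1) / (t ^+ 2 * (t + 1))); last by field; rewrite ?t0 ?t1.
by rewrite divr_ge0 ?mulr_ge0 ?sqr_ge0 //; lra.
Qed.

End power_sums.

(** * Moments and fluctuations of the walk *)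

Section walk_estimates.
Context {R : realType} (a1 a2 mu rho : R) (start : state).
Context (a1_le1 : `|a1| <= 1) (a2_le1 : `|a2| <= 1).
Context (mu_gt : 2^-1 < mu) (mu_le1 : mu <= 1).
Context (a1E : a1 = rho * mu) (a2E : rho * a2 = mu).
Implicit Types (k m n N : nat) (w : state).

Local Notation E := (walk_mean a1 a2 start).
Local Notation inc1 := (incr1 a1).
Local Notation inc2 := (incr2 a2).

Definition growth k : R := k%:R `^ mu.
Definition excess k : R := k%:R `^ (mu - 2^-1).
Definition root k : R := k%:R `^ 2^-1.

Local Notation pw := growth.
Local Notation h := excess.
Local Notation sq := root.
Local Notation v := (1 + rho ^+ 2).

Lemma mu_gt0 : 0 < mu. Proof. by have := mu_gt; lra. Qed.

Lemma mu_ge0 : 0 <= mu <= 1. Proof. by rewrite mu_le1 (ltW mu_gt0). Qed.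

Lemma mu2_itv : 0 < 2 * mu - 1 <= 1.
Proof. by apply/andP; split; [have := mu_gt|have := mu_le1]; lra. Qed.

Lemma mu2_gt0 : 0 < 2 * mu - 1. Proof. by case/andP: mu2_itv. Qed.

Lemma growth_gt0 k : (0 < k)%N -> 0 < pw k.
Proof. by move=> k0; rewrite powR_gt0 // natr_pos. Qed.

Lemma excess_gt0 k : (0 < k)%N -> 0 < h k.
Proof. by move=> k0; rewrite powR_gt0 // natr_pos. Qed.

Lemma root_gt0 k : (0 < k)%N -> 0 < sq k.
Proof. by move=> k0; rewrite powR_gt0 // natr_pos. Qed.

Lemma root_sqr k : sq k ^+ 2 = k%:R.
Proof. by rewrite /root powR12_sqrt // sqr_sqrtr. Qed.

Lemma growthE k : pw k = h k * sq k.
Proof. by rewrite /growth /excess /root -powRD ?subrK // (gt_eqF mu_gt0). Qed.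

Lemma powR_mono (r : R) m n : 0 <= r -> (m <= n)%N -> m%:R `^ r <= n%:R `^ r :> R.
Proof. by move=> r0 mn; rewrite ge0_ler_powR // ?nnegrE // ler_nat. Qed.

Lemma growth_mono m n : (m <= n)%N -> pw m <= pw n.
Proof. exact/powR_mono/ltW/mu_gt0. Qed.

Lemma excess_mono m n : (m <= n)%N -> h m <= h n.
Proof. by apply: powR_mono; have := mu_gt; lra. Qed.

Lemma root_mono m n : (m <= n)%N -> sq m <= sq n.
Proof. by apply: powR_mono; lra. Qed.

Lemma excess_le_root k : (0 < k)%N -> h k <= sq k.
Proof. by move=> k0; apply: ler_powR; rewrite ?ler1n //; have := mu_le1; lra. Qed.

Lemma root_ge1 k : (0 < k)%N -> 1 <= sq k.
Proof. by move=> /root_mono; apply: le_trans; rewrite /root powR1. Qed.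

Lemma root_le k : (0 < k)%N -> sq k <= k%:R.
Proof. by move=> k0; rewrite -root_sqr expr2 ler_peMl ?root_ge1 // ltW ?root_gt0. Qed.

Lemma growth_sqr k : pw k ^+ 2 = k%:R `^ (2 * mu).
Proof. by rewrite /growth -powR_mulrn ?powR_ge0 // -powRrM mulrC. Qed.

Lemma excess_sqr k : h k ^+ 2 = k%:R `^ (2 * mu - 1).
Proof. by rewrite /excess -powR_mulrn ?powR_ge0 // -powRrM; congr (_ `^ _); lra. Qed.

Lemma sum_growth_sqr_ge m n : (m <= n)%N ->
  n%:R * pw n ^+ 2 - m%:R * pw m ^+ 2 <= (2 * mu + 1) * \sum_(m <= k < n) pw k.+1 ^+ 2.
Proof.
move=> mn; have p0 : 0 < 2 * mu by have := mu_gt0; lra.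
by have := sum_powR_ge p0 mn; rewrite !powR_mulr // (eq_bigr _ (fun k _ => growth_sqr k.+1)) -!growth_sqr.
Qed.

Lemma sum_growth_sqr_le m n : (m <= n)%N ->
  (2 * mu + 1) * \sum_(m <= k < n) pw k.+1 ^+ 2 <= n%:R * pw n ^+ 2 + (2 * mu + 1) * pw n ^+ 2.
Proof.
move=> mn; have p0 : 0 < 2 * mu by have := mu_gt0; lra.
by have := sum_powR_le p0 mn; rewrite !powR_mulr // (eq_bigr _ (fun k _ => growth_sqr k.+1)) -!growth_sqr.
Qed.

Lemma growth_sqrV k : pw k ^- 2 = k%:R `^ (- (1 + (2 * mu - 1))).
Proof. by rewrite growth_sqr -powRN; congr (_ `^ _); lra. Qed.

Lemma sum_growth_sqrV_le m n : (0 < m)%N -> (m <= n)%N ->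
  (2 * mu - 1) * \sum_(m <= k < n) pw k.+1 ^- 2 <= h m ^- 2 - h n ^- 2.
Proof.
move=> m0 mn; have r0 := mu2_itv.
have := sum_powRN_le m0 mn r0.
by rewrite (eq_bigr _ (fun k _ => growth_sqrV k.+1)) !excess_sqr -!powRN.
Qed.

Lemma sum_growth_sqrV_ge m n : (0 < m)%N -> (m <= n)%N ->
  h m ^- 2 - h n ^- 2 - (2 * mu - 1) * pw m ^- 2 <=
  (2 * mu - 1) * \sum_(m <= k < n) pw k.+1 ^- 2.
Proof.
move=> m0 mn; have r0 := mu2_itv.
have := sum_powRN_ge m0 mn r0.
by rewrite (eq_bigr _ (fun k _ => growth_sqrV k.+1)) !excess_sqr growth_sqrV -!powRN.
Qed.

(** As k + 1 <= 2 k, the summand k^(-3/2) is at most 4 (k + 1)^(-3/2), and the latter sum is at most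
    2. This bounds the accumulated defect of [modeB], whose mean size at time k is of order
    [root k]. *)
Lemma sum_root_le m n : (0 < m)%N -> \sum_(m <= k < n) k%:R^-1 ^+ 2 * sq k <= 8.
Proof.
move=> m0; have [nm|mn] := leqP n m; first by rewrite big_geq.
have r0 : 0 < (2^-1 : R) <= 1 by apply/andP; split; lra.
have := sum_powRN_le m0 (ltnW mn) r0; set S := \sum_(m <= k < n) _ => hS.
have S2 : S <= 2.
  have := powR_ge0 (n%:R : R) (- 2^-1).
  have : m%:R `^ (- 2^-1) <= 1 :> R.
    by rewrite powRN invf_le1 ?root_ge1 // root_gt0.
  lra.
rewrite (@le_trans _ _ (4 * S)) //; last lra.
rewrite mulr_sumr big_nat_cond [leRHS]big_nat_cond; apply: ler_sum => k /andP[/andP[mk _] _].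
have k0 : (0 < k)%N by rewrite (leq_trans m0).
rewrite powRN_mulr // powRN -/(root k.+1) -(root_sqr k) -(root_sqr k.+1).
have s0 := root_gt0 k0; have s1 := root_gt0 (isT : (0 < k.+1)%N).
have s2 : sq k.+1 ^+ 2 <= (2 * sq k) ^+ 2.
  by rewrite exprMn !root_sqr -natr1; have : 1 <= k%:R :> R; [rewrite ler1n|lra].
have s3 : sq k.+1 ^+ 2 <= 2 * sq k ^+ 2.
  by rewrite !root_sqr -natr1; have : 1 <= k%:R :> R; [rewrite ler1n|lra].
have s4 : sq k.+1 <= 2 * sq k by rewrite -(@ler_pXn2r _ 2) ?nnegrE // ?mulr_ge0 // ltW.
move: (sq k) (sq k.+1) s0 s1 s3 s4 => s t s0 t0 h3 h4.
have -> : (s ^+ 2)^-1 ^+ 2 * s = (s ^+ 3)^-1 by field; rewrite gt_eqF.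
have -> : 4 * (t^-1 / t ^+ 2) = 4 / t ^+ 3 by field; rewrite gt_eqF.
rewrite ler_pdivlMr ?exprn_gt0 // mulrC ler_pdivrMr ?exprn_gt0 //.
have := ler_pM (ltW t0) (sqr_ge0 t) h4 h3.
have -> : t * t ^+ 2 = t ^+ 3 by ring.
by have -> : 2 * s * (2 * s ^+ 2) = 4 * s ^+ 3 by ring.
Qed.

(** The vectors (1, rho) and (1, - rho) are left eigenvectors of the drift matrix with rows (0, a1)
    and (a2, 0), for the eigenvalues mu and - mu; this is the content of [a1E] and [a2E]. *)
Definition modeA k w : R := pos1 k w + rho * pos2 k w.
Definition modeB k w : R := pos1 k w - rho * pos2 k w.
Definition scaledA k w : R := modeA k w / pw k.

Lemma modeA_adapted k : adapted k (modeA k).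
Proof. by move=> w b c j kj; rewrite /modeA pos1_adapted // pos2_adapted. Qed.

Lemma modeB_adapted k : adapted k (modeB k).
Proof. by move=> w b c j kj; rewrite /modeB pos1_adapted // pos2_adapted. Qed.

Lemma scaledA_adapted k : adapted k (scaledA k).
Proof. by move=> w b c j kj; rewrite /scaledA modeA_adapted. Qed.

Lemma modeAS k w : (0 < k)%N ->
  modeA k.+1 w = (1 + mu / k%:R) * modeA k w + (inc1 k w + rho * inc2 k w).
Proof.
move=> k0; rewrite /modeA pos1S pos2S /incr1 /incr2 /drift1 /drift2 -a2E a1E -a2E; ring.
Qed.

Lemma modeBS k w : (0 < k)%N ->
  modeB k.+1 w = (1 - mu / k%:R) * modeB k w + (inc1 k w - rho * inc2 k w).
Proof.
move=> k0; rewrite /modeB pos1S pos2S /incr1 /incr2 /drift1 /drift2 -a2E a1E -a2E; ring.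
Qed.

Lemma step_sqr_le n (F : state -> R) w z c1 c2 :
  (forall b c, F (push n.+1 w b c) = z + (c1 * inc1 n (push n.+1 w b c) +
     c2 * inc2 n (push n.+1 w b c))) ->
  step a1 a2 n (fun w => F w ^+ 2) w <= z ^+ 2 + (c1 ^+ 2 + c2 ^+ 2).
Proof.
move=> FE; rewrite (@step_centred _ _ _ _ _ _ (fun x y => (z + (c1 * x + c2 * y)) ^+ 2)); last first.
  by move=> b c; rewrite FE.
rewrite /centred_mean [leLHS](_ : _ = z ^+ 2 + (c1 ^+ 2 * (1 - drift1 a1 n w ^+ 2)
    + c2 ^+ 2 * (1 - drift2 a2 n w ^+ 2))); last by field.
by rewrite lerD2l lerD // ler_piMr ?sqr_ge0 // gerBl sqr_ge0.
Qed.

(** Parallelogram identity for the two signs of the first step. *)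
Lemma mode1_sqr_le (e : R) w : e ^+ 2 = rho ^+ 2 -> (pos1 1 w + e * pos2 1 w) ^+ 2 <= 2 * v.
Proof.
move=> e2; rewrite /pos1 /pos2 !big_nat1.
have s2 b : spin b ^+ 2 = 1 :> R by case: b; rewrite /spin ?sqrrN expr1n.
have -> (p q : R) : (p + e * q) ^+ 2 = 2 * (p ^+ 2 + e ^+ 2 * q ^+ 2) - (p - e * q) ^+ 2 by ring.
by rewrite !s2 e2; have := sqr_ge0 (spin (w.1 1%N) - e * spin (w.2 1%N)); lra.
Qed.

(** The factor 1 - mu / k lies in [0, 1], so a step adds at most its own noise to the second
    moment. *)
Lemma modeB_sqr_mean k : (0 < k)%N -> E k (fun w => modeB k w ^+ 2) <= k%:R * (2 * v).
Proof.
case: k => // k _; elim: k => [|k IH].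
  rewrite mul1r -[leRHS](walk_mean_cst a1 a2 start 1); apply: le_walk_mean => // w.
  by rewrite /modeB -mulNr; apply: mode1_sqr_le; rewrite sqrrN.
rewrite walk_meanS // (@le_trans _ _ (E k.+1 (fun w => modeB k.+1 w ^+ 2 + v))) //.
  apply: le_walk_mean => // w.
  rewrite (le_trans (@step_sqr_le _ _ _ ((1 - mu / k.+1%:R) * modeB k.+1 w) 1 (- rho) _)) //.
    by move=> b c; rewrite modeBS // modeB_adapted // mul1r mulNr.
  rewrite expr1n sqrrN lerD2r exprMn ler_piMl ?sqr_ge0 // exprn_ile1 //.
    rewrite subr_ge0 ler_pdivrMr ?natr_pos // mul1r (le_trans mu_le1) // ler1n //.
  by rewrite gerBl divr_ge0 // ltW ?mu_gt0.
rewrite walk_meanD walk_mean_cst -(natr1 k.+1) mulrDl lerD //.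
by have := sqr_ge0 rho; lra.
Qed.

(** The defect of [scaledA] as a martingale. It differs from 1 because the normalisation is the
    power k^mu and not the product of the factors 1 + mu / i. *)
Definition drift_ratio k : R := (1 + mu / k%:R) * pw k / pw k.+1.

Lemma drift_ratio_itv k : (0 < k)%N -> 0 <= drift_ratio k - 1 <= k%:R^-1 ^+ 2.
Proof.
move=> k0; rewrite subr_ge0 lerBlDl /drift_ratio.
rewrite ler_pdivlMr ?growth_gt0 // mul1r ler_pdivrMr ?growth_gt0 //.
by rewrite powR_step_le ?powR_step_ge // mu_ge0.
Qed.

Lemma scaledAS k w : (0 < k)%N ->
  scaledA k.+1 w = drift_ratio k * scaledA k w +
    ((pw k.+1)^-1 * inc1 k w + rho / pw k.+1 * inc2 k w).
Proof.
move=> k0; rewrite /scaledA modeAS // /drift_ratio.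
have k1 : k%:R != 0 :> R by rewrite gt_eqF ?natr_pos.
have p0 : pw k != 0 by rewrite gt_eqF ?growth_gt0.
have p1 : pw k.+1 != 0 by rewrite gt_eqF ?growth_gt0.
by field; rewrite ?k1 ?p0 ?p1.
Qed.

Lemma sum_growth_sqrV_bound m n : (0 < m)%N ->
  \sum_(m <= k < n) pw k.+1 ^- 2 <= h m ^- 2 / (2 * mu - 1).
Proof.
move=> m0; have r0 := mu2_gt0.
have [nm|mn] := leqP n m.
  by rewrite big_geq // divr_ge0 ?invr_ge0 ?sqr_ge0 // ltW.
rewrite ler_pdivlMr // mulrC (le_trans (sum_growth_sqrV_le m0 (ltnW mn))) //.
by rewrite gerBl invr_ge0 sqr_ge0.
Qed.

(** A discrete Gronwall argument: with x = k^-2 <= 1, (1 + x)^2 <= 1 + 3 x <= exp (3 x), and these x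
    sum to at most 2, hence [expR 6]. The noise term is finite because mu > 1/2. *)
Lemma scaledA_sqr_mean k : (0 < k)%N ->
  E k (fun w => scaledA k w ^+ 2) <= (2 * v + v / (2 * mu - 1)) * expR 6.
Proof.
move=> k0.
have v0 : 0 <= v by rewrite addr_ge0 // sqr_ge0.
have r0 := mu2_gt0.
suff : E k (fun w => scaledA k w ^+ 2) <=
  (2 * v + v * \sum_(1 <= i < k) pw i.+1 ^- 2) * expR (3 * \sum_(1 <= i < k) i%:R^-1 ^+ 2).
  move=> /le_trans; apply; rewrite ler_pM ?expR_ge0 //.
  - rewrite addr_ge0 ?mulr_ge0 // sumr_ge0 // => i _; by rewrite invr_ge0 sqr_ge0.
  - rewrite lerD2l ler_wpM2l // (le_trans (@sum_growth_sqrV_bound 1 k isT)) //.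
    by rewrite /excess powR1 expr1n invr1 mul1r.
  - by rewrite ler_expR; have := @sum_inv_sqr_le R 1 k isT; lra.
case: k k0 => // k _; elim: k => [|k IH].
  rewrite !big_geq // !mulr0 addr0 expR0 mulr1.
  rewrite -[leRHS](walk_mean_cst a1 a2 start 1); apply: le_walk_mean => // w.
  by rewrite /scaledA /growth powR1 divr1; exact: mode1_sqr_le.
have sumS (F : nat -> R) : \sum_(1 <= i < k.+2) F i = \sum_(1 <= i < k.+1) F i + F k.+1.
  by rewrite big_nat_recr.
rewrite walk_meanS // !sumS.
set S := \sum_(1 <= i < k.+1) pw i.+1 ^- 2 in IH *.
set Z := \sum_(1 <= i < k.+1) i%:R^-1 ^+ 2 in IH *.
have S0 : 0 <= S by rewrite sumr_ge0 // => i _; rewrite invr_ge0 sqr_ge0.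
have Z0 : 0 <= Z by rewrite sumr_ge0 // => i _; rewrite sqr_ge0.
set K := k.+1 in S Z S0 Z0 IH *.
set p := pw K.+1 ^- 2; have p0 : 0 <= p by rewrite invr_ge0 sqr_ge0.
set x := K%:R^-1 ^+ 2; have x0 : 0 <= x by rewrite sqr_ge0.
have x1 : x <= 1 by rewrite exprn_ile1 ?invr_ge0 // invf_le1 // ler1n.
rewrite (@le_trans _ _ (E K (fun w => (1 + 3 * x) * scaledA K w ^+ 2 + v * p))) //.
  apply: (@le_walk_mean R a1 a2 start a1_le1 a2_le1 K) => w.
  rewrite (le_trans (@step_sqr_le _ _ _ (drift_ratio K * scaledA K w) (pw K.+1)^-1 (rho / pw K.+1) _)) //.
    by move=> b c; rewrite scaledAS // scaledA_adapted.
  rewrite lerD //; last by rewrite le_eqVlt; apply/orP; left; apply/eqP; rewrite /p exprMn exprVn; ring.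
  rewrite exprMn ler_wpM2r ?sqr_ge0 //.
  have /andP[d0 d1] := drift_ratio_itv (isT : (0 < K)%N).
  rewrite -/x in d1; nra.
rewrite walk_meanD walk_mean_cst walk_meanZ [3 * (_ + _)]mulrDr expRD.
have e1 : 1 + 3 * x <= expR (3 * x) by exact: expR_ge1Dx.
have e2 : 1 <= expR (3 * Z) by rewrite -[leLHS]expR0 ler_expR mulr_ge0.
have := expR_ge0 (3 * Z).
set X := expR (3 * x) in e1 *; set Y := expR (3 * Z) in e2 IH *; move=> Y0.
have X1 : 1 <= X by rewrite (le_trans _ e1) // lerDl mulr_ge0.
have s1 : (1 + 3 * x) * E K (fun w => scaledA K w ^+ 2) <= X * ((2 * v + v * S) * Y).
  by rewrite ler_pM // ?addr_ge0 ?mulr_ge0 // walk_mean_ge0 // => w; rewrite sqr_ge0.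
have s2 : v * p <= v * p * (Y * X).
  by rewrite ler_peMr ?mulr_ge0 // -[leLHS]mulr1 ler_pM.
lra.
Qed.

(** In the last bound the noise of [scaledA] after m has total variance of order [excess m ^- 2],
    while the defects contribute O(1/m), which is no larger than order 1 / [excess m]. *)
Lemma moment_bounds : exists C : R, [/\ 1 <= C,
  forall k, (0 < k)%N -> E k (fun w => `|modeB k w|) <= C * sq k,
  forall k, (0 < k)%N -> E k (fun w => `|scaledA k w|) <= C &
  forall m k, (0 < m <= k)%N -> E k (fun w => `|scaledA k w - scaledA m w|) <= C / h m].
Proof.
have v0 : 0 <= v by rewrite addr_ge0 // sqr_ge0.
have r0 := mu2_gt0.
set Ca := (2 * v + v / (2 * mu - 1)) * expR 6.
have Ca0 : 0 <= Ca by rewrite mulr_ge0 ?expR_ge0 // addr_ge0 ?mulr_ge0 // invr_ge0 ltW.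
have Cv0 : 0 <= v / (2 * mu - 1) by rewrite divr_ge0 // ltW.
have bA k : (0 < k)%N -> E k (fun w => `|scaledA k w|) <= 1 + Ca.
  move=> k0; rewrite -[leRHS]mul1r; apply: walk_mean_abs_le => //.
  by rewrite expr1n mul1r; exact: scaledA_sqr_mean.
exists (1 + 2 * v + 1 + v / (2 * mu - 1) + 3 * (1 + Ca)); split.
- by lra.
- move=> k k0; rewrite (@le_trans _ _ (sq k * (1 + 2 * v))) //.
    by apply: walk_mean_abs_le; rewrite ?root_gt0 // root_sqr modeB_sqr_mean.
  by rewrite mulrC ler_wpM2r ?(ltW (root_gt0 k0)) //; lra.
- by move=> k k0; rewrite (le_trans (bA k k0)) //; lra.
move=> m k /andP[m0 mk].
pose M := mart a1 a2 (fun k => (pw k.+1)^-1) (fun k => rho / pw k.+1) m.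
have dec j w : (m <= j)%N -> scaledA j w - scaledA m w =
    M j w + \sum_(m <= i < j) (drift_ratio i - 1) * scaledA i w.
  move=> /subnK <-; elim: (j - m)%N => [|i IH].
    by rewrite add0n subrr /M /mart !big_geq // addr0.
  have mi : (m <= i + m)%N by exact: leq_addl.
  rewrite addSn /M martS // -/M big_nat_recr // scaledAS ?(leq_trans m0) //=.
  by move: IH; lra.
have hm0 := excess_gt0 m0.
have bM : E k (fun w => `|M k w|) <= (h m)^-1 * (1 + v / (2 * mu - 1)).
  apply: walk_mean_abs_le; rewrite ?invr_gt0 //.
  rewrite (le_trans (mart_sqr_mean start a1_le1 a2_le1 _ _ m0 mk)) //.
  have -> : \sum_(m <= i < k) ((pw i.+1)^-1 ^+ 2 + (rho / pw i.+1) ^+ 2) =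
     v * \sum_(m <= i < k) pw i.+1 ^- 2.
    by rewrite mulr_sumr; apply: eq_bigr => i _; rewrite exprMn exprVn; ring.
  by rewrite exprVn mulrCA ler_wpM2l // sum_growth_sqrV_bound.
have bS : E k (fun w => `|\sum_(m <= i < k) (drift_ratio i - 1) * scaledA i w|) <=
    2 / m%:R * (1 + Ca).
  rewrite (@le_trans _ _ (E k (fun w => \sum_(m <= i < k) i%:R^-1 ^+ 2 * `|scaledA i w|))) //.
    apply: le_walk_mean => // w; rewrite (le_trans (ler_norm_sum _ _ _)) //.
    rewrite big_nat_cond [leRHS]big_nat_cond; apply: ler_sum => i /andP[/andP[mi _] _].
    have /andP[d0 d1] := drift_ratio_itv (leq_trans m0 mi).
    by rewrite normrM ler_wpM2r // ger0_norm.
  rewrite walk_mean_sum (@le_trans _ _ (\sum_(m <= i < k) i%:R^-1 ^+ 2 * (1 + Ca))) //.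
    rewrite big_nat_cond [leRHS]big_nat_cond; apply: ler_sum => i /andP[/andP[mi ik] _].
    rewrite walk_meanZ ler_wpM2l ?sqr_ge0 // (@walk_mean_adapted _ _ _ _ i k) ?bA ?(leq_trans m0) //.
      by rewrite ltnW // (leq_trans m0).
    by move=> w b c j ij; rewrite scaledA_adapted.
  by rewrite -mulr_suml ler_wpM2r ?sum_inv_sqr_le // addr_ge0.
rewrite (@le_trans _ _ (E k (fun w => `|M k w| + `|\sum_(m <= i < k) (drift_ratio i - 1) * scaledA i w|))) //.
  by apply: le_walk_mean => // w; rewrite dec // ler_normD.
rewrite walk_meanD (le_trans (lerD bM bS)) // mulrC -[in leLHS](mulrC (1 + Ca)).
have : m%:R^-1 <= (h m)^-1.
  rewrite lef_pV2 ?posrE ?natr_pos // (le_trans (excess_le_root m0)) //; exact: root_le.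
have := hm0; rewrite -invr_gt0; set x := (h m)^-1; set y := m%:R^-1 => x0 yx.
have : (1 + Ca) * (2 * y) <= (1 + Ca) * (2 * x) by rewrite ler_wpM2l ?addr_ge0 // ler_wpM2l.
set c1 := v / (2 * mu - 1) in Cv0 *.
have t1 : 0 <= (2 * v + 1) * x by rewrite mulr_ge0 // ?ltW //; lra.
have t2 : 0 <= (1 + Ca) * x by rewrite mulr_ge0 // ?ltW //; lra.
lra.
Qed.

End walk_estimates.

(** * The fluctuation as a weighted sum of centred steps *)

Section walk_fluctuations.
Context {R : realType} (a1 a2 mu rho : R) (start : state).
Context (a1_le1 : `|a1| <= 1) (a2_le1 : `|a2| <= 1).
Context (mu_gt : 2^-1 < mu) (mu_le1 : mu <= 1).
Context (a1E : a1 = rho * mu) (a2E : rho * a2 = mu).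
Implicit Types (k m n N : nat) (w : state).

Local Notation E := (walk_mean a1 a2 start).
Local Notation inc1 := (incr1 a1).
Local Notation inc2 := (incr2 a2).
Local Notation pw := (growth mu).
Local Notation h := (excess mu).
Local Notation sq := (@root R).
Local Notation v := (1 + rho ^+ 2).
Local Notation A := (modeA rho).
Local Notation B := (modeB rho).
Local Notation sA := (scaledA mu rho).
Local Notation leE := (le_walk_mean start a1_le1 a2_le1).

Lemma sqr_dist_le (x y : R) : `|x| <= 1 -> `|y| <= 1 -> `|x ^+ 2 - y ^+ 2| <= 2 * `|x - y|.
Proof.
move=> x1 y1; rewrite subr_sqr normrM mulrC ler_wpM2r //.
by rewrite (le_trans (ler_normD _ _)) //; lra.
Qed.

Lemma sqr_dist_le_add (x y : R) : `|x| <= 1 -> `|y| <= 1 -> `|x ^+ 2 - y ^+ 2| <= `|x| + `|y|.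
Proof.
move=> x1 y1; rewrite (le_trans (ler_normB _ _)) // !normrX lerD //.
  by rewrite expr2 ler_piMr.
by rewrite expr2 ler_piMr.
Qed.

Lemma norm_comb_le (x y z : R) k : 0 <= y ->
  `|x * y + z / k%:R| <= `|x| * y + `|z| / k%:R.
Proof.
move=> y0; rewrite (le_trans (ler_normD _ _)) // !normrM normfV normr_nat.
by rewrite (ger0_norm y0).
Qed.

Lemma avg1_modes k w : avg1 k w = (A k w / k%:R + B k w / k%:R) / 2.
Proof.
rewrite /avg1 /modeA /modeB; set x := k%:R^-1; lra.
Qed.

Lemma drift1_modes k w : drift1 a1 k w = mu * ((A k w / k%:R - B k w / k%:R) / 2).
Proof. by rewrite /drift1 /modeA /modeB a1E; set x := k%:R^-1; field. Qed.

Lemma modeA_scaled k w : (0 < k)%N -> A k w / k%:R = sA k w * (pw k / k%:R).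
Proof.
move=> k0; rewrite /scaledA; field.
by rewrite !gt_eqF ?growth_gt0 ?natr_pos.
Qed.

Lemma avg1_le1 k w : `|avg1 k w| <= 1 :> R.
Proof. exact/avg_le1/pos1_le. Qed.

Lemma root_inv k : (0 < k)%N -> sq k / k%:R = (sq k)^-1.
Proof. by move=> k0; rewrite -root_sqr; field; rewrite gt_eqF ?root_gt0. Qed.

(** For mu = 1 one has a2^2 = 1, so the second drift is the average up to sign, and the first
    differs from it, up to a factor of modulus 1, only through [modeB / k], which vanishes; the
    average settles at the rate of [scaledA]. For mu < 1 drifts and averages all vanish, at rate
    k^(mu - 1). *)
Lemma drift_sqr_close : exists C gam : R, [/\ 0 <= C, 0 < gam &
  forall m j, (0 < m <= j)%N ->
    E j (fun w => `|drift1 a1 j w ^+ 2 - avg1 m w ^+ 2|) <= C * m%:R `^ (- gam) /\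
    E j (fun w => `|drift2 a2 j w ^+ 2 - avg1 m w ^+ 2|) <= C * m%:R `^ (- gam)].
Proof.
have [C [C1 bB bA bAA]] := moment_bounds start a1_le1 a2_le1 mu_gt mu_le1 a1E a2E.
have C0 : 0 <= C by lra.
have bBk m j : (0 < m <= j)%N -> E j (fun w => `|B m w| / m%:R) <= C / sq m.
  move=> /andP[m0 mj].
  rewrite (@eq_walk_mean _ _ _ _ j _ (fun w => m%:R^-1 * `|B m w|)); last by move=> w; rewrite mulrC.
  rewrite walk_meanZ (@walk_mean_adapted _ _ _ _ m j) ?m0 //; last first.
    by move=> w b c i ij; rewrite modeB_adapted.
  by rewrite mulrC -root_inv // mulrA ler_wpM2r ?invr_ge0 // bB.
have bAm m j : (0 < m <= j)%N -> E j (fun w => `|sA m w|) <= C.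
  move=> /andP[m0 mj]; rewrite (@walk_mean_adapted _ _ _ _ m j) ?m0 ?bA //.
  by move=> w b c i ij; rewrite scaledA_adapted.
have rootV m j : (0 < m <= j)%N -> (sq j)^-1 <= (sq m)^-1.
  by move=> /andP[m0 mj]; rewrite lef_pV2 ?posrE ?root_gt0 ?(leq_trans m0) ?root_mono.
have [mu1|mu_neq1] := eqVneq mu 1.
  exists (3 * C), 2^-1; split; [lra|lra|] => m j mj; have /andP[m0 mlej] := mj.
  have j0 := leq_trans m0 mlej; rewrite powRN -/(root m).
  have pwE k : (0 < k)%N -> pw k / k%:R = 1.
    by move=> k0; rewrite /growth mu1 powRr1 // divff // gt_eqF ?natr_pos.
  have hE k : h k = sq k by rewrite /excess /root; congr (_ `^ _); lra.
  have a22 : a2 ^+ 2 = 1.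
    have a12 : a1 ^+ 2 * a2 ^+ 2 = 1.
      by rewrite -exprMn a1E mulrAC a2E mu1 mul1r expr1n.
    have s1 : a1 ^+ 2 <= 1 by rewrite -(real_normK (num_real a1)) exprn_ile1.
    have s2 : a2 ^+ 2 <= 1 by rewrite -(real_normK (num_real a2)) exprn_ile1.
    have := sqr_ge0 a1; have := sqr_ge0 a2; nra.
  (* Dominates both differences: a drift or an average is half the sum of [scaledA] and a signed
     [modeB / k]. *)
  pose T w := `|sA j w - sA m w| + `|B j w| / j%:R + `|B m w| / m%:R.
  have bT : E j T <= 3 * C / sq m.
    rewrite !walk_meanD.
    have := bAA _ _ mj; have := bBk m j mj; have := bBk j j; rewrite j0 leqnn => /(_ isT).
    have := ler_wpM2l C0 (rootV _ _ mj); rewrite hE; lra.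
  have TE (x y e : R) w : x = (sA j w + e * (B j w / j%:R)) / 2 ->
      y = (sA m w + B m w / m%:R) / 2 -> `|e| = 1 -> `|x - y| <= T w / 2.
    move=> -> -> e1.
    rewrite -mulrBl normrM (@ger0_norm _ 2^-1) // ler_wpM2r // /T.
    have -> : sA j w + e * (B j w / j%:R) - (sA m w + B m w / m%:R) =
      sA j w - sA m w + e * (B j w / j%:R) - B m w / m%:R by ring.
    rewrite (le_trans (ler_normB _ _)) // !normrM !normfV !normr_nat lerD //.
    by rewrite (le_trans (ler_normD _ _)) // !normrM e1 mul1r normfV normr_nat.
  have avgE k w : (0 < k)%N -> avg1 k w = (sA k w + B k w / k%:R) / 2.
    by move=> k0; rewrite avg1_modes modeA_scaled // pwE // mulr1.
  split; apply: (le_trans _ bT); apply: leE => w.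
    rewrite (le_trans (sqr_dist_le (drift1_le1 a1_le1 _ _) (avg1_le1 _ _))) //.
    rewrite mulrC -ler_pdivlMr //; apply: (TE _ _ (- 1)); rewrite ?normrN1 //; last exact: avgE.
    have -> : drift1 a1 j w = (A j w / j%:R - B j w / j%:R) / 2.
      by rewrite drift1_modes mu1 mul1r.
    by rewrite modeA_scaled // pwE // mulr1 mulN1r.
  rewrite /drift2 exprMn a22 mul1r -/(avg1 j w).
  rewrite (le_trans (sqr_dist_le (avg1_le1 _ _) (avg1_le1 _ _))) //.
  rewrite mulrC -ler_pdivlMr //; apply: (TE _ _ 1); rewrite ?normr1 //; last exact: avgE.
  by rewrite avgE // mul1r.
have mu_lt1 : mu < 1 by rewrite lt_neqAle mu_neq1.
exists (2 * C), (1 - mu); split; [lra|lra|] => m j mj; have /andP[m0 mlej] := mj.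
have j0 := leq_trans m0 mlej.
have pwE k : (0 < k)%N -> pw k / k%:R = k%:R `^ (- (1 - mu)).
  move=> k0; rewrite opprB powRD ?powR_inv1 //.
  by rewrite pnatr_eq0 -lt0n k0 implybT.
have sqV k : (0 < k)%N -> (sq k)^-1 <= k%:R `^ (- (1 - mu)).
  by move=> k0; rewrite -powRN; apply: ler_powR; rewrite ?ler1n //; have := mu_gt; lra.
have mono : j%:R `^ (- (1 - mu)) <= m%:R `^ (- (1 - mu)) :> R.
  by rewrite !powRN lef_pV2 ?posrE ?powR_gt0 ?natr_pos // powR_mono //; lra.
pose T k w := `|sA k w| * (pw k / k%:R) + `|B k w| / k%:R.
have bT k : (0 < k <= j)%N -> E j (T k) <= 2 * C * k%:R `^ (- (1 - mu)).
  move=> kj; have /andP[k0 _] := kj.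
  rewrite walk_meanD (@eq_walk_mean _ _ _ _ j (fun w => `|sA k w| * (pw k / k%:R))
    (fun w => (pw k / k%:R) * `|sA k w|)); last by move=> w; rewrite mulrC.
  rewrite walk_meanZ pwE //.
  have := ler_wpM2l (powR_ge0 (k%:R : R) (- (1 - mu))) (bAm k j kj).
  have := bBk k j kj; have := ler_wpM2l C0 (sqV _ k0); lra.
have avgE k w : (0 < k)%N -> `|avg1 k w| <= T k w / 2.
  move=> k0; rewrite avg1_modes modeA_scaled // normrM (@ger0_norm _ 2^-1) // ler_wpM2r //.
  by rewrite norm_comb_le // divr_ge0 // ltW // growth_gt0.
have dr1 w : `|drift1 a1 j w| <= T j w / 2.
  rewrite drift1_modes modeA_scaled // normrM.
  rewrite (@le_trans _ _ `|(sA j w * (pw j / j%:R) - B j w / j%:R) / 2|) //.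
    by rewrite ler_piMl // ger0_norm // ltW // mu_gt0.
  rewrite normrM (@ger0_norm _ 2^-1) // ler_wpM2r //.
  have y0 : 0 <= pw j / j%:R by rewrite divr_ge0 // ltW // growth_gt0.
  by have := norm_comb_le (sA j w) (- B j w) j y0; rewrite normrN mulNr.
have dr2 w : `|drift2 a2 j w| <= T j w / 2.
  by rewrite normrM (le_trans _ (avgE j w j0)) // ler_piMl.
have bb : E j (fun w => 2^-1 * T j w + 2^-1 * T m w) <= 2 * C * m%:R `^ (- (1 - mu)).
  rewrite walk_meanD !walk_meanZ.
  have := bT m mj; have := bT j; rewrite j0 leqnn => /(_ isT).
  have := ler_wpM2l C0 mono; lra.
split; apply: (le_trans _ bb); apply: leE => w.
  rewrite (le_trans (sqr_dist_le_add (drift1_le1 a1_le1 _ _) (avg1_le1 _ _))) //.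
  by rewrite lerD // mulrC ?avgE.
rewrite (le_trans (sqr_dist_le_add (drift2_le1 a2_le1 _ _) (avg1_le1 _ _))) //.
by rewrite lerD // mulrC ?avgE.
Qed.

Definition fluct n N w : R := h n * (pos1 n w / pw n - pos1 N w / pw N).

Lemma fluct_modes n N w : fluct n N w =
  h n / 2 * (sA n w - sA N w + B n w / pw n - B N w / pw N).
Proof.
rewrite /fluct /scaledA /modeA /modeB.
by set x := (pw n)^-1; set y := (pw N)^-1; field.
Qed.

Lemma modeB_abs_adapted n N : (0 < n <= N)%N ->
  E N (fun w => `|B n w|) = E n (fun w => `|B n w|).
Proof.
by move=> nN; rewrite (@walk_mean_adapted _ _ _ _ n N) // => w b c i ij; rewrite modeB_adapted.
Qed.

Lemma excess_growthV n : (0 < n)%N -> h n / pw n = (sq n)^-1.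
Proof.
by move=> n0; rewrite (growthE mu_gt); field; rewrite !gt_eqF ?root_gt0 ?excess_gt0.
Qed.

Lemma root_growthV n : (0 < n)%N -> sq n / pw n = (h n)^-1.
Proof.
by move=> n0; rewrite (growthE mu_gt); field; rewrite !gt_eqF ?root_gt0 ?excess_gt0.
Qed.

(** Each of the three contributions to [fluct_modes] is of order 1 / [excess n] in L1 and is
    cancelled by the prefactor. *)
Lemma fluct_tight : exists C : R, 0 <= C /\ forall n N, (0 < n <= N)%N ->
  E N (fun w => `|fluct n N w|) <= C.
Proof.
have [C [C1 bB bA bAA]] := moment_bounds start a1_le1 a2_le1 mu_gt mu_le1 a1E a2E.
exists (3 / 2 * C); split; first lra.
move=> n N nN; have /andP[n0 nleN] := nN; have N0 := leq_trans n0 nleN.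
have hn := excess_gt0 mu n0; have hN := excess_gt0 mu N0.
rewrite (@le_trans _ _ (E N (fun w => h n / 2 * (`|sA N w - sA n w| +
   ((pw n)^-1 * `|B n w| + (pw N)^-1 * `|B N w|))))) //.
  apply: leE => w; rewrite fluct_modes normrM (@ger0_norm _ (h n / 2)) ?divr_ge0 ?(ltW hn) //.
  rewrite ler_wpM2l ?divr_ge0 ?(ltW hn) // addrA (le_trans (ler_normB _ _)) //.
  rewrite [X in _ + X <= _]normrM normfV (gtr0_norm (growth_gt0 mu N0)) [X in _ + X <= _]mulrC lerD2r.
  rewrite (le_trans (ler_normD _ _)) // normrM normfV (gtr0_norm (growth_gt0 mu n0)).
  by rewrite [X in _ + X <= _]mulrC lerD2r distrC.
rewrite walk_meanZ !walk_meanD !walk_meanZ modeB_abs_adapted //.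
have k1 := bAA _ _ nN.
have k2 : (pw n)^-1 * E n (fun w => `|B n w|) <= C / h n.
  by rewrite -root_growthV // mulrA mulrC ler_wpM2r ?invr_ge0 ?bB // ltW ?growth_gt0.
have k3 : (pw N)^-1 * E N (fun w => `|B N w|) <= C / h n.
  apply: (@le_trans _ _ (C / h N)).
    by rewrite -root_growthV // mulrA mulrC ler_wpM2r ?invr_ge0 ?bB // ltW ?growth_gt0.
  by rewrite ler_wpM2l ?lef_pV2 ?posrE ?excess_mono //; lra.
have k4 : h n / 2 * (3 * (C / h n)) = 3 / 2 * C by field; rewrite gt_eqF.
rewrite -k4 ler_wpM2l ?divr_ge0 ?(ltW hn) //; lra.
Qed.

(* Weights of the steps of the two walks in [fluct n N]: up to [n] they come from [modeB n], whose
   martingale is [n^mu * modeB n], and after [n] from [modeA / growth]. *)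
Definition weight1 n k : R :=
  if (k < n)%N then h n / 2 / pw n ^+ 2 * pw k.+1 else - (h n / 2 / pw k.+1).
Definition weight2 n k : R := (if (k < n)%N then - rho else rho) * weight1 n k.

(** The uniform smallness that plays the role of a Lindeberg condition. Both branches are largest
    for k next to n. *)
Lemma weight1_le n k : (0 < n)%N -> `|weight1 n k| <= 2^-1 / sq n.
Proof.
move=> n0; have hn := excess_gt0 mu n0; have pn := growth_gt0 mu n0.
rewrite /weight1 -excess_growthV //.
have -> : 2^-1 * (h n / pw n) = h n / 2 / pw n by ring.
case: ifPn => [kn|]; last rewrite -leqNgt => nk.
  rewrite ger0_norm; last by rewrite mulr_ge0 ?powR_ge0 // !divr_ge0 ?sqr_ge0 // ltW.
  have -> : h n / 2 / pw n ^+ 2 * pw k.+1 = h n / 2 / pw n * (pw k.+1 / pw n).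
    by field; rewrite gt_eqF.
  rewrite ler_piMr ?divr_ge0 ?(ltW pn) ?(ltW hn) //.
  by rewrite ler_pdivrMr // mul1r (growth_mono mu_gt).
have pk := growth_gt0 mu (ltn0Sn k).
rewrite normrN ger0_norm ?divr_ge0 ?(ltW hn) ?(ltW pk) //.
rewrite ler_wpM2l ?divr_ge0 ?(ltW hn) // lef_pV2 ?posrE // (growth_mono mu_gt) // ltnW //.
Qed.

(** Three errors remain: the initial value [growth m * modeB m], the defects of the two almost
    martingales, and the final term [modeB N / growth N]. The first two are O(m / [root n]), the
    last is O([excess n] / [excess N]). *)
Lemma fluct_mart_close : exists C : R, 0 <= C /\
  forall m n N, (0 < m)%N -> (m <= n)%N -> (n <= N)%N ->
  E N (fun w => `|fluct n N w - mart a1 a2 (weight1 n) (weight2 n) m N w|) <=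
  C * (m%:R / sq n + h n / h N).
Proof.
have [C [C1 bB bA bAA]] := moment_bounds start a1_le1 a2_le1 mu_gt mu_le1 a1E a2E.
have C0 : 0 <= C by lra.
(* The coefficient of 1 / [root n] is 1 + (m + 16) / 2 <= 10 m for m >= 1, where 16 is twice the
   constant of [sum_root_le]. *)
exists (10 * C); split; first lra.
move=> m n N m0 mn nN; have n0 := leq_trans m0 mn; have N0 := leq_trans n0 nN.
have hn := excess_gt0 mu n0; have pn := growth_gt0 mu n0; have pN := growth_gt0 mu N0.
have hN := excess_gt0 mu N0; have sn := @root_gt0 R n n0.
pose r k := pw k.+1 * (1 - mu / k%:R) - pw k.
have telA w : sA N w - sA n w = \sum_(n <= k < N) ((pw k.+1)^-1 * (inc1 k w + rho * inc2 k w))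
    + \sum_(n <= k < N) (drift_ratio mu k - 1) * sA k w.
  rewrite -(telescope_sumr (fun k => sA k w) nN) -big_split /=.
  apply: eq_big_nat => k /andP[nk _]; have k0 := leq_trans n0 nk.
  by rewrite (scaledAS a1E a2E) //; ring.
have telB w : pw n * B n w - pw m * B m w =
    \sum_(m <= k < n) (pw k.+1 * (inc1 k w - rho * inc2 k w)) + \sum_(m <= k < n) r k * B k w.
  rewrite -(telescope_sumr (fun k => pw k * B k w) mn) -big_split /=.
  apply: eq_big_nat => k /andP[mk _]; have k0 := leq_trans m0 mk.
  by rewrite (modeBS a1E a2E) // /r; ring.
have martE w : mart a1 a2 (weight1 n) (weight2 n) m N w =
    h n / 2 / pw n ^+ 2 * \sum_(m <= k < n) (pw k.+1 * (inc1 k w - rho * inc2 k w)) -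
    h n / 2 * \sum_(n <= k < N) ((pw k.+1)^-1 * (inc1 k w + rho * inc2 k w)).
  rewrite /mart (@big_cat_nat _ _ _ n m N) //= !mulr_sumr -sumrN; congr (_ + _).
    by apply: eq_big_nat => k /andP[_ kn]; rewrite /weight2 /weight1 kn; ring.
  apply: eq_big_nat => k /andP[nk _]; rewrite /weight2 /weight1 ltnNge nk /=; ring.
have errE w : fluct n N w - mart a1 a2 (weight1 n) (weight2 n) m N w =
    h n / 2 * (- (\sum_(n <= k < N) (drift_ratio mu k - 1) * sA k w)
     + (pw m * B m w + \sum_(m <= k < n) r k * B k w) / pw n ^+ 2 - B N w / pw N).
  rewrite fluct_modes martE.
  have -> : sA n w - sA N w = - (\sum_(n <= k < N) ((pw k.+1)^-1 * (inc1 k w + rho * inc2 k w))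
    + \sum_(n <= k < N) (drift_ratio mu k - 1) * sA k w) by rewrite -telA opprB.
  have -> : B n w / pw n = (pw m * B m w + (\sum_(m <= k < n) (pw k.+1 * (inc1 k w - rho * inc2 k w))
     + \sum_(m <= k < n) r k * B k w)) / pw n ^+ 2.
    by rewrite -telB; field; rewrite gt_eqF.
  by set x := (pw N)^-1; field; rewrite gt_eqF.
rewrite (@le_trans _ _ (E N (fun w => h n / 2 *
   (\sum_(n <= k < N) k%:R^-1 ^+ 2 * `|sA k w| +
   (pw n ^- 2 * (pw m * `|B m w| + \sum_(m <= k < n) 2 * k%:R^-1 ^+ 2 * pw k * `|B k w|) +
    (pw N)^-1 * `|B N w|))))) //.
  apply: leE => w; rewrite errE normrM (@ger0_norm _ (h n / 2)) ?divr_ge0 ?(ltW hn) //.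
  rewrite ler_wpM2l ?divr_ge0 ?(ltW hn) //.
  rewrite -addrA (le_trans (ler_normD _ _)) // normrN lerD //.
    rewrite (le_trans (ler_norm_sum _ _ _)) //.
    rewrite big_nat_cond [leRHS]big_nat_cond; apply: ler_sum => k /andP[/andP[nk _] _].
    have /andP[d0 d1] := drift_ratio_itv mu_gt mu_le1 (leq_trans n0 nk).
    by rewrite normrM ler_wpM2r // ger0_norm.
  rewrite (le_trans (ler_normB _ _)) // lerD //; last by rewrite normrM normfV (gtr0_norm pN) mulrC.
  rewrite normrM normfV (@ger0_norm _ (pw n ^+ 2)) ?sqr_ge0 // mulrC ler_wpM2l ?invr_ge0 ?sqr_ge0 //.
  rewrite (le_trans (ler_normD _ _)) // normrM (gtr0_norm (growth_gt0 mu m0)) lerD2l.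
  rewrite (le_trans (ler_norm_sum _ _ _)) //.
  rewrite big_nat_cond [leRHS]big_nat_cond; apply: ler_sum => k /andP[/andP[mk _] _].
  by rewrite normrM ler_wpM2r // powR_step_down ?(leq_trans m0) // mu_ge0.
rewrite walk_meanZ !walk_meanD !walk_meanZ walk_meanD walk_meanZ !walk_mean_sum.
have b1 : \sum_(n <= k < N) E N (fun w => k%:R^-1 ^+ 2 * `|sA k w|) <= C * (2 / n%:R).
  rewrite (@le_trans _ _ (\sum_(n <= k < N) C * k%:R^-1 ^+ 2)) //; last first.
    by rewrite -mulr_sumr ler_wpM2l // sum_inv_sqr_le.
  rewrite big_nat_cond [leRHS]big_nat_cond; apply: ler_sum => k /andP[/andP[nk kN] _].
  have k0 := leq_trans n0 nk.
  rewrite walk_meanZ mulrC ler_wpM2r ?sqr_ge0 // (@walk_mean_adapted _ _ _ _ k N) ?bA ?k0 1?ltnW //.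
  by move=> w b c i ij; rewrite scaledA_adapted.
have b2 : \sum_(m <= k < n) E N (fun w => 2 * k%:R^-1 ^+ 2 * pw k * `|B k w|) <= 16 * (C * pw n).
  rewrite (@le_trans _ _ (\sum_(m <= k < n) (2 * (C * pw n) * (k%:R^-1 ^+ 2 * sq k)))) //; last first.
    have := @sum_root_le R m n m0; rewrite -mulr_sumr => hs.
    have c0 : 0 <= C * pw n by rewrite mulr_ge0 // ltW.
    have := ler_wpM2l c0 hs; lra.
  rewrite big_nat_cond [leRHS]big_nat_cond; apply: ler_sum => k /andP[/andP[mk kn] _].
  have k0 := leq_trans m0 mk.
  rewrite walk_meanZ modeB_abs_adapted ?k0 /=; last by rewrite ltnW // (leq_trans kn).
  have -> : 2 * (C * pw n) * (k%:R^-1 ^+ 2 * sq k) = 2 * k%:R^-1 ^+ 2 * pw n * (C * sq k) by ring.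
  rewrite ler_pM ?bB ?walk_mean_ge0 ?mulr_ge0 ?sqr_ge0 ?(ltW (growth_gt0 _ k0)) //.
  by rewrite ler_wpM2l ?mulr_ge0 ?sqr_ge0 // (growth_mono mu_gt) // ltnW.
have b3 : pw m * E N (fun w => `|B m w|) <= pw n * (C * m%:R).
  rewrite modeB_abs_adapted ?m0 ?(leq_trans mn) //.
  rewrite ler_pM ?(ltW (growth_gt0 _ m0)) ?walk_mean_ge0 ?(growth_mono mu_gt) //.
  by rewrite (le_trans (bB m m0)) // ler_wpM2l // root_le.
have b4 : (pw N)^-1 * E N (fun w => `|B N w|) <= C / h N.
  by rewrite -root_growthV // mulrA mulrC ler_wpM2r ?invr_ge0 ?bB // ltW.
have b23 : pw n ^- 2 * (pw m * E N (fun w => `|B m w|) +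
    \sum_(m <= k < n) E N (fun w => 2 * k%:R^-1 ^+ 2 * pw k * `|B k w|)) <= C * (m%:R + 16) / pw n.
  have -> : C * (m%:R + 16) / pw n = pw n ^- 2 * (pw n * (C * m%:R) + 16 * (C * pw n)).
    by field; rewrite gt_eqF.
  by rewrite ler_wpM2l ?invr_ge0 ?sqr_ge0 // lerD.
have h0 : 0 <= h n / 2 by rewrite divr_ge0 // ltW.
rewrite (le_trans (ler_wpM2l h0 (lerD b1 (lerD b23 b4)))) //.
have -> : h n / 2 * (C * (2 / n%:R) + (C * (m%:R + 16) / pw n + C / h N)) =
  C * (h n / n%:R + (m%:R + 16) / 2 * (h n / pw n) + 2^-1 * (h n / h N)).
  by field; rewrite !gt_eqF // ?natr_pos.
rewrite excess_growthV //.
have hnn : h n / n%:R <= (sq n)^-1.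
  by rewrite -root_inv // ler_wpM2r ?invr_ge0 // excess_le_root.
have sV : 0 <= (sq n)^-1 by rewrite invr_ge0 ltW.
have hh : 0 <= h n / h N by rewrite divr_ge0 // ltW.
have m1 : 1 <= m%:R :> R by rewrite ler1n.
have -> : 10 * C * (m%:R / sq n + h n / h N) = C * (10 * m%:R * (sq n)^-1 + 10 * (h n / h N)) by ring.
rewrite ler_wpM2l //.
have := ler_wpM2r sV m1; set x := (sq n)^-1 in sV hnn *; set y := h n / h N in hh *.
rewrite mul1r; nra.
Qed.

(** Before n the squared weights form n^(-(2 mu + 1)) times a sum of k^(2 mu), tending to 1 / (2 mu
    + 1); after n they form n^(2 mu - 1) times a sum of k^(-2 mu), tending to 1 / (2 mu - 1). The 4
    comes from S1 = (A + B) / 2. *)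
Lemma sum_weight_sqr : exists C : R, 0 <= C /\
  forall m n N, (0 < m)%N -> (m <= n)%N -> (n <= N)%N ->
  \sum_(m <= k < N) weight1 n k ^+ 2 <= C /\
  `|\sum_(m <= k < N) weight1 n k ^+ 2 - ((2 * mu + 1)^-1 + (2 * mu - 1)^-1) / 4| <=
  C * (m%:R / sq n + h n / h N).
Proof.
have mg := mu_gt; have r0 := mu2_gt0 mu_gt mu_le1.
have rV : 0 < (2 * mu - 1)^-1 by rewrite invr_gt0.
have p0 : 0 < 2 * mu + 1 by lra.
have pV : 0 < (2 * mu + 1)^-1 by rewrite invr_gt0.
have pV1 : (2 * mu + 1)^-1 <= 1 by rewrite invf_le1 //; lra.
exists (1 + (2 * mu - 1)^-1); split; first lra.
move=> m n N m0 mn nN; have n0 := leq_trans m0 mn; have N0 := leq_trans n0 nN.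
have hn := excess_gt0 mu n0; have pn := growth_gt0 mu n0; have pN := growth_gt0 mu N0.
have hN := excess_gt0 mu N0; have sn := @root_gt0 R n n0.
have nn := @natr_pos R n n0; have mm := @natr_pos R m m0.
set S1 := \sum_(m <= k < n) pw k.+1 ^+ 2; set S2 := \sum_(n <= k < N) pw k.+1 ^- 2.
have sE : \sum_(m <= k < N) weight1 n k ^+ 2 =
    (S1 / (n%:R * pw n ^+ 2) + h n ^+ 2 * S2) / 4.
  have -> : S1 / (n%:R * pw n ^+ 2) = h n ^+ 2 / pw n ^+ 4 * S1.
    by rewrite -(root_sqr n) (growthE mu_gt); field; rewrite !gt_eqF.
  rewrite (@big_cat_nat _ _ _ n m N) //= /S1 /S2 !mulr_sumr mulrDl !mulr_suml; congr (_ + _).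
    by apply: eq_big_nat => k /andP[_ kn]; rewrite /weight1 kn; field; rewrite gt_eqF.
  apply: eq_big_nat => k /andP[nk _]; rewrite /weight1 ltnNge nk /=.
  by field; rewrite gt_eqF ?growth_gt0.
have u1 : S1 / (n%:R * pw n ^+ 2) <= (2 * mu + 1)^-1 + n%:R^-1.
  have := sum_growth_sqr_le mu_gt mn; rewrite -/S1 => hS.
  rewrite ler_pdivrMr ?mulr_gt0 ?exprn_gt0 // -(ler_pM2l p0) (le_trans hS) //.
  by rewrite le_eqVlt; apply/orP; left; apply/eqP; field; rewrite !gt_eqF.
have l1 : (2 * mu + 1)^-1 - m%:R / n%:R <= S1 / (n%:R * pw n ^+ 2).
  have := sum_growth_sqr_ge mu_gt mn; rewrite -/S1 => hS.
  rewrite ler_pdivlMr ?mulr_gt0 ?exprn_gt0 // -(ler_pM2l p0) (le_trans _ hS) //.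
  have -> : (2 * mu + 1) * (((2 * mu + 1)^-1 - m%:R / n%:R) * (n%:R * pw n ^+ 2)) =
     n%:R * pw n ^+ 2 - (2 * mu + 1) * (m%:R * pw n ^+ 2) by field; rewrite !gt_eqF.
  rewrite lerD2l lerN2.
  have : m%:R * pw m ^+ 2 <= m%:R * pw n ^+ 2.
    rewrite ler_wpM2l ?(ltW mm) // lerXn2r ?nnegrE ?(ltW pn) ?(ltW (growth_gt0 _ m0)) //.
    exact: growth_mono.
  have : 0 <= m%:R * pw n ^+ 2 by rewrite mulr_ge0 ?sqr_ge0.
  by move=> q1 q2; nra.
have u2 : h n ^+ 2 * S2 <= (2 * mu - 1)^-1.
  have := @sum_growth_sqrV_bound R mu mu_gt mu_le1 n N n0; rewrite -/S2 => hS.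
  rewrite (le_trans (ler_wpM2l (sqr_ge0 (h n)) hS)) //.
  by rewrite mulrA divff ?mul1r // gt_eqF ?exprn_gt0.
have l2 : (2 * mu - 1)^-1 - (h n / h N) ^+ 2 * (2 * mu - 1)^-1 - n%:R^-1 <= h n ^+ 2 * S2.
  have := sum_growth_sqrV_ge mu_gt mu_le1 n0 nN; rewrite -/S2 => hS.
  rewrite -(ler_pM2l r0) -(ler_pM2l (_ : 0 < h n ^- 2)) ?invr_gt0 ?exprn_gt0 //.
  rewrite [leRHS](_ : _ = (2 * mu - 1) * S2); last by field; rewrite gt_eqF.
  rewrite (le_trans _ hS) //.
  rewrite le_eqVlt; apply/orP; left; apply/eqP.
  by rewrite (growthE mu_gt) -(root_sqr n); field; rewrite !gt_eqF.
rewrite sE.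
have n1 : 1 <= n%:R :> R by rewrite ler1n.
have m1 : 1 <= m%:R :> R by rewrite ler1n.
have nV : n%:R^-1 <= 1 :> R by rewrite invf_le1.
have snV : n%:R^-1 <= (sq n)^-1 by rewrite lef_pV2 ?posrE // root_le.
have nV0 : 0 < n%:R^-1 :> R by rewrite invr_gt0.
have mnV : m%:R / n%:R <= m%:R / sq n by rewrite ler_wpM2l // ltW.
have mnV2 : n%:R^-1 <= m%:R / n%:R :> R by apply: ler_peMl => //; exact: ltW.
set x := h n / h N in l2 *.
have x0 : 0 <= x by rewrite divr_ge0 // ltW.
have x1 : x <= 1 by rewrite ler_pdivrMr // mul1r (excess_mono mu_gt).
have x2 : x ^+ 2 <= x by rewrite expr2 ler_piMr.
have x3 : x ^+ 2 * (2 * mu - 1)^-1 <= x * (2 * mu - 1)^-1 by rewrite ler_wpM2r // ltW.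
have x4 : 0 <= x * (2 * mu - 1)^-1 by rewrite mulr_ge0 // ltW.
set y := m%:R / sq n in mnV *.
have y0 : 0 <= y * (2 * mu - 1)^-1 by rewrite mulr_ge0 ?divr_ge0 // ltW.
split; first lra.
by rewrite ler_norml; apply/andP; split; lra.
Qed.

Lemma cos_lipschitz (x y : R) : `|cos x - cos y| <= `|x - y|.
Proof.
wlog xy : x y / x <= y.
  move=> hw; have [/hw//|/ltW/hw] := leP x y.
  by rewrite distrC (distrC y).
have [c _] : exists2 c, c \in `[x, y]%R & cos y - cos x = - sin c * (y - x).
  apply: MVT_segment => //; apply: derivable_within_continuous => z _.
  exact: derivable_cos.
rewrite distrC (distrC x) => ->; rewrite normrM normrN ler_piMl //.
by rewrite ler_norml sin_geN1 sin_le1.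
Qed.

Lemma walk_fluct_cos th s : exists C gam : R, [/\ 0 <= C, 0 < gam &
  forall m n N, (0 < m)%N -> (m <= n)%N -> (n <= N)%N ->
  `|E N (fun w => cos (th + s * fluct n N w)) - cos th * E m (fun w =>
     expR (- ((1 - avg1 m w ^+ 2) * (s ^+ 2 * (v * (((2 * mu + 1)^-1 + (2 * mu - 1)^-1) / 4))) / 2)))|
  <= C * (m%:R `^ (- gam) + (m%:R / sq n + h n / h N))].
Proof.
have [C1 [C1_ge0 close]] := fluct_mart_close.
have [C2 [C2_ge0 sumw]] := sum_weight_sqr.
have [D [gam [D0 gam0 dclose]]] := drift_sqr_close.
have v0 : 0 <= v by rewrite addr_ge0 // sqr_ge0.
set kap := ((2 * mu + 1)^-1 + (2 * mu - 1)^-1) / 4 in sumw *.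
(* Collects the cubic and quartic errors of [cos_one_step], each bounded by [weight1^2 / root n]. *)
pose K := 8 / 3 * (`|s| * (1 + `|rho|)) ^+ 3 + (s ^+ 2 * v) ^+ 2.
have K0 : 0 <= K.
  by rewrite addr_ge0 ?sqr_ge0 // mulr_ge0 // ?exprn_ge0 ?mulr_ge0 ?addr_ge0 //; lra.
have sv0 : 0 <= s ^+ 2 * v by rewrite mulr_ge0 ?sqr_ge0.
exists (`|s| * C1 + s ^+ 2 * v * C2 + K * C2 + C2 * (s ^+ 2 * v) * D), gam; split => //.
  by rewrite !(sqr_ge0, addr_ge0, mulr_ge0).
move=> m n N m0 mn nN; have n0 := leq_trans m0 mn; have N0 := leq_trans n0 nN.
have hn := excess_gt0 mu n0; have hN := excess_gt0 mu N0; have sn := @root_gt0 R n n0.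
have mN := leq_trans mn nN.
have [S_le S_close] := sumw m n N m0 mn nN.
set S := \sum_(m <= k < N) weight1 n k ^+ 2 in S_le S_close.
have S0 : 0 <= S by rewrite sumr_ge0 // => k _; rewrite sqr_ge0.
pose c1 k := s * weight1 n k; pose c2 k := s * weight2 n k.
have qE k : c1 k ^+ 2 + c2 k ^+ 2 = s ^+ 2 * v * weight1 n k ^+ 2.
  by rewrite /c1 /c2 /weight2; case: ifP => _; ring.
have sumqE : \sum_(m <= k < N) (c1 k ^+ 2 + c2 k ^+ 2) = s ^+ 2 * v * S.
  by rewrite /S mulr_sumr; apply: eq_bigr => k _; rewrite qE.
have martE w : mart a1 a2 c1 c2 m N w = s * mart a1 a2 (weight1 n) (weight2 n) m N w.
  by rewrite /mart mulr_sumr; apply: eq_bigr => k _; rewrite /c1 /c2; ring.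
set del := D * m%:R `^ (- gam).
have del0 : 0 <= del by rewrite mulr_ge0 ?powR_ge0.
have clt := @cos_mart_mean R a1 a2 start a1_le1 a2_le1 c1 c2 m m0 N th del mN.
have {}clt := clt (fun k mk => (dclose m k (introT andP (conj m0 (proj1 (andP mk))))).1).
have {}clt := clt (fun k mk => (dclose m k (introT andP (conj m0 (proj1 (andP mk))))).2).
rewrite sumqE in clt.
(* Every per-step error is a small factor times the squared weight, so the total stays bounded
   uniformly in the number of steps N - m. *)
have err_le : \sum_(m <= k < N) (8 / 3 * (`|c1 k| + `|c2 k|) ^+ 3
      + (c1 k ^+ 2 + c2 k ^+ 2) ^+ 2 / 8 + (c1 k ^+ 2 + c2 k ^+ 2) * del / 2) <=
    (K / sq n + s ^+ 2 * v * del) * S.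
  rewrite /S mulr_sumr; apply: ler_sum => k _; rewrite qE.
  have wl := weight1_le k n0.
  set x := weight1 n k in wl *.
  have sV : 0 < (sq n)^-1 by rewrite invr_gt0.
  have sV1 : (sq n)^-1 <= 1 by rewrite invf_le1 ?root_ge1.
  have cc : `|c1 k| + `|c2 k| = `|s| * (1 + `|rho|) * `|x|.
    by rewrite /c1 /c2 /weight2 -/x !normrM; case: ifP => _; rewrite ?normrN; ring.
  have xx : x ^+ 2 = `|x| ^+ 2 by rewrite real_normK ?num_real.
  have wl' : `|x| <= (sq n)^-1 by lra.
  have x3 : `|x| ^+ 3 <= (sq n)^-1 * x ^+ 2 by rewrite exprS xx ler_wpM2r ?sqr_ge0.
  have x2 : x ^+ 2 <= (sq n)^-1.
    by rewrite xx expr2 -[leRHS]mulr1 ler_pM // (le_trans wl').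
  have x4 : (x ^+ 2) ^+ 2 <= (sq n)^-1 * x ^+ 2 by rewrite expr2 ler_wpM2r ?sqr_ge0.
  rewrite cc exprMn [(_ * x ^+ 2) ^+ 2]exprMn /K.
  set u := (`|s| * (1 + `|rho|)) ^+ 3; set t := s ^+ 2 * v in sv0 *.
  have u0 : 0 <= u by rewrite exprn_ge0 // mulr_ge0 // addr_ge0.
  have e1 := ler_wpM2l u0 x3; have e2 := ler_wpM2l (sqr_ge0 t) x4.
  have e3 : 0 <= t * x ^+ 2 * del by rewrite mulr_ge0 // mulr_ge0 ?sqr_ge0.
  have e4 : 0 <= t ^+ 2 * (x ^+ 2) ^+ 2 by rewrite mulr_ge0 ?sqr_ge0.
  lra.
have step1 : `|E N (fun w => cos (th + s * fluct n N w)) -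
    E N (fun w => cos (th + mart a1 a2 c1 c2 m N w))| <=
    `|s| * (C1 * (m%:R / sq n + h n / h N)).
  rewrite -walk_meanB (le_trans (walk_mean_norm _ _ _ _ _)) //.
  rewrite (le_trans _ (ler_wpM2l (normr_ge0 s) (close m n N m0 mn nN))) // -walk_meanZ.
  apply: leE => w; rewrite martE (le_trans (cos_lipschitz _ _)) //.
  rewrite [X in `|X| <= _](_ : _ = s * (fluct n N w - mart a1 a2 (weight1 n) (weight2 n) m N w));
    last by ring.
  by rewrite normrM.
have step3 : `|cos th * E m (fun w => expR (- ((1 - avg1 m w ^+ 2) * (s ^+ 2 * v * S) / 2))) -
    cos th * E m (fun w => expR (- ((1 - avg1 m w ^+ 2) * (s ^+ 2 * (v * kap)) / 2)))| <=
    s ^+ 2 * v * (C2 * (m%:R / sq n + h n / h N)).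
  rewrite -mulrBr normrM -walk_meanB.
  have c1_le : `|cos th| <= 1 by rewrite ler_norml cos_geN1 cos_le1.
  rewrite (le_trans (ler_piMl _ c1_le)) // (le_trans (walk_mean_norm _ _ _ _ _)) //.
  rewrite -[leRHS](walk_mean_cst a1 a2 start m); apply: leE => w.
  have /andP[V0 V1] := @avg1_var_itv R m w; set V := 1 - avg1 m w ^+ 2 in V0 V1 *.
  have kap0 : 0 <= kap.
    have mg := mu_gt; have r0 := mu2_gt0 mu_gt mu_le1.
    by rewrite divr_ge0 // addr_ge0 // invr_ge0 //; lra.
  have e0 : 0 <= V * (s ^+ 2 * v * S) / 2 by rewrite divr_ge0 // mulr_ge0 // mulr_ge0.
  have e1 : 0 <= V * (s ^+ 2 * (v * kap)) / 2.
    by rewrite divr_ge0 // mulr_ge0 // mulr_ge0 ?sqr_ge0 // mulr_ge0.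
  rewrite (le_trans (expRN_lipschitz e0 e1)) //.
  have -> : V * (s ^+ 2 * v * S) / 2 - V * (s ^+ 2 * (v * kap)) / 2 =
    (V / 2) * (s ^+ 2 * v * (S - kap)) by field.
  have V2 : `|V / 2| <= 1 by rewrite ger0_norm ?divr_ge0 //; lra.
  rewrite normrM (le_trans (ler_piMl _ V2)) // normrM (ger0_norm sv0).
  by rewrite ler_wpM2l.
have sV : (sq n)^-1 <= m%:R / sq n by rewrite ler_peMl ?invr_ge0 ?(ltW sn) ?ler1n.
set X := E N _ in step1 *; set Y := E N _ in step1 clt.
set Z := cos th * _ in step3 clt; set W := cos th * _ in step3 *.
have xh : 0 <= h n / h N by rewrite divr_ge0 // ltW.
have xm : 0 <= m%:R / sq n by rewrite divr_ge0 // ltW.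
have := ler_distD Y X W; have := ler_distD Z Y W.
have e5 : (K / sq n + s ^+ 2 * v * del) * S <= (K * (m%:R / sq n) + s ^+ 2 * v * del) * C2.
  have d0 : 0 <= s ^+ 2 * v * del by rewrite mulr_ge0.
  have k0 : 0 <= K / sq n by rewrite divr_ge0 // ltW.
  by apply: ler_pM => //; rewrite ?addr_ge0 // lerD2r ler_wpM2l.
have := le_trans clt err_le; rewrite /del in e5 *.
set g := m%:R `^ (- gam) in e5 *; have g0 : 0 <= g by rewrite powR_ge0.
set x := m%:R / sq n in xm sV e5 step1 step3 *; set y := h n / h N in xh step1 step3 *.
set t := s ^+ 2 * v in sv0 e5 step3 *.
move=> q1 q2 q3.
have f1 : 0 <= (`|s| * C1 + t * C2 + K * C2) * g.
  exact: mulr_ge0 (addr_ge0 (addr_ge0 (mulr_ge0 (normr_ge0 s) C1_ge0) (mulr_ge0 sv0 C2_ge0))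
    (mulr_ge0 K0 C2_ge0)) g0.
have f2 : 0 <= K * C2 * y := mulr_ge0 (mulr_ge0 K0 C2_ge0) xh.
have f3 : 0 <= C2 * t * D * (x + y) := mulr_ge0 (mulr_ge0 (mulr_ge0 C2_ge0 sv0) D0) (addr_ge0 xm xh).
rewrite (le_trans q3) // (le_trans (lerD step1 (le_trans q2 (lerD (le_trans q1 e5) step3)))) //.
rewrite -subr_ge0 [leRHS](_ : _ = (`|s| * C1 + t * C2 + K * C2) * g + K * C2 * y +
  C2 * t * D * (x + y)); last by ring.
by rewrite addr_ge0 // addr_ge0.
Qed.

End walk_fluctuations.

(** * A continuity theorem for cosine means *)

Section bernstein.
Context {R : realType}.
Implicit Types (f g : R -> R) (u v e : R) (n : nat).

(* Bernstein operator, conditioning on the first of [n] coin flips of bias [u]. *)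
Fixpoint bernstein n (phi : nat -> R) u : R :=
  if n is k.+1 then u * bernstein k (fun i => phi i.+1) u + (1 - u) * bernstein k phi u
  else phi 0%N.

Lemma bernstein_lin n c (phi psi : nat -> R) u :
  bernstein n (fun k => c * phi k + psi k) u = c * bernstein n phi u + bernstein n psi u.
Proof. by elim: n phi psi => //= n IH phi psi; rewrite !IH; ring. Qed.

Lemma bernstein_cst n c u : bernstein n (fun=> c) u = c.
Proof. by elim: n => //= n ->; ring. Qed.

Lemma le_bernstein n (phi psi : nat -> R) u : 0 <= u <= 1 ->
  (forall k, phi k <= psi k) -> bernstein n phi u <= bernstein n psi u.
Proof.
move=> u01; have /andP[u0 u1] := u01; elim: n phi psi => [|n IH] phi psi h /=; first exact: h.
by rewrite lerD // ler_wpM2l ?IH // subr_ge0.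
Qed.

(** Binomial variance plus squared bias. The centre varies in the induction because a success on the
    first flip moves it to [a - 1]. *)
Lemma bernstein_sqr n (a : R) u :
  bernstein n (fun k => (k%:R - a) ^+ 2) u = n%:R * (u * (1 - u)) + (n%:R * u - a) ^+ 2.
Proof.
elim: n a => [|n IH] a /=; first by ring.
have -> : bernstein n (fun k => (k.+1%:R - a) ^+ 2) u = bernstein n (fun k => (k%:R - (a - 1)) ^+ 2) u.
  by congr bernstein; apply/funext => k; rewrite -natr1; ring.
by rewrite !IH -(natr1 n); ring.
Qed.

(** Heine-Cantor through the covering form of compactness; only [x] is confined to the segment. *)
Lemma uniform_modulus g (a b e : R) : continuous g -> 0 < e -> exists2 d : R, 0 < d &
  forall x y, a <= x <= b -> `|x - y| < d -> `|g x - g y| <= e.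
Proof.
move=> cg e0.
have /compact_near_coveringP := @segment_compact R a b.
move=> /(_ R (nbhs (0 : R)^'+) (fun d x => forall y, `|x - y| < d -> `|g x - g y| <= e) _) h.
have {h} : \forall d \near (0 : R)^'+, `[a, b]%classic `<=` (fun x => forall y, `|x - y| < d -> `|g x - g y| <= e).
  apply: h => x _.
  have e2 : 0 < e / 2 by rewrite divr_gt0.
  have /cvgrPdist_lt /(_ _ e2) := cg x.
  rewrite /prop_near1 /nbhs /= => -[r /= r0 hr].
  have r2 : 0 < r / 2 by rewrite divr_gt0.
  exists (ball x (r / 2), [set d | 0 < d < r / 2]).
    split => /=; first exact: nbhsx_ballx.
    exists (r / 2) => //= d /=; rewrite sub0r normrN => dr d0; rewrite d0 /=.
    by rewrite -(gtr0_norm d0).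
  move=> [x' d] /= [xx' /andP[d0 dr]] y yd.
  have h1 : `|g x - g x'| < e / 2 by apply: hr; rewrite /ball_ /=; move: xx'; rewrite /ball /=; lra.
  have h2 : `|g x - g y| < e / 2.
    apply: hr; rewrite /ball_ /=; move: xx'; rewrite /ball /= => xx'.
    by have := ler_distD x' x y; lra.
  by rewrite (le_trans (ler_distD (g x) _ _)) // [leRHS]splitr lerD ?(ltW h2) // distrC ltW.
move=> [d /= d0 hd]; exists (d / 2); first by rewrite divr_gt0.
move=> x y xab xy; apply: (hd (d / 2)) => //=.
- by rewrite sub0r normrN gtr0_norm ?divr_gt0 //; lra.
- by rewrite divr_gt0.
Qed.

Lemma bernstein_approx g (M e : R) : continuous g -> (forall x, `|g x| <= M) -> 0 < e ->
  exists n, forall u, 0 <= u <= 1 -> `|g u - bernstein n (fun k => g (k%:R / n%:R)) u| <= e.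
Proof.
move=> cg gM e0; have e2 : 0 < e / 2 by rewrite divr_gt0.
have [d d0 hd] := uniform_modulus 0 1 cg e2.
have M0 : 0 <= M by rewrite (le_trans _ (gM 0)).
have [n n0 hn] : exists2 n, (0 < n)%N & M / (d ^+ 2) / n%:R <= e / 2.
  have X0 : 0 <= M / d ^+ 2 / (e / 2) by rewrite divr_ge0 ?(ltW e2) // divr_ge0 ?sqr_ge0.
  exists (Num.bound (M / d ^+ 2 / (e / 2))).+1 => //.
  rewrite ler_pdivrMr ?ltr0n // [leRHS]mulrC -ler_pdivrMr // ltW // (lt_trans (archi_boundP X0)) //.
  by rewrite ltr_nat.
exists n => u u01; have /andP[u0 u1] := u01.
have np : 0 < n%:R :> R by rewrite ltr0n.
(* Chebyshev: where [|u - k / n| >= d], the trivial bound 2 M is at most 2 M (u - k / n)^2 / d^2,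
   whose binomial mean is O(1/n). *)
pose c := 2 * M / d ^+ 2 / n%:R ^+ 2.
have c0 : 0 <= c by rewrite !divr_ge0 ?sqr_ge0 // mulr_ge0.
have dev k : `|g u - g (k%:R / n%:R)| <= c * (k%:R - n%:R * u) ^+ 2 + e / 2.
  have [lt_d|ge_d] := ltP `|u - k%:R / n%:R| d.
    by rewrite (le_trans (hd _ _ u01 lt_d)) // lerDr mulr_ge0 ?sqr_ge0.
  rewrite (@le_trans _ _ (2 * M)) //.
    by rewrite (le_trans (ler_normB _ _)) //; have := gM u; have := gM (k%:R / n%:R); lra.
  have -> : c * (k%:R - n%:R * u) ^+ 2 = 2 * M / d ^+ 2 * `|u - k%:R / n%:R| ^+ 2.
    by rewrite real_normK ?num_real // /c; field; rewrite !gt_eqF.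
  rewrite -[leLHS]addr0 lerD ?(ltW e2) // -mulrA ler_peMr ?mulr_ge0 //.
  by rewrite mulrC ler_pdivlMr ?exprn_gt0 // mul1r lerXn2r // ?nnegrE ltW // (lt_le_trans d0).
have bd : bernstein n (fun k => c * (k%:R - n%:R * u) ^+ 2 + e / 2) u <= e.
  rewrite bernstein_lin bernstein_cst bernstein_sqr subrr expr0n addr0.
  have : c * (n%:R * (u * (1 - u))) <= M / d ^+ 2 / n%:R.
    have -> : c * (n%:R * (u * (1 - u))) = M / d ^+ 2 / n%:R * (2 * (u * (1 - u))).
      by rewrite /c; field; rewrite !gt_eqF.
    rewrite ler_piMr ?divr_ge0 ?sqr_ge0 //.
    by have := sqr_ge0 (u - 2^-1); nra.
  by move=> ?; lra.
have gE : bernstein n (fun k => - 1 * g (k%:R / n%:R) + g u) u =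
    g u - bernstein n (fun k => g (k%:R / n%:R)) u.
  by rewrite bernstein_lin bernstein_cst mulN1r addrC.
rewrite -gE ler_norml; apply/andP; split.
  rewrite -(@bernstein_cst n (- e) u).
  have -> : - e = - 1 * e + 0 by lra.
  rewrite (le_trans (_ : _ <= bernstein n (fun k => - 1 * (c * (k%:R - n%:R * u) ^+ 2 + e / 2) + 0) u)) //.
    by rewrite bernstein_cst bernstein_lin bernstein_cst; lra.
  apply: le_bernstein => // k; have := dev k; rewrite ler_norml => /andP[]; lra.
rewrite (le_trans _ bd) //; apply: le_bernstein => // k.
by have := dev k; rewrite ler_norml => /andP[]; lra.
Qed.

End bernstein.

(** * From cosine means to bounded continuous test functions *)

Section levy.
Context {R : realType}.
Implicit Types (f g t : R -> R) (e : R) (n : nat).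

Definition bcont f := continuous f /\ exists M : R, forall x, `|f x| <= M.

(** A normalised positive linear functional, so that the approximating laws and the limit law are
    treated alike. *)
Record is_mean (F : (R -> R) -> R) : Prop := IsMean {
  mean_lin : forall c f g, bcont f -> bcont g -> F (fun x => c * f x + g x) = c * F f + F g;
  mean_ge0 : forall f, bcont f -> (forall x, 0 <= f x) -> 0 <= F f;
  mean1 : F (fun=> 1) = 1 }.

Lemma bcont_cst (c : R) : bcont (fun=> c).
Proof. by split; [move=> x; exact: cvg_cst|exists `|c|]. Qed.

Lemma bcontD f g : bcont f -> bcont g -> bcont (fun x => f x + g x).
Proof.
move=> [cf [M fM]] [cg [N gN]]; split; first by move=> x; apply: cvgD; [exact: cf|exact: cg].
by exists (M + N) => x; rewrite (le_trans (ler_normD _ _)) // lerD.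
Qed.

Lemma bcontM f g : bcont f -> bcont g -> bcont (fun x => f x * g x).
Proof.
move=> [cf [M fM]] [cg [N gN]]; split; first by move=> x; apply: cvgM; [exact: cf|exact: cg].
by exists (M * N) => x; rewrite normrM ler_pM.
Qed.

Lemma bcontZ (c : R) f : bcont f -> bcont (fun x => c * f x).
Proof. exact: (bcontM (bcont_cst c)). Qed.

Lemma bcont_lin (c : R) f g : bcont f -> bcont g -> bcont (fun x => c * f x + g x).
Proof. by move=> bf bg; apply: bcontD => //; exact: bcontZ. Qed.

Lemma continuous_affine (a b : R) : continuous (fun x : R => a + b * x).
Proof.
by move=> x; apply: cvgD; [exact: cvg_cst|apply: cvgM; [exact: cvg_cst|exact: cvg_id]].
Qed.

Lemma bcont_cos (a b : R) : bcont (fun x => cos (a + b * x)).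
Proof.
split; last by exists 1 => x; rewrite ler_norml cos_geN1 cos_le1.
by move=> x; apply: (@continuous_comp _ _ _ (fun x => a + b * x) cos);
  [exact: continuous_affine|exact: continuous_cos].
Qed.

Lemma bcont_sin (b : R) : bcont (fun x => sin (b * x)).
Proof.
have -> : (fun x => sin (b * x)) = (fun x => cos (- (pi / 2) + b * x)).
  by apply/funext => x; rewrite addrC cosBpihalf.
exact: bcont_cos.
Qed.

(** A continuous majorant of the indicator of [|x| > K] that is itself at most [|x| / K]: tightness
    is tested on it, and a first moment controls it as in Markov's inequality. *)
Definition cutoff (K x : R) : R := Num.min (`|x| / K) 1.

Lemma cutoff_ge0 K x : 0 <= K -> 0 <= cutoff K x.
Proof. by move=> K0; rewrite le_min ler01 andbT divr_ge0. Qed.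

Lemma bcont_cutoff K : 0 < K -> bcont (cutoff K).
Proof.
move=> K0; split.
  move=> x; apply: (@continuous_min R R (fun x => `|x| / K : R^o) (fun=> 1 : R^o)); last exact: cvg_cst.
  by apply: cvgM; [exact: norm_continuous|exact: cvg_cst].
exists 1 => x; rewrite ger0_norm ?cutoff_ge0 ?(ltW K0) //.
by rewrite /cutoff ge_min lexx orbT.
Qed.

Section mean_theory.
Context (F : (R -> R) -> R) (mF : is_mean F).

Lemma mean_cst c : F (fun=> c) = c.
Proof.
have h0 : F (fun=> 0) = 0.
  have := mean_lin mF (- 1) (bcont_cst 0) (bcont_cst 0).
  have -> : (fun=> -1 * 0 + 0) = (fun=> 0) :> (R -> R) by apply/funext => x; lra.
  lra.
have := mean_lin mF c (bcont_cst 1) (bcont_cst 0).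
by rewrite (mean1 mF) h0 mulr1 !addr0.
Qed.

Lemma le_mean f g : bcont f -> bcont g -> (forall x, f x <= g x) -> F f <= F g.
Proof.
move=> bf bg fg; have := mean_lin mF (- 1) bf bg; rewrite mulN1r addrC => e.
rewrite -subr_ge0 -e; apply: (mean_ge0 mF); first exact: bcont_lin.
by move=> x; have := fg x; lra.
Qed.

Lemma mean_dist f g h : bcont f -> bcont g -> bcont h ->
  (forall x, `|f x - g x| <= h x) -> `|F f - F g| <= F h.
Proof.
move=> bf bg bh fgh.
have fg x := fgh x; have le1 : F f <= F h + F g.
  have := mean_lin mF 1 bh bg; rewrite mul1r => <-; apply: le_mean => //; first exact: bcont_lin.
  by move=> x; have := fg x; rewrite ler_norml => /andP[_]; lra.
have le2 : F g <= F h + F f.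
  have := mean_lin mF 1 bh bf; rewrite mul1r => <-; apply: le_mean => //; first exact: bcont_lin.
  by move=> x; have := fg x; rewrite ler_norml => /andP[+ _]; lra.
by rewrite ler_norml; apply/andP; split; lra.
Qed.

End mean_theory.

Context (Fn : nat -> (R -> R) -> R) (F : (R -> R) -> R).
Context (mFn : forall n, is_mean (Fn n)) (mF : is_mean F).
Context (cvg_cos : forall a b : R, Fn n (fun x => cos (a + b * x)) @[n --> \oo] --> F (fun x => cos (a + b * x))).

(** Testing against [t] times every cosine makes the class stable under multiplication by sines,
    through the product-to-sum formulas. *)
Definition cvg_trig t := bcont t /\
  forall a b : R, Fn n (fun x => t x * cos (a + b * x)) @[n --> \oo] --> F (fun x => t x * cos (a + b * x)).

Lemma cvg_trig1 : cvg_trig (fun=> 1).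
Proof.
split; first exact: bcont_cst.
move=> a b; have -> : (fun x => 1 * cos (a + b * x)) = (fun x => cos (a + b * x)).
  by apply/funext => x; rewrite mul1r.
exact: cvg_cos.
Qed.

Lemma cvg_mean_lin c f g : bcont f -> bcont g ->
  Fn n f @[n --> \oo] --> F f -> Fn n g @[n --> \oo] --> F g ->
  Fn n (fun x => c * f x + g x) @[n --> \oo] --> F (fun x => c * f x + g x).
Proof.
move=> bf bg hf hg; rewrite (mean_lin mF) //.
have -> : (fun n => Fn n (fun x => c * f x + g x)) = (fun n => c * Fn n f + Fn n g).
  by apply/funext => n; rewrite (mean_lin (mFn n)).
by apply: cvgD => //; apply: cvgM => //; exact: cvg_cst.
Qed.

Lemma cvg_trig_lin c t t' : cvg_trig t -> cvg_trig t' -> cvg_trig (fun x => c * t x + t' x).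
Proof.
move=> [bt ht] [bt' ht']; split; first exact: bcont_lin.
move=> a b.
have -> : (fun x => (c * t x + t' x) * cos (a + b * x)) =
  (fun x => c * (t x * cos (a + b * x)) + t' x * cos (a + b * x)).
  by apply/funext => x; ring.
by apply: cvg_mean_lin => //; apply: bcontM => //; exact: bcont_cos.
Qed.

Lemma cvg_trigM_sin w t : cvg_trig t -> cvg_trig (fun x => t x * sin (w * x)).
Proof.
move=> [bt ht]; split; first by apply: bcontM => //; exact: bcont_sin.
move=> a b.
have -> : (fun x => t x * sin (w * x) * cos (a + b * x)) =
  (fun x => 2^-1 * (t x * cos (a - pi / 2 + (b + w) * x)) +
    (2^-1 * (t x * cos (- a - pi / 2 + (w - b) * x)) + 0)).
  apply/funext => x; rewrite addr0.
  rewrite (_ : a - pi / 2 + (b + w) * x = w * x + (a + b * x) - pi / 2); last by ring.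
  rewrite (_ : - a - pi / 2 + (w - b) * x = w * x - (a + b * x) - pi / 2); last by ring.
  by rewrite !cosBpihalf; set z := a + b * x; rewrite sinB sinD; field.
have b0 : bcont (fun=> 0 : R) by exact: bcont_cst.
have bc (p q : R) : bcont (fun x => t x * cos (p + q * x)) by apply: bcontM => //; exact: bcont_cos.
apply: cvg_mean_lin => //; first exact: bcont_lin.
apply: cvg_mean_lin => //; rewrite (mean_cst mF).
by under eq_fun do rewrite (mean_cst (mFn _)); exact: cvg_cst.
Qed.

Lemma cvg_trig_half w (p q : R) t : cvg_trig t -> cvg_trig (fun x => (p + q * sin (w * x)) * t x).
Proof.
move=> ht.
have -> : (fun x => (p + q * sin (w * x)) * t x) =
   (fun x => p * t x + (q * (t x * sin (w * x)) + 0 * t x)).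
  by apply/funext => x; ring.
have h0 : cvg_trig (fun x => 0 * t x).
  have -> : (fun x => 0 * t x) = (fun x => - 1 * t x + t x) by apply/funext => x; ring.
  exact: cvg_trig_lin.
by apply: cvg_trig_lin => //; apply: cvg_trig_lin => //; exact: cvg_trigM_sin.
Qed.

Lemma cvg_trig_bernstein w n (phi : nat -> R) :
  cvg_trig (fun x => bernstein n phi ((1 + sin (w * x)) / 2)).
Proof.
elim: n phi => [|n IH] phi /=.
  have -> : (fun=> phi 0%N) = (fun x : R => (phi 0%N + 0 * sin (w * x)) * 1).
    by apply/funext => x; ring.
  by apply: cvg_trig_half; exact: cvg_trig1.
have -> : (fun x => (1 + sin (w * x)) / 2 * bernstein n (fun i => phi i.+1) ((1 + sin (w * x)) / 2) +
    (1 - (1 + sin (w * x)) / 2) * bernstein n phi ((1 + sin (w * x)) / 2)) =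
  (fun x => 1 * ((2^-1 + 2^-1 * sin (w * x)) * bernstein n (fun i => phi i.+1) ((1 + sin (w * x)) / 2)) +
    (2^-1 + (- 2^-1) * sin (w * x)) * bernstein n phi ((1 + sin (w * x)) / 2)).
  by apply/funext => x; field.
by apply: cvg_trig_lin; exact: cvg_trig_half.
Qed.

(** On [|x| <= K] the arcsine recovers x from sin (x / K), so [f] becomes a continuous function of
    (1 + sin (x / K)) / 2 in [0, 1], to which Bernstein approximation applies. The bound by [M]
    persists everywhere since a Bernstein value averages values of [f]. *)
Lemma trig_approx f (M e K : R) : continuous f -> (forall x, `|f x| <= M) -> 0 < e -> 0 < K ->
  exists t, [/\ cvg_trig t, forall x, `|t x| <= M & forall x, `|x| <= K -> `|f x - t x| <= e].
Proof.
move=> cf fM e0 K0.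
(* Clipping keeps the arcsine inside the open interval, hence continuous; as sin 1 < 9/10 it changes
   nothing for [|x| <= K]. *)
pose clip (y : R) := Num.max (- (9 / 10)) (Num.min y (9 / 10)).
have clip_itv y : -1 < clip y < 1.
  apply/andP; split; first by rewrite lt_max; apply/orP; left; lra.
  by rewrite gt_max gt_min; apply/andP; split; [lra|apply/orP; right; lra].
have cclip : continuous clip.
  move=> x; apply: (@continuous_max R R (fun=> - (9 / 10) : R^o) (fun y => Num.min y (9 / 10) : R^o)).
    exact: cvg_cst.
  apply: (@continuous_min R R (fun y => y : R^o) (fun=> 9 / 10 : R^o)); last exact: cvg_cst.
  exact: cvg_id.
pose g (u : R) : R := f (K * asin (clip (-1 + 2 * u))).
have cg : continuous g.
  move=> u; rewrite /g.
  apply: (@continuous_comp R R R (fun u : R => K * asin (clip (-1 + 2 * u))) f); last exact: cf.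
  apply: cvgM; first exact: cvg_cst.
  apply: (@continuous_comp R R R (fun u : R => clip (-1 + 2 * u)) asin); last exact: continuous_asin.
  by apply: (@continuous_comp R R R (fun u : R => -1 + 2 * u) clip); [exact: continuous_affine|exact: cclip].
have [n hn] := bernstein_approx cg (fun u => fM _) e0.
have half (x : R) : 0 <= (1 + sin (K^-1 * x)) / 2 <= 1.
  by have := sin_geN1 (K^-1 * x); have := sin_le1 (K^-1 * x); lra.
exists (fun x => bernstein n (fun k => g (k%:R / n%:R)) ((1 + sin (K^-1 * x)) / 2)); split.
- exact: cvg_trig_bernstein.
- move=> x; rewrite ler_norml -{1}(bernstein_cst n (- M) ((1 + sin (K^-1 * x)) / 2)).
  rewrite -[X in _ && (_ <= X)](bernstein_cst n M ((1 + sin (K^-1 * x)) / 2)).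
  by apply/andP; split; apply: le_bernstein => // k;
    have := fM (K * asin (clip (-1 + 2 * (k%:R / n%:R)))); rewrite ler_norml => /andP[].
move=> x xK; have := hn _ (half x).
suff -> : g ((1 + sin (K^-1 * x)) / 2) = f x by [].
rewrite /g; set z := K^-1 * x.
have z1 : `|z| <= 1.
  by rewrite /z normrM gtr0_norm ?invr_gt0 // mulrC ler_pdivrMr // mul1r.
have cz : 2^-1 <= cos z.
  have cE : cos z = cos `|z| by have [x0|x0] := leP 0 z; [rewrite ger0_norm|rewrite ltr0_norm// cosN].
  have := cos_ge_quadratic (normr_ge0 z); rewrite -cE.
  have : `|z| ^+ 2 <= 1 by rewrite exprn_ile1.
  lra.
have sz := cos2Dsin2 z.
have s1 : sin z <= 9 / 10 by nra.
have s2 : - (9 / 10) <= sin z by nra.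
have -> : -1 + 2 * ((1 + sin z) / 2) = sin z by field.
have -> : clip (sin z) = sin z by rewrite /clip min_l // max_r.
rewrite sinK.
  by rewrite /z mulrA divff ?mul1r // gt_eqF.
have := pihalf_ge1 R; move: z1; rewrite ler_norml in_itv /= => /andP[z1 z2] p1.
by apply/andP; split; lra.
Qed.

Lemma levy_cvg : (forall e : R, 0 < e -> exists2 K : R, 0 < K &
    F (cutoff K) <= e /\ forall n, (0 < n)%N -> Fn n (cutoff K) <= e) ->
  forall f, bcont f -> Fn n f @[n --> \oo] --> F f.
Proof.
move=> tight f bf; have [cf [M fM]] := bf.
have M0 : 0 <= M by rewrite (le_trans _ (fM 0)).
apply/cvgrPdist_le => e e0.
have e6 : 0 < e / 6 by rewrite divr_gt0.
(* Chosen so that 2 M times the mean of the cutoff, plus e / 6, is at most e / 3. *)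
have eM : 0 < e / 6 / (2 * M + 1) by rewrite divr_gt0 //; lra.
have [K K0 [tF tn]] := tight _ eM.
have [t [[bt ht] tM tf]] := trig_approx cf fM e6 K0.
have bh : bcont (fun x => 2 * M * cutoff K x + e / 6).
  by apply: bcont_lin; [exact: bcont_cutoff|exact: bcont_cst].
have close x : `|f x - t x| <= 2 * M * cutoff K x + e / 6.
  have [xK|xK] := leP `|x| K.
    rewrite (le_trans (tf _ xK)) // lerDr mulr_ge0 ?cutoff_ge0 ?(ltW K0) // mulr_ge0 //.
  have -> : cutoff K x = 1 by rewrite /cutoff min_r // ler_pdivlMr // mul1r ltW.
  by rewrite (le_trans (ler_normB _ _)) //; have := fM x; have := tM x; lra.
have cl (G : (R -> R) -> R) : is_mean G -> G (cutoff K) <= e / 6 / (2 * M + 1) -> `|G f - G t| <= e / 3.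
  move=> mG hG; rewrite (le_trans (mean_dist mG bf bt bh close)) //.
  rewrite (mean_lin mG) ?(mean_cst mG); [|exact: bcont_cutoff|exact: bcont_cst].
  have M1 : 0 <= 2 * M + 1 by lra.
  have G0 : 0 <= G (cutoff K).
    apply: (mean_ge0 mG); first exact: bcont_cutoff.
    by move=> x; rewrite cutoff_ge0 // ltW.
  have : (2 * M + 1) * G (cutoff K) <= e / 6.
    by rewrite mulrC -ler_pdivlMr //; lra.
  lra.
have ht0 : Fn n t @[n --> \oo] --> F t.
  have := ht 0 0.
  suff -> : (fun x => t x * cos (0 + 0 * x)) = t by [].
  by apply/funext => x; rewrite mul0r addr0 cos0 mulr1.
have e3 : 0 < e / 3 by rewrite divr_gt0.
move/cvgrPdist_le : ht0 => /(_ _ e3) ht0.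
near=> n.
have n0 : (0 < n)%N by near: n; exact: nbhs_infty_gt.
have h1 := cl F mF tF; have h2 := cl (Fn n) (mFn n) (tn n n0).
have h3 : `|F t - Fn n t| <= e / 3 by near: n.
have := ler_distD (F t) (F f) (Fn n f); have := ler_distD (Fn n t) (F t) (Fn n f).
rewrite (distrC (Fn n t)); lra.
Unshelve. all: by end_near. Qed.

End levy.

(** * The Gaussian characteristic function *)

Section dominated.
Context d (T : measurableType d) (R : realType) (mu : {measure set T -> \bar R}).
Implicit Types f g : T -> R.

Lemma integrable_dominated f g : measurable_fun setT f -> mu.-integrable setT (EFin \o g) ->
  (forall x, `|f x| <= g x) -> mu.-integrable setT (EFin \o f).
Proof.
move=> mf ig fg; apply: (le_integrable measurableT _ _ ig); first exact/measurable_EFinP.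
by move=> x _ /=; rewrite lee_fin (le_trans (fg x)) // ler_norm.
Qed.

Lemma Rintegral_dominated_cvg (fn : nat -> T -> R) f g :
  (forall n, measurable_fun setT (fn n)) -> measurable_fun setT f ->
  {ae mu, forall x, fn n x @[n --> \oo] --> f x} ->
  mu.-integrable setT (EFin \o g) -> (forall n x, `|fn n x| <= g x) ->
  \int[mu]_x fn n x @[n --> \oo] --> \int[mu]_x f x.
Proof.
move=> mfn mf fnf ig fg.
have fE : {ae mu, forall x, setT x -> (fn n x)%:E @[n --> \oo] --> (EFin \o f) x}.
  by apply: filterS fnf => x fx _; apply: cvg_EFin => //; exact: nearW.
have gE : {ae mu, forall x n, setT x -> (`|(fn n x)%:E| <= (EFin \o g) x)%E}.
  by apply: aeW => x n _; rewrite lee_fin.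
have [if_ _ h] := @dominated_convergence _ _ _ mu setT measurableT
  (fun n x => (fn n x)%:E) (EFin \o f) (EFin \o g)
  (fun n => (measurable_EFinP _ _).2 (mfn n)) ((measurable_EFinP _ _).2 mf) fE ig gE.
by apply: fine_cvg; rewrite fineK; last exact: integrable_fin_num if_.
Qed.

End dominated.

Section gaussian.
Context {R : realType} (sg : R) (sg_neq0 : sg != 0).
Local Notation mu := (@lebesgue_measure R).
Local Notation p := (normal_pdf 0 sg).
Local Notation c := (- (2 * sg ^+ 2)^-1).

Lemma sg2_gt0 : 0 < sg ^+ 2. Proof. by rewrite exprn_even_gt0. Qed.

Lemma normal_pdf_expR x : p x = normal_peak sg * expR (c * x ^+ 2).
Proof.
rewrite normal_pdfE // /normal_fun subr0; congr (_ * expR _).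
by rewrite -mulr_natl; field.
Qed.

(** The Radon-Nikodym derivative of the normal law agrees almost everywhere with [normal_pdf]. *)
Lemma integral_normal_prob (f : R -> R) : measurable_fun setT f -> (exists M : R, forall x, `|f x| <= M) ->
  (\int[normal_prob 0 sg]_x (f x)%:E = \int[mu]_x (f x * p x)%:E)%E.
Proof.
move=> mf [M fM].
have dom := normal_prob_dominates (0 : R) sg.
have intf : (normal_prob 0 sg).-integrable setT (EFin \o f).
  apply: (integrable_dominated (g := fun=> M)) => //; exact: finite_measure_integrable_cst.
rewrite -(Radon_Nikodym_change_of_variables dom) //=.
under [RHS]eq_integral do rewrite EFinM.
apply: ae_eq_integral => //.
- apply: emeasurable_funM; first exact/measurable_EFinP.
  by apply: measurable_int; exact: Radon_Nikodym_integrable.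
- apply: emeasurable_funM; first exact/measurable_EFinP.
  by apply/measurable_EFinP; exact: measurable_normal_pdf.
apply: ae_eqe_mul2l; rewrite Radon_NikodymE //=.
case: cid => /= h [h1 h2 h3]; apply: integral_ae_eq => //=.
- by apply/measurable_EFinP; exact: measurable_normal_pdf.
- by move=> E _ mE; rewrite -h3.
Qed.

(** Half of the Gaussian exponent absorbs [|x|], leaving a normal density of doubled variance. This
    gives integrability of x p(x) and the dominating function for differentiating under the
    integral. *)
Lemma normal_pdf_moment_bound : exists C : R, forall x, `|x| * p x <= C * normal_pdf 0 (Num.sqrt 2 * sg) x.
Proof.
have s2 := sg2_gt0; have q0 : 0 < Num.sqrt 2 :> R by rewrite sqrtr_gt0.
have t0 : Num.sqrt 2 * sg != 0 by rewrite mulf_neq0 // gt_eqF.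
have pk0 := normal_peak_gt0 t0; have pk1 := normal_peak_gt0 sg_neq0.
(* With y = x^2 / (4 sg^2): [|x| <= 1 + x^2 <= (1 + 4 sg^2) (1 + y) <= (1 + 4 sg^2) exp y]. *)
exists (normal_peak sg * (1 + 4 * sg ^+ 2) / normal_peak (Num.sqrt 2 * sg)) => x.
rewrite normal_pdf_expR normal_pdfE // /normal_fun subr0.
rewrite [leRHS]mulrA divfK ?gt_eqF // mulrCA -mulrA ler_pM2l //.
have -> : - x ^+ 2 / ((Num.sqrt 2 * sg) ^+ 2 *+ 2) = - (x ^+ 2 / (4 * sg ^+ 2)).
  by rewrite exprMn sqr_sqrtr // -mulr_natr; field.
set y := x ^+ 2 / (4 * sg ^+ 2).
have -> : c * x ^+ 2 = - y + - y by rewrite /y; field.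
have y0 : 0 <= y by rewrite divr_ge0 ?sqr_ge0 // mulr_ge0 // ltW.
rewrite expRD mulrA ler_pM2r ?expR_gt0 // -ler_pdivlMr ?expR_gt0 // expRN invrK.
have h := expR_ge1Dx y.
rewrite (@le_trans _ _ ((1 + 4 * sg ^+ 2) * (1 + y))) //; last by rewrite ler_wpM2l // addr_ge0 // mulr_ge0 // ltW.
have -> : (1 + 4 * sg ^+ 2) * (1 + y) = 1 + 4 * sg ^+ 2 + y + x ^+ 2 by rewrite /y; field.
have : `|x| <= 1 + x ^+ 2 by rewrite -(real_normK (num_real x)); have := sqr_ge0 (`|x| - 1); nra.
lra.
Qed.

Lemma integrable_pdfM (f : R -> R) : measurable_fun setT f -> (forall x, `|f x| <= 1) ->
  mu.-integrable setT (EFin \o (fun x => f x * p x)).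
Proof.
move=> mf f1; apply: (@integrable_dominated _ _ R mu _ p).
- by apply: measurable_funM => //; exact: measurable_normal_pdf.
- exact: integrable_normal_pdf.
- by move=> x; rewrite normrM (ger0_norm (normal_pdf_ge0 _ _ _)) ler_piMl ?normal_pdf_ge0.
Qed.

Lemma integrable_id_pdfM (f : R -> R) : measurable_fun setT f -> (forall x, `|f x| <= 1) ->
  mu.-integrable setT (EFin \o (fun x => x * f x * p x)).
Proof.
move=> mf f1; have [C hC] := normal_pdf_moment_bound.
apply: (@integrable_dominated _ _ R mu _ (fun x => C * normal_pdf 0 (Num.sqrt 2 * sg) x)).
- apply: measurable_funM; last exact: measurable_normal_pdf.
  by apply: measurable_funM.
- have := integrableZl measurableT C (integrable_normal_pdf 0 (Num.sqrt 2 * sg)).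
  by apply: eq_integrable => // x _ /=; rewrite EFinM.
- move=> x; rewrite (le_trans _ (hC x)) // !normrM (ger0_norm (normal_pdf_ge0 _ _ _)).
  by rewrite ler_wpM2r ?normal_pdf_ge0 // ler_piMr.
Qed.

Lemma measurable_cos_affine (a b : R) : measurable_fun setT (fun x : R => cos (a + b * x)).
Proof. by apply: continuous_measurable_fun; case: (bcont_cos a b). Qed.

Lemma sin_affineE (a b : R) : (fun x : R => sin (a + b * x)) = (fun x => cos ((a - pi / 2) + b * x)).
Proof. by apply/funext => x; rewrite addrAC cosBpihalf. Qed.

Lemma measurable_sin_affine (a b : R) : measurable_fun setT (fun x : R => sin (a + b * x)).
Proof. by rewrite sin_affineE; exact: measurable_cos_affine. Qed.

Lemma cos_norm_le1 (x : R) : `|cos x| <= 1. Proof. exact: cos_max. Qed.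

Lemma sin_norm_le1 (x : R) : `|sin x| <= 1.
Proof. by rewrite ler_norml sin_geN1 sin_le1. Qed.

Lemma Rintegral_itv_cvg (f : R -> R) : mu.-integrable setT (EFin \o f) ->
  \int[mu]_(x in `[(- n%:R : R), n%:R]) f x @[n --> \oo] --> \int[mu]_x f x.
Proof.
move=> intf; pose In n := `[(- n%:R : R), n%:R]%classic.
have -> : (fun n : nat => \int[mu]_(x in `[(- n%:R : R), n%:R]) f x) =
    (fun n => \int[mu]_x (f \_ (In n)) x).
  by apply/funext => n; rewrite Rintegral_mkcond.
have mf : measurable_fun setT f by apply/measurable_EFinP; exact: measurable_int intf.
apply: (@Rintegral_dominated_cvg _ _ R mu (fun n => f \_ (In n)) f (fun x => `|f x|)) => //.
- move=> n; have mI : measurable (In n) by exact: measurable_itv.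
  by apply: (measurable_restrictT f mI).1; exact: measurable_funS measurableT (@subsetT _ _) mf.
- apply: aeW => x; apply/cvgrPdist_le => e e0; near=> n.
  rewrite patchE mem_set ?subrr ?normr0 ?(ltW e0) //=.
  rewrite /In /= in_itv /= -ler_norml.
  by near: n; exact: nbhs_infty_ger.
- by have := integrable_norm intf.
- by move=> n x; rewrite patchE; case: ifP => // _; rewrite normr0.
Unshelve. all: by end_near. Qed.

(** Stein's identity: the derivative [g] of sin (a + b x) p(x) integrates to 0 because the boundary
    values vanish. *)
Lemma normal_stein (a b : R) :
  \int[mu]_x (x * sin (a + b * x) * p x) = sg ^+ 2 * b * \int[mu]_x (cos (a + b * x) * p x).
Proof.
pose G x := sin (a + b * x) * p x.
pose g x := b * (cos (a + b * x) * p x) + 2 * c * (x * sin (a + b * x) * p x).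
have i1 := integrable_pdfM (measurable_cos_affine a b) (fun x => cos_norm_le1 _).
have i2 := integrable_id_pdfM (measurable_sin_affine a b) (fun x => sin_norm_le1 _).
have i1' : mu.-integrable setT (EFin \o (fun x => b * (cos (a + b * x) * p x))).
  by have := integrableZl measurableT b i1; apply: eq_integrable => // x _ /=; rewrite EFinM.
have i2' : mu.-integrable setT (EFin \o (fun x => 2 * c * (x * sin (a + b * x) * p x))).
  by have := integrableZl measurableT (2 * c) i2; apply: eq_integrable => // x _ /=; rewrite EFinM.
have intg : mu.-integrable setT (EFin \o g).
  by have := integrableD measurableT i1' i2'; apply: eq_integrable => // x _ /=; rewrite EFinD.
have dG (x : R) : is_derive x 1 G (g x).
  rewrite /G /g; under eq_fun do rewrite normal_pdf_expR.
  rewrite normal_pdf_expR.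
  by apply: is_derive_eq; rewrite /GRing.scale /=; ring.
have cp : continuous p by exact: continuous_normal_pdf.
have cg : continuous g.
  have [cc _] := bcont_cos a b; have [cs _] : bcont (fun x => sin (a + b * x)).
    by rewrite sin_affineE; exact: bcont_cos.
  move=> x; apply: cvgD; apply: cvgM; [exact: cvg_cst| |exact: cvg_cst|].
    by apply: cvgM; [exact: cc|exact: cp].
  by apply: cvgM; [apply: cvgM; [exact: cvg_id|exact: cs]|exact: cp].
have ftc n : (0 < n)%N -> \int[mu]_(x in `[(- n%:R : R), n%:R]) g x = G n%:R - G (- n%:R).
  move=> n0; have np : - n%:R < n%:R :> R by have : 0 < n%:R :> R; [rewrite ltr0n|lra].
  rewrite /Rintegral (@continuous_FTC2 _ g G) //.
  - exact: continuous_subspaceT.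
  - have cG : continuous G.
      by move=> x; apply: differentiable_continuous; apply/derivable1_diffP; have [] := dG x.
    split => [x _||].
    + by have [] := dG x.
    + exact/cvg_at_right_filter/cG.
    + exact/cvg_at_left_filter/cG.
  - by move=> x _; rewrite derive1E; have [_ ->] := dG x.
have s2 := sg2_gt0.
have G0 : (fun n => G n%:R - G (- n%:R)) @ \oo --> (0 : R).
  (* From exp (- z) <= 1 / z the density at n is at most peak * 2 sg^2 / n^2; there are two
     endpoints. *)
  pose K : R := 2 * (normal_peak sg * (2 * sg ^+ 2)).
  have K0 : 0 <= K by rewrite /K mulr_ge0 // mulr_ge0 ?normal_peak_ge0 // mulr_ge0 // ltW.
  have small n : (0 < n)%N -> `|G n%:R - G (- n%:R)| <= K / n%:R.
    move=> n0; have n1 : 1 <= n%:R :> R by rewrite ler1n.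
    have np : 0 < n%:R :> R by rewrite ltr0n.
    have pb x : `|x| = n%:R -> `|G x| <= normal_peak sg * (2 * sg ^+ 2) / n%:R.
      move=> xn; rewrite normrM (ger0_norm (normal_pdf_ge0 _ _ _)).
      rewrite (le_trans (ler_piMl (normal_pdf_ge0 _ _ _) (sin_norm_le1 _))) //.
      rewrite normal_pdf_expR -mulrA ler_wpM2l ?normal_peak_ge0 //.
      rewrite -(real_normK (num_real x)) xn mulNr expRN.
      set z := (2 * sg ^+ 2)^-1 * n%:R ^+ 2.
      have z0 : 0 < z by rewrite mulr_gt0 ?exprn_gt0 // invr_gt0 mulr_gt0.
      rewrite (@le_trans _ _ z^-1) //.
        by rewrite lef_pV2 ?posrE ?expR_gt0 //; have := expR_ge1Dx z; lra.
      have s20 : 0 <= 2 * sg ^+ 2 by rewrite mulr_ge0 // ltW.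
      rewrite /z invfM invrK ler_wpM2l //.
      by rewrite lef_pV2 ?posrE ?exprn_gt0 // expr2 ler_peMl // ltW.
    rewrite (le_trans (ler_normB _ _)) //.
    have -> : K / n%:R = normal_peak sg * (2 * sg ^+ 2) / n%:R + normal_peak sg * (2 * sg ^+ 2) / n%:R.
      by rewrite /K; ring.
    by rewrite lerD // pb // ?normrN normr_nat.
  apply/cvgrPdist_le => e e0; near=> n; rewrite sub0r normrN.
  have n0 : (0 < n)%N by near: n; exact: nbhs_infty_gt.
  rewrite (le_trans (small n n0)) // ler_pdivrMr ?ltr0n // mulrC -ler_pdivrMr //.
  by near: n; exact: nbhs_infty_ger.
have intg0 : \int[mu]_x g x = 0.
  have h := Rintegral_itv_cvg intg.
  have h' : \int[mu]_(x in `[(- n%:R : R), n%:R]) g x @[n --> \oo] --> (0 : R).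
    apply: cvg_trans G0; apply: near_eq_cvg; near=> n; rewrite ftc //.
    by near: n; exact: nbhs_infty_gt.
  exact: (cvg_unique _ h h').
move: intg0; rewrite /g RintegralD // !RintegralZl // => h.
apply: (@mulfI _ (2 * c)); first by rewrite mulf_neq0 // oppr_eq0 invr_eq0 gt_eqF // mulr_gt0.
have -> : 2 * c * (sg ^+ 2 * b * \int[mu]_x (cos (a + b * x) * p x)) =
   - (b * \int[mu]_x (cos (a + b * x) * p x)) by field.
lra.
Unshelve. all: by end_near. Qed.

(** Differentiating under the integral and applying Stein's identity yields the equation F' = - sg^2
    s F. *)
Lemma normal_cf_derive (a s : R) : is_derive s 1 (fun s => \int[mu]_x (cos (a + s * x) * p x))
  (- (sg ^+ 2 * s * \int[mu]_x (cos (a + s * x) * p x))).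
Proof.
pose f (s x : R) := cos (a + s * x) * p x.
have df (x t : R) : is_derive t 1 (f ^~ x) (- (x * sin (a + t * x) * p x)).
  by rewrite /f; apply: is_derive_eq; rewrite /GRing.scale /=; ring.
have Is : `]s - 1, s + 1[%classic s by rewrite /= in_itv /=; lra.
have [C hC] := normal_pdf_moment_bound.
pose Gd x := C * normal_pdf 0 (Num.sqrt 2 * sg) x.
have intGd : mu.-integrable setT (EFin \o Gd).
  have := integrableZl measurableT C (integrable_normal_pdf 0 (Num.sqrt 2 * sg)).
  by apply: eq_integrable => // x _ /=; rewrite EFinM.
have intf t : `]s - 1, s + 1[%classic t -> mu.-integrable setT (EFin \o f t).
  by move=> _; exact: (integrable_pdfM (measurable_cos_affine a t) (fun x => cos_norm_le1 _)).
have derf t x : `]s - 1, s + 1[%classic t -> setT x -> derivable (f ^~ x) t 1.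
  by move=> _ _; have [] := df x t.
have d1E t x : partial1of2 f t x = - (x * sin (a + t * x) * p x).
  by rewrite partial1of2E; have [_ ->] := df x t.
have Gd0 x : 0 <= Gd x by rewrite (le_trans _ (hC x)) // mulr_ge0 // normal_pdf_ge0.
have d1b t x : `]s - 1, s + 1[%classic t -> setT x -> `|partial1of2 f t x| <= Gd x.
  move=> _ _; rewrite d1E normrN (le_trans _ (hC x)) // !normrM (ger0_norm (normal_pdf_ge0 _ _ _)).
  by rewrite ler_wpM2r ?normal_pdf_ge0 // ler_piMr // sin_norm_le1.
apply: DeriveDef.
  exact: (derivable_under_integral measurableT Is intf derf Gd0 intGd d1b).
rewrite -derive1E (differentiation_under_integral measurableT Is intf derf Gd0 intGd d1b).
rewrite -normal_stein -mulN1r -RintegralZl //; last first.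
  exact: integrable_id_pdfM (measurable_sin_affine a s) (fun x => sin_norm_le1 _).
by apply: eq_Rintegral => x _; rewrite d1E mulN1r.
Qed.

Lemma normal_cf (a s : R) :
  (\int[normal_prob 0 sg]_x (cos (a + s * x))%:E = (cos a * expR (- (sg ^+ 2 * s ^+ 2 / 2)))%:E)%E.
Proof.
rewrite integral_normal_prob; [|exact: measurable_cos_affine|by exists 1 => x; exact: cos_norm_le1].
pose F (s : R) := \int[mu]_x (cos (a + s * x) * p x).
have intF (t : R) : mu.-integrable setT (EFin \o (fun x => cos (a + t * x) * p x)).
  exact: (integrable_pdfM (measurable_cos_affine a t) (fun x => cos_norm_le1 _)).
have FE t : (\int[mu]_x (cos (a + t * x) * p x)%:E)%E = (F t)%:E.
  by rewrite /F /Rintegral fineK //; exact: integrable_fin_num (intF t).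
rewrite FE; congr EFin.
have F0 : F 0 = cos a.
  have := FE 0; under eq_integral do rewrite mul0r addr0 EFinM.
  rewrite integralZl //; last exact: integrable_normal_pdf.
  by rewrite integral_normal_pdf mule1 => -[].
(* The integrating factor of that equation, so [H] is constant. *)
pose H t := F t * expR (sg ^+ 2 * t ^+ 2 / 2).
have dH (t : R) : is_derive t 1 H 0.
  have := normal_cf_derive a t; rewrite -/(F t) -/F => dF.
  by rewrite /H; apply: is_derive_eq; rewrite /GRing.scale /=; field.
have := @is_derive_0_is_cst R H s 0 dH.
rewrite /H F0 expr0n mulr0 mul0r expR0 mulr1 => <-.
by rewrite -(mulrA (F s)) -expRD subrr expR0 mulr1.
Qed.

End gaussian.

(** * Integrals of finitely valued families *)

Section full_set.
Import HBNNSimple.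
Context d (T : measurableType d) (R : realType) (mu : {measure set T -> \bar R}).
Context (D : set T) (mD : measurable D) (muD : mu (~` D) = 0%E).
Local Open Scope ereal_scope.

(** A simple function below [f], multiplied by the indicator of [D], lies below [g] and keeps its
    integral. Measurability cannot be assumed: the partial sums of [X1] are controlled only on a set
    of full measure. *)
Lemma ge0_le_integral_full (f g : T -> \bar R) : (forall x, 0 <= f x) -> (forall x, 0 <= g x) ->
  (forall x, D x -> f x <= g x) -> \int[mu]_x f x <= \int[mu]_x g x.
Proof.
move=> f0 g0 fg; rewrite !ge0_integralTE //.
apply: ge_ereal_sup => _ [h /= hf <-].
apply: ereal_sup_ubound; exists (proj_nnsfun h mD).
  move=> x /=; rewrite mindicE; have [xD|xD] := boolP (x \in D).
    by rewrite mulr1 (le_trans (hf x)) // fg //; exact: set_mem.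
  by rewrite mulr0.
have sE (k : {nnsfun T >-> R}) : sintegral mu k = \int[mu]_x (k x)%:E.
  by rewrite integral_nnsfun // patch_setT.
rewrite !sE.
have kE (k : {nnsfun T >-> R}) : \int[mu]_x (k x)%:E = \int[mu]_(x in D) (k x)%:E.
  rewrite (@ge0_negligible_integral _ _ _ mu setT (~` D)) //.
  - by rewrite setTD setCK.
  - exact: measurableC.
  - by apply/measurable_EFinP.
  - by move=> x _; rewrite lee_fin.
rewrite kE [RHS]kE; apply: eq_integral => x xD /=.
by rewrite mindicE xD mulr1.
Qed.

(* No measurability is needed: the lower integrals agree. *)
Lemma eq_integral_full (f g : T -> \bar R) : (forall x, D x -> f x = g x) ->
  \int[mu]_x f x = \int[mu]_x g x.
Proof.
move=> fg; rewrite integralE [RHS]integralE; congr (_ - _); apply/eqP; rewrite eq_le;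
  apply/andP; split; apply: ge0_le_integral_full => // x Dx;
  by rewrite ?funeposE ?funenegE fg.
Qed.

End full_set.

Section finite_valued.
Context d (T : measurableType d) (R : realType) (P : probability T R).
Context (I : eqType) (ok : pred I) (Z : I -> T -> nat) (rng : I -> seq nat) (wt : I -> nat -> R).
Context (Zrng : forall i t, ok i -> Z i t \in rng i) (urng : forall i, uniq (rng i)).
Context (mZ : forall i k, ok i -> measurable (Z i @^-1` [set k])).
Context (PZ : forall (J : seq I) (k : I -> nat), uniq J -> all ok J ->
  (forall j, j \in J -> k j \in rng j) ->
  P (\bigcap_(j in [set j | j \in J]) (Z j @^-1` [set k j])) = (\prod_(j <- J) wt j (k j))%:E).
Implicit Types (J : seq I) (om : I -> nat) (G : (I -> nat) -> R).

Definition upd_val om (j : I) (v : nat) : I -> nat := fun i => if i == j then v else om i.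

(** Fubini for independent finitely valued coordinates: those in [J] are summed out in turn, and
    [om] supplies the others. *)
Fixpoint iter_mean J G om : R :=
  if J is j :: J1 then \sum_(v <- rng j) wt j v * iter_mean J1 G (upd_val om j v) else G om.

Definition assign J om (t : T) : I -> nat := fun i => if i \in J then Z i t else om i.

Lemma iter_mean_cat J J' G om : iter_mean (J ++ J') G om = iter_mean J (iter_mean J' G) om.
Proof. by elim: J om => //= j J IH om; apply: eq_bigr => v _; rewrite IH. Qed.

Lemma eq_iter_mean J G G' om : (forall om, G om = G' om) -> iter_mean J G om = iter_mean J G' om.
Proof. by move=> GG; congr iter_mean; apply/funext. Qed.

Definition cylinder J (k : I -> nat) : set T := \bigcap_(j in [set j | j \in J]) (Z j @^-1` [set k j]).

Lemma cylinder_cons j J k : cylinder (j :: J) k = Z j @^-1` [set k j] `&` cylinder J k.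
Proof.
apply/seteqP; split => [t h|t [h1 h2] i /=].
  by split=> [|i iJ]; apply: h; rewrite /= inE ?eqxx // iJ orbT.
by rewrite inE => /predU1P[->|iJ] //; exact: h2.
Qed.

Lemma measurable_cylinder J k : all ok J -> measurable (cylinder J k).
Proof.
elim: J => [_|j J IH /andP[okj okJ]].
  by rewrite (_ : cylinder _ _ = setT) //; apply/seteqP; split => // t _ i; rewrite /= in_nil.
by rewrite cylinder_cons; apply: measurableI; [exact: mZ|exact: IH].
Qed.

Lemma Rintegral_sum (J : eqType) (s : seq J) (f : J -> T -> R) (c : J -> R) :
  (forall j, j \in s -> P.-integrable setT (EFin \o f j) /\ \int[P]_x f j x = c j) ->
  P.-integrable setT (EFin \o (fun x => \sum_(j <- s) f j x)) /\
  \int[P]_x (\sum_(j <- s) f j x) = \sum_(j <- s) c j.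
Proof.
elim: s => [_|j s IH h].
  have -> : (fun x => \sum_(j <- [::]) f j x) = (fun=> 0).
    by apply/funext => x; rewrite big_nil.
  rewrite big_nil; split; last by rewrite Rintegral_cst // mul0r.
  exact: finite_measure_integrable_cst.
have -> : (fun x => \sum_(i <- j :: s) f i x) = (fun x => f j x + \sum_(i <- s) f i x).
  by apply/funext => x; rewrite big_cons.
have [ij cj] := h j (mem_head _ _).
have [is_ cs] := IH (fun i iS => h i (mem_behead (s := j :: s) iS)).
split; last by rewrite big_cons RintegralD // cj cs.
by have := integrableD measurableT ij is_; apply: eq_integrable => // x _ /=; rewrite EFinD.
Qed.

(** The induction splits over the value of the head of [J], which then joins the cylinder list [J'].
    Once [J] is empty, only the joint law of the cylinder is left. *)
Lemma integral_cylinder J J' k G om : uniq (J' ++ J) -> all ok (J' ++ J) ->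
  (forall j, j \in J' -> k j \in rng j) ->
  P.-integrable setT (EFin \o (fun t => \1_(cylinder J' k) t * G (assign J om t))) /\
  \int[P]_t (\1_(cylinder J' k) t * G (assign J om t)) =
    (\prod_(j <- J') wt j (k j)) * iter_mean J G om.
Proof.
elim: J J' k om => [|j J IH] J' k om /=.
  rewrite cats0 => uJ okJ kr.
  have -> : (fun t => \1_(cylinder J' k) t * G (assign [::] om t)) =
      (fun t => G om * \1_(cylinder J' k) t).
    by apply/funext => t; rewrite mulrC.
  have mC := measurable_cylinder k okJ.
  have i1 : P.-integrable setT (EFin \o (\1_(cylinder J' k) : T -> R)).
    by apply: integrable_indic => //; rewrite (le_lt_trans (probability_le1 P _)) ?ltry.
  split.
    by have := integrableZl measurableT (G om) i1; apply: eq_integrable => // x _ /=; rewrite EFinM.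
  rewrite RintegralZl // mulrC; congr (_ * _).
  by rewrite /Rintegral integral_indic // setIT; exact: (congr1 fine (PZ uJ okJ kr)).
rewrite -cat_rcons => uJ okJ kr.
have jJ' : j \notin J'.
  by move: uJ; rewrite cat_uniq rcons_uniq => /and3P[/andP[]].
have jJ : j \notin J.
  move: uJ; rewrite cat_uniq => /and3P[_ /hasPn h _]; apply/negP => /h /=.
  by rewrite mem_rcons mem_head.
have okj : ok j by move/allP : okJ; apply; rewrite mem_cat mem_rcons mem_head.
pose kv v i := if i == j then v else k i.
have cE v : cylinder (rcons J' j) (kv v) = Z j @^-1` [set v] `&` cylinder J' k.
  apply/seteqP; split => [t h|t [h1 h2] i /=].
    split; first by have := h j; rewrite /= mem_rcons mem_head /kv eqxx; apply.
    move=> i iJ; have := h i; rewrite /= mem_rcons inE iJ orbT => /(_ isT).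
    by rewrite /kv; case: eqP => // ij; rewrite -ij iJ in jJ'.
  rewrite mem_rcons inE /kv; case: eqP => [-> _ //|_ /= iJ]; exact: h2.
have ptw t : \1_(cylinder J' k) t * G (assign (j :: J) om t) =
    \sum_(v <- rng j) \1_(cylinder (rcons J' j) (kv v)) t * G (assign J (upd_val om j v) t).
  rewrite (bigD1_seq (Z j t)) ?Zrng ?urng //= big1 ?addr0; last first.
    move=> v /eqP vZ; rewrite cE indicE memNset ?mul0r // => -[/= e _].
    by apply: vZ; rewrite e.
  have -> : assign (j :: J) om t = assign J (upd_val om j (Z j t)) t.
    apply/funext => i; rewrite /assign inE /upd_val; have [->|] := eqVneq i j => //=.
    by rewrite (negbTE jJ).
  congr (_ * _); rewrite cE !indicE; congr (_%:R); congr nat_of_bool.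
  by rewrite in_setI [X in _ = X && _]mem_set.
have sumE := @Rintegral_sum _ (rng j)
  (fun v t => \1_(cylinder (rcons J' j) (kv v)) t * G (assign J (upd_val om j v) t))
  (fun v => (\prod_(i <- J') wt i (k i)) * (wt j v * iter_mean J G (upd_val om j v))).
have -> : (fun t => \1_(cylinder J' k) t * G (assign (j :: J) om t)) =
  (fun t => \sum_(v <- rng j) \1_(cylinder (rcons J' j) (kv v)) t * G (assign J (upd_val om j v) t)).
  exact/funext.
rewrite mulr_sumr; apply: sumE => v vr.
have [|i1 ->] := IH (rcons J' j) (kv v) (upd_val om j v) uJ okJ.
  by move=> i; rewrite mem_rcons inE /kv; case: eqP => [-> _ //|_ /=]; exact: kr.
split => //; rewrite mulrA; congr (_ * _).
rewrite -cats1 big_cat big_seq1 /= /kv eqxx; congr (_ * _).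
rewrite big_seq_cond [RHS]big_seq_cond; apply: eq_bigr => i /andP[iJ _].
by case: eqP => // ij; rewrite -ij iJ in jJ'.
Qed.

Lemma integral_assign J G om : uniq J -> all ok J ->
  P.-integrable setT (EFin \o (fun t => G (assign J om t))) /\
  \int[P]_t G (assign J om t) = iter_mean J G om.
Proof.
move=> uJ okJ.
have [|i1 e1] := @integral_cylinder J [::] om G om uJ okJ; first by [].
have c1 t : \1_(cylinder [::] om) t = 1 :> R.
  by rewrite indicE mem_set // => i; rewrite /= in_nil.
move: i1 e1; rewrite big_nil mul1r.
have -> : (fun t => \1_(cylinder [::] om) t * G (assign J om t)) = (fun t => G (assign J om t)).
  by apply/funext => t; rewrite c1 mul1r.
by [].
Qed.

End finite_valued.

(** * Forcing the driving variables into their ranges *)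

Section clipping.
Context d (T : measurableType d) (R : realType) (P : probability T R).
Context (I : eqType) (ok : pred I) (Y : I -> T -> nat) (rng : I -> seq nat) (wt : I -> nat -> R).
Context (dflt : I -> nat) (D : set T) (mD : measurable D) (PD : P (~` D) = 0%E).
Context (mY : forall i k, ok i -> measurable (Y i @^-1` [set k])).
Context (Yrng : forall i t, ok i -> D t -> Y i t \in rng i).
Context (PY : forall i k, ok i -> k \in rng i -> P (Y i @^-1` [set k]) = (wt i k)%:E).
Context (indep : mutually_independent_nat P ok Y).

(** The laws confine a variable to its range only almost surely; the default makes the confinement
    hold everywhere without changing the joint law. *)
Definition clip_val (i : I) (t : T) : nat := if Y i t \in rng i then Y i t else dflt i.

Lemma clip_valE i t : ok i -> D t -> clip_val i t = Y i t.
Proof. by move=> oki Dt; rewrite /clip_val Yrng. Qed.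

Lemma measurable_clip_val i k : ok i -> measurable (clip_val i @^-1` [set k]).
Proof.
move=> oki.
have mA (A : set nat) : measurable (Y i @^-1` A).
  rewrite (_ : _ @^-1` _ = \bigcup_(v in A) (Y i @^-1` [set v])).
    by apply: bigcup_measurable => v _; exact: mY.
  apply/seteqP; split => [t At|t [v Av /= ->//]].
  by exists (Y i t).
have -> : clip_val i @^-1` [set k] = Y i @^-1` [set v | (if v \in rng i then v else dflt i) = k].
  by apply/seteqP; split.
exact: mA.
Qed.

Lemma probability_setI_full (A : set T) : measurable A -> P A = P (A `&` D).
Proof.
move=> mA; rewrite (measureDI P mA mD) -[RHS]add0e; congr (_ + _)%E.
apply/eqP; rewrite eq_le measure_ge0 andbT -PD.
by apply: le_measure; rewrite ?inE; [exact: measurableD|exact: measurableC|move=> t []].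
Qed.

Lemma clip_val_law (J : seq I) (k : I -> nat) : uniq J -> all ok J ->
  (forall j, j \in J -> k j \in rng j) ->
  P (\bigcap_(j in [set j | j \in J]) (clip_val j @^-1` [set k j])) = (\prod_(j <- J) wt j (k j))%:E.
Proof.
move=> uJ okJ kr.
have mc (Z : I -> T -> nat) : (forall i k, ok i -> measurable (Z i @^-1` [set k])) ->
    measurable (\bigcap_(j in [set j | j \in J]) (Z j @^-1` [set k j])).
  by move=> mZ; exact: measurable_cylinder mZ _ _ okJ.
rewrite probability_setI_full; last exact: mc measurable_clip_val.
have -> : \bigcap_(j in [set j | j \in J]) (clip_val j @^-1` [set k j]) `&` D =
    \bigcap_(j in [set j | j \in J]) (Y j @^-1` [set k j]) `&` D.
  have okj j : j \in J -> ok j by move/allP : okJ; apply.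
  apply/seteqP; split => t [h Dt]; split => // j /= jJ.
    by have := h j jJ; rewrite /= clip_valE ?okj.
  by rewrite /= clip_valE ?okj //; exact: h.
rewrite -probability_setI_full; last exact: mc mY.
rewrite indep // -prodEFin big_seq [RHS]big_seq; apply: eq_bigr => j jJ.
by rewrite PY ?kr //; move/allP : okJ; apply.
Qed.

End clipping.

(** * The sample paths of the walk *)

Section elephant_paths.
Context {R : realType} (p1 p2 : R) (start : state).
Implicit Types (om : elephant_idx -> nat) (n : nat) (F : state -> R).
Local Notation a1 := (2 * p1 - 1).
Local Notation a2 := (2 * p2 - 1).

Definition elephant_rng (i : elephant_idx) : seq nat :=
  match i with Xi1 _ | Xi2 _ => [:: 0; 1]%N | U1 n | U2 n => iota 1 n end.

Definition elephant_wt (i : elephant_idx) (k : nat) : R :=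
  match i with
  | Xi1 _ => if k == 1%N then p1 else 1 - p1
  | Xi2 _ => if k == 1%N then p2 else 1 - p2
  | U1 n | U2 n => n%:R^-1
  end.

Definition flip (e : nat) (b : bool) : bool := if e == 1%N then b else ~~ b.

Fixpoint walk_path n om : state :=
  if n is k.+1 then
    if k is 0%N then start
    else let w := walk_path k om in
      push k.+1 w (flip (om (Xi1 k.+1)) (w.2 (om (U2 k)))) (flip (om (Xi2 k.+1)) (w.1 (om (U1 k))))
  else start.

Lemma walk_pathS n om : (0 < n)%N -> walk_path n.+1 om =
  push n.+1 (walk_path n om) (flip (om (Xi1 n.+1)) ((walk_path n om).2 (om (U2 n))))
    (flip (om (Xi2 n.+1)) ((walk_path n om).1 (om (U1 n)))).
Proof. by case: n. Qed.

(** Each coin is followed by the index it is applied to, so the iterated mean nests as two instances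
    of [flip_mean], one per walk. *)
Definition step_idx n : seq elephant_idx := [:: Xi1 n.+1; U2 n; Xi2 n.+1; U1 n].

Fixpoint idx_upto n : seq elephant_idx :=
  if n is k.+1 then if k is 0%N then [::] else idx_upto k ++ step_idx k else [::].

Lemma idx_uptoS n : (0 < n)%N -> idx_upto n.+1 = idx_upto n ++ step_idx n.
Proof. by case: n. Qed.

(** The time of the step that the variable decides. *)
Definition level (i : elephant_idx) : nat :=
  match i with Xi1 n | Xi2 n => n | U1 n | U2 n => n.+1 end.

Lemma level_step n i : i \in step_idx n -> level i = n.+1.
Proof. by rewrite !inE => /or4P[] /eqP ->. Qed.

Lemma level_idx_upto n i : i \in idx_upto n -> (level i <= n)%N.
Proof.
elim: n => [//|[|n] IH] //=; rewrite mem_cat => /orP[/IH/leqW //|].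
by move=> /level_step ->.
Qed.

Lemma idx_upto_uniq n : uniq (idx_upto n).
Proof.
elim: n => [//|[|n] IH] //; have us : uniq (step_idx n.+1) by [].
rewrite idx_uptoS // cat_uniq IH us andbT andTb.
apply/hasPn => i /level_step li; apply/negP => /level_idx_upto.
by rewrite li ltnn.
Qed.

Lemma idx_upto_valid n : all elephant_valid (idx_upto n).
Proof. by elim: n => [//|[|n] IH] //; rewrite idx_uptoS // all_cat IH. Qed.

Lemma walk_path_dep n om om' : (forall i, i \in idx_upto n -> om i = om' i) ->
  walk_path n om = walk_path n om'.
Proof.
elim: n => [//|[|n] IH] // h.
rewrite (walk_pathS om (ltn0Sn n)) (walk_pathS om' (ltn0Sn n)) IH; last first.
  by move=> i iin; apply: h; rewrite idx_uptoS // mem_cat iin.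
by rewrite !h // idx_uptoS // mem_cat !inE eqxx !orbT.
Qed.

Lemma spin_flip (e : nat) b : spin (flip e b) = (if e == 1%N then 1 else -1) * spin b :> R.
Proof. by rewrite /flip; case: (e == 1%N); case: b; rewrite /spin /=; ring. Qed.

Lemma fun_spin (h : bool -> R) b : h b = (h true + h false) / 2 + spin b * ((h true - h false) / 2).
Proof. by case: b; rewrite /spin; field. Qed.

(** A function of one sign is affine in it, so only the mean of the flipped sign matters: 2 p - 1
    times the average of the past signs. *)
Lemma flip_mean (p : R) (f : nat -> bool) n (h : bool -> R) : (0 < n)%N ->
  \sum_(e <- [:: 0; 1]%N) (if e == 1%N then p else 1 - p) *
    (\sum_(u <- iota 1 n) n%:R^-1 * h (flip e (f u))) =
  (1 + (2 * p - 1) * ((\sum_(1 <= k < n.+1) spin (f k)) / n%:R)) / 2 * h true +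
  (1 - (2 * p - 1) * ((\sum_(1 <= k < n.+1) spin (f k)) / n%:R)) / 2 * h false.
Proof.
move=> n0; have nn : n%:R != 0 :> R by rewrite pnatr_eq0 -lt0n.
have inner e : \sum_(u <- iota 1 n) n%:R^-1 * h (flip e (f u)) =
    (h true + h false) / 2 + (if e == 1%N then 1 else -1) *
      ((\sum_(1 <= k < n.+1) spin (f k)) / n%:R) * ((h true - h false) / 2).
  rewrite -mulr_sumr (eq_bigr (fun u => (h true + h false) / 2 +
     spin (f u) * ((if e == 1%N then 1 else -1) * ((h true - h false) / 2)))); last first.
    by move=> u _; rewrite (fun_spin h) spin_flip; ring.
  have e2 q : \sum_(u <- iota 1 n) ((h true + h false) / 2 + spin (f u) * q) =
      (h true + h false) / 2 * n%:R + (\sum_(u <- iota 1 n) spin (f u)) * q.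
    by rewrite big_split /= big_const_seq count_predT size_iota iter_addr addr0 mulr_natr mulr_suml.
  rewrite e2 /index_iota subn1 /=; set S := \sum_(_ <- _) _.
  by move: (if e == 1%N then _ else _) => q; field.
by rewrite !big_cons big_nil !inner /=; field.
Qed.

Lemma iter_mean_step n F om : (0 < n)%N ->
  iter_mean elephant_rng elephant_wt (step_idx n) (F \o walk_path n.+1) om =
  step a1 a2 n F (walk_path n om).
Proof.
move=> n0; rewrite /= ; set w := walk_path n om.
have pathE e1 v2 e2 v1 : walk_path n.+1 (upd_val (upd_val (upd_val (upd_val om (Xi1 n.+1) e1) (U2 n) v2)
    (Xi2 n.+1) e2) (U1 n) v1) = push n.+1 w (flip e1 (w.2 v2)) (flip e2 (w.1 v1)).
  rewrite walk_pathS // (@walk_path_dep n _ om) //; last first.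
    move=> i iin; have li := level_idx_upto iin.
    have ne j : j \in step_idx n -> (i == j) = false.
      by move=> /level_step lj; apply/eqP => ij; move: li; rewrite ij lj ltnn.
    by rewrite /upd_val !ne // !inE eqxx ?orbT.
  by rewrite /upd_val !eqxx.
have inner b : \sum_(e2 <- [:: 0; 1]%N) (if e2 == 1%N then p2 else 1 - p2) *
    (\sum_(v1 <- iota 1 n) n%:R^-1 * F (push n.+1 w b (flip e2 (w.1 v1)))) =
    (1 + drift2 a2 n w) / 2 * F (push n.+1 w b true) +
    (1 - drift2 a2 n w) / 2 * F (push n.+1 w b false).
  exact: (flip_mean p2 w.1 (fun c => F (push n.+1 w b c)) n0).
transitivity (\sum_(e1 <- [:: 0; 1]%N) (if e1 == 1%N then p1 else 1 - p1) *
    (\sum_(v2 <- iota 1 n) n%:R^-1 *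
      ((1 + drift2 a2 n w) / 2 * F (push n.+1 w (flip e1 (w.2 v2)) true) +
       (1 - drift2 a2 n w) / 2 * F (push n.+1 w (flip e1 (w.2 v2)) false)))).
  apply: eq_bigr => e1 _; congr (_ * _); apply: eq_bigr => v2 _; congr (_ * _).
  rewrite -inner; apply: eq_bigr => e2 _; congr (_ * _); apply: eq_bigr => v1 _.
  by congr (_ * F _); exact: pathE.
rewrite (flip_mean p1 w.2 (fun b => (1 + drift2 a2 n w) / 2 * F (push n.+1 w b true) +
       (1 - drift2 a2 n w) / 2 * F (push n.+1 w b false)) n0).
rewrite -/(pos2 n w) -/(drift1 a1 n w) /step; ring.
Qed.

Lemma iter_mean_walk n F om :
  iter_mean elephant_rng elephant_wt (idx_upto n) (F \o walk_path n) om = walk_mean a1 a2 start n F.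
Proof.
elim: n F om => [//|[//|n] IH] F om.
rewrite idx_uptoS // iter_mean_cat walk_meanS // -(IH _ om); apply: eq_iter_mean => om'.
exact: iter_mean_step.
Qed.

Lemma pos1_walk_path n N om : (n <= N)%N -> pos1 n (walk_path N om) = pos1 n (walk_path n om) :> R.
Proof.
move=> /subnK <-; elim: (N - n)%N => [//|k IH]; rewrite addSn.
case: (posnP (k + n)) => [kn0|kn].
  by move: kn0 IH; case: n => [|n]; case: k.
by rewrite walk_pathS // pos1_adapted // ltnS leq_addl.
Qed.

End elephant_paths.

(** * The law of the sample paths *)

Section elephant_law.
Context d (T : measurableType d) (R : realType) (P : probability T R).
Context (p1 p2 : R) (xi1 xi2 u1 u2 : nat -> T -> nat) (x1 x2 : R) (X1 X2 : nat -> T -> R).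
Local Notation Y := (elephant_family xi1 xi2 u1 u2).
Context (mY : forall i k, elephant_valid i -> measurable (Y i @^-1` [set k])).
Context (Pxi1 : forall n, (2 <= n)%N ->
  P [set t | xi1 n t = 1%N] = p1%:E /\ P [set t | xi1 n t = 0%N] = (1 - p1)%:E).
Context (Pxi2 : forall n, (2 <= n)%N ->
  P [set t | xi2 n t = 1%N] = p2%:E /\ P [set t | xi2 n t = 0%N] = (1 - p2)%:E).
Context (Pu1 : forall n k, (1 <= n)%N -> (1 <= k <= n)%N -> P [set t | u1 n t = k] = (n%:R^-1)%:E).
Context (Pu2 : forall n k, (1 <= n)%N -> (1 <= k <= n)%N -> P [set t | u2 n t = k] = (n%:R^-1)%:E).
Context (indep : mutually_independent_nat P elephant_valid Y).
Context (x1_pm : x1 = 1 \/ x1 = -1) (x2_pm : x2 = 1 \/ x2 = -1).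
Context (X11 : forall t, X1 1%N t = x1) (X21 : forall t, X2 1%N t = x2).
Context (X1S : forall n t, (1 <= n)%N ->
  X1 n.+1 t = (xi1 n.+1 t)%:R * X2 (u2 n t) t - (1 - (xi1 n.+1 t)%:R) * X2 (u2 n t) t).
Context (X2S : forall n t, (1 <= n)%N ->
  X2 n.+1 t = (xi2 n.+1 t)%:R * X1 (u1 n t) t - (1 - (xi2 n.+1 t)%:R) * X1 (u1 n t) t).

Local Notation rng := elephant_rng.
Local Notation wt := (elephant_wt p1 p2).
Local Notation ok := elephant_valid.

Lemma elephant_marginal i k : ok i -> k \in rng i -> P (Y i @^-1` [set k]) = (wt i k)%:E.
Proof.
have E (f : T -> nat) : f @^-1` [set k] = [set t | f t = k] by [].
case: i => n /= oki; rewrite E.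
- by rewrite !inE => /orP[] /eqP -> /=; case: (Pxi1 oki).
- by rewrite !inE => /orP[] /eqP -> /=; case: (Pxi2 oki).
- by rewrite mem_iota => /andP[k1 kn]; rewrite Pu1 // k1 -ltnS.
- by rewrite mem_iota => /andP[k1 kn]; rewrite Pu2 // k1 -ltnS.
Qed.

Lemma rng_uniq i : uniq (rng i).
Proof. by case: i => n //=; exact: iota_uniq. Qed.

Lemma elephant_wt_sum i : ok i -> \sum_(k <- rng i) wt i k = 1.
Proof.
case: i => n /= oki; rewrite ?(big_cons, big_nil) /=; try by lra.
- rewrite big_const_seq count_predT size_iota iter_addr addr0 -[LHS]mulr_natr mulVf //.
  by rewrite pnatr_eq0 -lt0n.
- rewrite big_const_seq count_predT size_iota iter_addr addr0 -[LHS]mulr_natr mulVf //.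
  by rewrite pnatr_eq0 -lt0n.
Qed.

Lemma preimage_seq_law i (s : seq nat) : ok i -> uniq s -> {subset s <= rng i} ->
  measurable (Y i @^-1` [set k | k \in s]) /\
  P (Y i @^-1` [set k | k \in s]) = (\sum_(k <- s) wt i k)%:E.
Proof.
move=> oki; elim: s => [_ _|k s IH /andP[ks us] sr].
  rewrite (_ : _ @^-1` _ = set0) ?measure0 ?big_nil; first by split.
  by apply/seteqP; split => // t; rewrite /= in_nil.
have [m1 e1] := IH us (fun j js => sr j (mem_behead (s := k :: s) js)).
have mk := mY k oki.
rewrite (_ : _ @^-1` _ = Y i @^-1` [set k] `|` Y i @^-1` [set k | k \in s]); last first.
  apply/seteqP; split => t /=; rewrite inE; first by case/predU1P; [left|right].
  by case=> [->|->]; rewrite ?eqxx ?orbT.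
split; first exact: measurableU.
rewrite big_cons EFinD -(elephant_marginal oki (sr k (mem_head _ _))) -e1 measureU //.
by apply/seteqP; split => // t [/= -> ]; rewrite (negbTE ks).
Qed.

Definition bad_idx (i : elephant_idx) : set T :=
  if ok i then ~` (Y i @^-1` [set k | k \in rng i]) else set0.

(** The prescribed probabilities of the single values in the range already add up to 1. *)
Lemma bad_idx_null i : measurable (bad_idx i) /\ P (bad_idx i) = 0%E.
Proof.
rewrite /bad_idx; case: ifP => oki; last by rewrite measure0.
have [m1 e1] := preimage_seq_law oki (rng_uniq i) (fun k => id).
split; first exact: measurableC.
by rewrite probability_setC // e1 elephant_wt_sum // subee.
Qed.

Definition bad_set : set T :=
  \bigcup_n (bad_idx (Xi1 n) `|` bad_idx (Xi2 n) `|` (bad_idx (U1 n) `|` bad_idx (U2 n))).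

Lemma bad_set_null : measurable bad_set /\ P bad_set = 0%E.
Proof.
have mi i := (bad_idx_null i).1.
have ni i : P.-negligible (bad_idx i) by apply/negligibleP => //; case: (bad_idx_null i).
have mb : measurable bad_set.
  by apply: bigcup_measurable => n _; apply: measurableU; apply: measurableU.
split => //; apply/negligibleP => //; apply: negligible_bigcup => n.
by apply: negligibleU; apply: negligibleU.
Qed.

Definition good_set : set T := ~` bad_set.

Lemma measurable_good_set : measurable good_set.
Proof. by apply: measurableC; case: bad_set_null. Qed.

Lemma good_set_full : P (~` good_set) = 0%E.
Proof. by rewrite setCK; case: bad_set_null. Qed.

Lemma good_set_rng i t : ok i -> good_set t -> Y i t \in rng i.
Proof.
move=> oki gt; apply: contrapT => bt.
have bi : bad_idx i t by rewrite /bad_idx oki => h; apply: bt.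
by apply: gt; case: i oki bt bi => n _ _ bi; exists n => //;
  [left; left|left; right|right; left|right; right].
Qed.

Local Notation val := (clip_val Y rng (fun=> 1%N)).

(** The default value 1 belongs to the range of every valid index. *)
Lemma clip_val_rng i t : ok i -> val i t \in rng i.
Proof.
move=> oki; rewrite /clip_val; case: ifP => // _.
by case: i oki => n //= n0; rewrite mem_iota /=; case: n n0.
Qed.

Definition elephant_start : state := (fun=> x1 == 1, fun=> x2 == 1).

Definition sample_path n t : state := walk_path elephant_start n (val ^~ t).

(** Any [F] is allowed: the path is a function of finitely many finitely valued variables, which
    makes integrability automatic. *)
Lemma sample_path_law n (F : state -> R) :
  P.-integrable setT (EFin \o (fun t => F (sample_path n t))) /\
  \int[P]_t F (sample_path n t) = walk_mean (2 * p1 - 1) (2 * p2 - 1) elephant_start n F.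
Proof.
have law := clip_val_law (fun=> 1%N) measurable_good_set good_set_full mY good_set_rng
  elephant_marginal indep.
have mc i k : ok i -> measurable (val i @^-1` [set k]).
  by move=> oki; exact: (measurable_clip_val rng (fun=> 1%N) mY).
have [i1 e1] := integral_assign clip_val_rng rng_uniq mc law (F \o walk_path elephant_start n)
  (fun=> 0%N) (idx_upto_uniq n) (idx_upto_valid n).
have fE : (fun t => (F \o walk_path elephant_start n) (assign val (idx_upto n) (fun=> 0%N) t)) =
    (fun t => F (sample_path n t)).
  apply/funext => t /=; congr F; apply: walk_path_dep => i iin.
  by rewrite /assign iin.
by move: i1 e1; rewrite fE iter_mean_walk.
Qed.

(** On [good_set] the coins are 0 or 1 and the chosen indices lie in 1, ..., n, so the recursion
    refers only to steps already identified. *)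
Lemma sample_path_steps n t : good_set t -> forall k, (1 <= k <= n)%N ->
  X1 k t = spin ((sample_path n t).1 k) /\ X2 k t = spin ((sample_path n t).2 k).
Proof.
move=> gt; elim: n => [|n IH] k; first by case: k.
have [->|n0] := posnP n.
  case: k => [|[|k]] // _; rewrite X11 X21 /sample_path /=; split.
    by case: x1_pm => ->; rewrite /spin ?eqxx // lt_eqF //; lra.
  by case: x2_pm => ->; rewrite /spin ?eqxx // lt_eqF //; lra.
move=> /andP[k1 kn]; rewrite /sample_path walk_pathS // -/(sample_path n t) /=.
case: eqP => [->|/eqP knn]; last by apply: IH; rewrite k1 -ltnS ltn_neqAle knn.
have rU2 := @good_set_rng (U2 n) t n0 gt; have rU1 := @good_set_rng (U1 n) t n0 gt.
have rX1 := @good_set_rng (Xi1 n.+1) t n0 gt; have rX2 := @good_set_rng (Xi2 n.+1) t n0 gt.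
rewrite X1S // X2S // !spin_flip /clip_val rU2 rU1 rX1 rX2 /=.
move: rU2 rU1 rX1 rX2; rewrite /= !mem_iota !inE !add1n !ltnS => h2 h1 e1 e2.
have [_ ->] := IH _ h2; have [-> _] := IH _ h1.
by split; [case/orP: e1 => /eqP -> /=|case/orP: e2 => /eqP -> /=]; ring.
Qed.

Lemma partial_sum_sample_path n t : good_set t -> partial_sum X1 n t = pos1 n (sample_path n t).
Proof.
move=> gt; rewrite /partial_sum /pos1; apply: eq_big_nat => k kn.
by have [] := sample_path_steps gt kn.
Qed.

End elephant_law.

(** * Passage to the limit *)

Section bounded_means.
Context {R : realType}.

Lemma integrable_bounded d (T : measurableType d) (Q : probability T R) (f : T -> R) (M : R) :
  measurable_fun setT f -> (forall t, `|f t| <= M) -> Q.-integrable setT (EFin \o f).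
Proof.
move=> mf fM; apply: (@integrable_dominated _ _ R Q _ (fun=> M)) => //.
exact: finite_measure_integrable_cst.
Qed.

Lemma measurable_bcont d (T : measurableType d) (f : R -> R) (Z : T -> R) :
  bcont f -> measurable_fun setT Z -> measurable_fun setT (fun t => f (Z t)).
Proof.
move=> [cf _] mZ; apply: (@measurableT_comp _ _ _ _ _ _ f) => //.
exact: continuous_measurable_fun.
Qed.

Lemma integrable_bcont d (T : measurableType d) (Q : probability T R) (f : R -> R) (Z : T -> R) :
  bcont f -> measurable_fun setT Z -> Q.-integrable setT (EFin \o (fun t => f (Z t))).
Proof.
move=> bf mZ; have [_ [M fM]] := bf.
by apply: (@integrable_bounded _ _ _ _ M); [exact: measurable_bcont|move=> t; exact: fM].
Qed.

Lemma is_mean_rv d (T : measurableType d) (Q : probability T R) (Z : T -> R) :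
  measurable_fun setT Z -> is_mean (fun f => \int[Q]_t f (Z t)).
Proof.
move=> mZ; split.
- move=> c f g bf bg; rewrite RintegralD //; last 2 first.
  + exact: (integrable_bcont Q (bcontZ c bf) mZ).
  + exact: integrable_bcont.
  by rewrite RintegralZl //; exact: integrable_bcont.
- by move=> f _ f0; apply: Rintegral_ge0 => x _; exact: f0.
- rewrite Rintegral_cst // [LHS]mul1r.
  exact: (congr1 fine (@probability_setT _ _ _ Q)).
Qed.

Lemma EFin_Rintegral_bcont d (T : measurableType d) (Q : probability T R) (f : R -> R) (Z : T -> R) :
  bcont f -> measurable_fun setT Z -> (\int[Q]_t (f (Z t))%:E)%E = (\int[Q]_t f (Z t))%:E.
Proof.
move=> bf mZ; rewrite /Rintegral fineK //.
exact: (integrable_fin_num measurableT (integrable_bcont Q bf mZ)).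
Qed.

Lemma powRN_cvg0 (r : R) : 0 < r -> n%:R `^ (- r) @[n --> \oo] --> (0 : R).
Proof.
move=> r0; apply/cvgrPdist_le => e e0; near=> n; rewrite sub0r normrN ger0_norm ?powR_ge0 //.
have n0 : 0 < n%:R :> R by rewrite ltr0n; near: n; exact: nbhs_infty_gt.
have en : (e^-1) `^ (r^-1) <= n%:R by near: n; exact: nbhs_infty_ger.
rewrite powRN -[e]invrK lef_pV2 ?posrE ?powR_gt0 ?invr_gt0 //.
rewrite (_ : e^-1 = (e^-1 `^ r^-1) `^ r); last first.
  by rewrite -powRrM mulVf ?gt_eqF // powRr1 // invr_ge0 ltW.
by apply: ge0_ler_powR; rewrite ?nnegrE ?powR_ge0 // ?(ltW n0) ?(ltW r0).
Unshelve. all: by end_near. Qed.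

(** The law of sg(t) Z on the product with a standard normal Z. Scaling Z, instead of mixing normal
    laws of deviation [sg t], covers points where [sg] vanishes. *)
Lemma normal_mixture d (T : measurableType d) (Q : probability T R) (sg : T -> R) :
  measurable_fun setT sg -> exists L : borel_law R, forall a b : R,
    (\int[L]_x (cos (a + b * x))%:E =
     \int[Q]_t (cos a * expR (- (sg t ^+ 2 * b ^+ 2 / 2)))%:E)%E.
Proof.
move=> msg.
pose B := g_sigma_algebraType (R.-ocitv.-measurable).
pose N : probability B R := normal_prob 0 1.
pose F (z : T * B) : B := sg z.1 * (z.2 : R).
have mF : measurable_fun setT F.
  apply: (@measurable_funM _ _ R setT (fun z : T * B => sg z.1) (fun z : T * B => z.2 : R)).
    exact: measurableT_comp.
  exact: measurable_snd.
pose X : {mfun (T * B)%type >-> B} := HB.pack F (isMeasurableFun.Build _ _ _ _ F mF).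
exists (distribution (Q \x N)%E X) => a b.
have mc : measurable_fun setT (fun x : B => (cos (a + b * x))%:E).
  by apply/measurable_EFinP; exact: measurable_cos_affine.
have mcF : measurable_fun setT (fun z : T * B => cos (a + b * F z)).
  exact: (measurableT_comp (measurable_cos_affine a b) mF).
have icF : (Q \x N)%E.-integrable setT (fun z : T * B => (cos (a + b * F z))%:E).
  exact: (integrable_bounded (Q \x N)%E mcF (fun z => cos_norm_le1 _)).
rewrite integral_distribution // -integral12_prod_meas1 //.
apply: eq_integral => t _; rewrite /fubini_F /=.
rewrite -[LHS]/(\int[normal_prob 0 1]_x (cos (a + b * (sg t * x)))%:E)%E.
under eq_integral do rewrite mulrA.
by rewrite normal_cf ?oner_neq0 // expr1n mul1r exprMn (mulrC (b ^+ 2)).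
Qed.

End bounded_means.

(** * Removing the horizon *)

Section path_limit.
Context d (T : measurableType d) (R : realType) (P : probability T R).
Context (a1 a2 mu rho : R) (start : state).
Context (a1_le1 : `|a1| <= 1) (a2_le1 : `|a2| <= 1).
Context (mu_gt : 2^-1 < mu) (mu_le1 : mu <= 1).
Context (a1E : a1 = rho * mu) (a2E : rho * a2 = mu).
Context (sp : nat -> T -> state).
Context (sp_law : forall n F, P.-integrable setT (EFin \o (fun t => F (sp n t))) /\
  \int[P]_t F (sp n t) = walk_mean a1 a2 start n F).
Context (sp_pos : forall n N t, (n <= N)%N -> pos1 n (sp N t) = pos1 n (sp n t) :> R).
Context (W V : T -> R) (mW : measurable_fun setT W) (mV : measurable_fun setT V).
Context (V_ge0 : forall t, 0 <= V t).
Context (cvgW : {ae P, forall t, pos1 n (sp n t) / growth mu n @[n --> \oo] --> W t}).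
Context (cvgV : {ae P, forall t, 1 - (avg1 m (sp m t) : R) ^+ 2 @[m --> \oo] --> V t}).
Local Notation kap := ((1 + rho ^+ 2) * (((2 * mu + 1)^-1 + (2 * mu - 1)^-1) / 4)).
Context (L : borel_law R).
Context (LE : forall a b : R, (\int[L]_x (cos (a + b * x))%:E =
  \int[P]_t (cos a * expR (- (V t * (b ^+ 2 * kap) / 2)))%:E)%E).

Local Notation E := (walk_mean a1 a2 start).
Local Notation h := (excess mu).
Local Notation sq := (@root R).

Definition limit_fluct (n : nat) (t : T) : R := h n * (pos1 n (sp n t) / growth mu n - W t).

Lemma measurable_sp n (F : state -> R) : measurable_fun setT (fun t => F (sp n t)).
Proof. by have [/measurable_int/measurable_EFinP] := sp_law n F. Qed.

Lemma measurable_limit_fluct n : measurable_fun setT (limit_fluct n).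
Proof.
apply: measurable_funM => //; apply: measurable_funB => //.
by apply: measurable_funM => //; exact: measurable_sp.
Qed.

Lemma fluct_cvg n : {ae P, forall t, fluct mu n N (sp N t) @[N --> \oo] --> limit_fluct n t}.
Proof.
apply: filterS cvgW => t ct.
have : h n * (pos1 n (sp n t) / growth mu n - pos1 N (sp N t) / growth mu N) @[N --> \oo] --> limit_fluct n t.
  by apply: cvgM; [exact: cvg_cst|apply: cvgB; [exact: cvg_cst|exact: ct]].
apply: cvg_trans; apply: near_eq_cvg; near=> N; rewrite /fluct sp_pos //.
by near: N; exact: nbhs_infty_ge.
Unshelve. all: by end_near. Qed.

Lemma mean_fluct_cvg n (f : R -> R) : bcont f ->
  E N (fun w => f (fluct mu n N w)) @[N --> \oo] --> \int[P]_t f (limit_fluct n t).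
Proof.
move=> bf; have [cf [M fM]] := bf.
have -> : (fun N => E N (fun w => f (fluct mu n N w))) = (fun N => \int[P]_t f (fluct mu n N (sp N t))).
  by apply/funext => N; have [_ <-] := sp_law N (fun w => f (fluct mu n N w)).
apply: (@Rintegral_dominated_cvg _ _ R P _ _ (fun=> M)).
- move=> N; exact: (measurable_sp N (fun w => f (fluct mu n N w))).
- exact: measurable_bcont (measurable_limit_fluct n).
- apply: filterS (fluct_cvg n) => t ct; exact: (cvg_comp _ _ ct (cf _)).
- exact: finite_measure_integrable_cst.
- by move=> N t; exact: fM.
Qed.

Lemma excess_ratio_cvg n : h n / h N @[N --> \oo] --> (0 : R).
Proof.
rewrite -[X in _ --> X](mulr0 (h n)); apply: cvgM; first exact: cvg_cst.
have g0 : 0 < mu - 2^-1 by have := mu_gt; lra.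
have := powRN_cvg0 g0; apply: cvg_trans; apply: near_eq_cvg; apply: nearW => N.
by rewrite powRN.
Qed.

Lemma root_ratio_cvg m : m%:R / sq n @[n --> \oo] --> (0 : R).
Proof.
rewrite -[X in _ --> X](mulr0 m%:R); apply: cvgM; first exact: cvg_cst.
have g0 : 0 < 2^-1 :> R by lra.
have := powRN_cvg0 g0; apply: cvg_trans; apply: near_eq_cvg; apply: nearW => n.
by rewrite powRN.
Qed.

(** The finite-horizon L1 bound survives N -> oo because it is read through the bounded continuous
    [cutoff]. *)
Lemma limit_fluct_tight : exists C : R, 0 <= C /\ forall n (K : R), (0 < n)%N -> 0 < K ->
  \int[P]_t cutoff K (limit_fluct n t) <= C / K.
Proof.
have [C [C0 hC]] := fluct_tight start a1_le1 a2_le1 mu_gt mu_le1 a1E a2E.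
exists C; split => // n K n0 K0.
have c1 := @mean_fluct_cvg n _ (bcont_cutoff K0).
apply: (@ler_cvg_to _ _ _ _ _ _ _ _ c1 (cvg_cst (C / K))).
near=> N; have nN : (0 < n <= N)%N by rewrite n0 /=; near: N; exact: nbhs_infty_ge.
rewrite (le_trans (_ : _ <= E N (fun w => K^-1 * `|fluct mu n N w|))) //.
  by apply: (le_walk_mean start a1_le1 a2_le1) => w; rewrite mulrC /cutoff ge_min lexx.
by rewrite walk_meanZ mulrC ler_wpM2r ?invr_ge0 ?(ltW K0) // hC.
Unshelve. all: by end_near. Qed.

Lemma kap_ge0 (b : R) : 0 <= b ^+ 2 * kap.
Proof.
have r0 := mu2_gt0 mu_gt mu_le1; have m0 := mu_gt0 mu_gt.
rewrite mulr_ge0 ?sqr_ge0 // mulr_ge0 ?addr_ge0 ?sqr_ge0 // divr_ge0 //.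
by rewrite addr_ge0 // invr_ge0 //; lra.
Qed.

Lemma limit_fluct_cos (a b : R) : \int[P]_t cos (a + b * limit_fluct n t) @[n --> \oo] -->
  cos a * \int[P]_t expR (- (V t * (b ^+ 2 * kap) / 2)).
Proof.
have [C [gam [C0 gam0 hC]]] := walk_fluct_cos start a1_le1 a2_le1 mu_gt mu_le1 a1E a2E a b.
pose e m w : R := expR (- ((1 - avg1 m w ^+ 2) * (b ^+ 2 * kap) / 2)).
have kap0 := kap_ge0 b.
have e_cvg : \int[P]_t e m (sp m t) @[m --> \oo] --> \int[P]_t expR (- (V t * (b ^+ 2 * kap) / 2)).
  apply: (@Rintegral_dominated_cvg _ _ R P _ _ (fun=> 1)).
  - by move=> m; exact: (measurable_sp m (e m)).
  - apply: measurableT_comp => //; apply: measurableT_comp => //.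
    by apply: measurable_funM => //; apply: measurable_funM.
  - apply: filterS cvgV => t ct.
    apply: (@cvg_comp _ _ _ (fun m => - ((1 - avg1 m (sp m t) ^+ 2) * (b ^+ 2 * kap) / 2)) expR);
      last exact: continuous_expR.
    by apply: cvgN; apply: cvgM; [apply: cvgM; [exact: ct|exact: cvg_cst]|exact: cvg_cst].
  - exact: finite_measure_integrable_cst.
  - move=> m t; rewrite /e ger0_norm ?expR_ge0 // -[leRHS](@expR0 R) ler_expR oppr_le0.
    have /andP[V0 _] := @avg1_var_itv R m (sp m t).
    by rewrite divr_ge0 // mulr_ge0.
have close m n : (0 < m)%N -> (m <= n)%N ->
    `|\int[P]_t cos (a + b * limit_fluct n t) - cos a * \int[P]_t e m (sp m t)| <=
    C * (m%:R `^ (- gam) + m%:R / sq n).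
  move=> m0 mn; have [_ ->] := sp_law m (e m).
  have lhs : `|E N (fun w => cos (a + b * fluct mu n N w)) - cos a * E m (e m)| @[N --> \oo] -->
     `|\int[P]_t cos (a + b * limit_fluct n t) - cos a * E m (e m)|.
    apply: cvg_norm; apply: cvgB; last exact: cvg_cst.
    exact: (@mean_fluct_cvg n _ (bcont_cos a b)).
  have rhs : C * (m%:R `^ (- gam) + (m%:R / sq n + h n / h N)) @[N --> \oo] -->
     C * (m%:R `^ (- gam) + (m%:R / sq n + 0)).
    apply: cvgM; first exact: cvg_cst.
    apply: cvgD; first exact: cvg_cst.
    by apply: cvgD; [exact: cvg_cst|exact: excess_ratio_cvg].
  rewrite addr0 in rhs.
  apply: (ler_cvg_to lhs rhs); near=> N; apply: hC => //.
  by near: N; exact: nbhs_infty_ge.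
apply/cvgrPdist_le => eps eps0.
have e3 : 0 < eps / 3 by rewrite divr_gt0.
have C1 : 0 < C + 1 by lra.
have e3C : 0 < eps / 3 / (C + 1) by rewrite divr_gt0.
(* The horizon is already gone from [close]. Fixing m before n is forced: the remaining bound
   m^(-gam) + m / [root n] needs m large, but n much larger. *)
have [m [m0 hm1 hm2]] : exists m, [/\ (0 < m)%N, m%:R `^ (- gam) <= eps / 3 / (C + 1) &
    `|cos a * \int[P]_t expR (- (V t * (b ^+ 2 * kap) / 2)) - cos a * \int[P]_t e m (sp m t)| <= eps / 3].
  have /cvgrPdist_le /(_ _ e3C) c1 := powRN_cvg0 gam0.
  have /cvgrPdist_le /(_ _ e3) c2 : cos a * \int[P]_t e m (sp m t) @[m --> \oo] -->
      cos a * \int[P]_t expR (- (V t * (b ^+ 2 * kap) / 2)).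
    by apply: cvgM => //; exact: cvg_cst.
  near \oo => m; exists m; split.
  - by near: m; exact: nbhs_infty_gt.
  - have : `|0 - m%:R `^ (- gam)| <= eps / 3 / (C + 1) by near: m.
    by rewrite sub0r normrN ger0_norm ?powR_ge0.
  - by near: m.
have /cvgrPdist_le /(_ _ e3C) c3 := root_ratio_cvg m.
near=> n.
have mn : (m <= n)%N by near: n; exact: nbhs_infty_ge.
have hn : `|0 - m%:R / sq n| <= eps / 3 / (C + 1) by near: n.
rewrite sub0r normrN ger0_norm ?divr_ge0 ?powR_ge0 // in hn.
have := close m n m0 mn.
have b1 : C * (m%:R `^ (- gam)) <= eps / 3.
  rewrite (@le_trans _ _ ((C + 1) * (eps / 3 / (C + 1)))) //.
    by rewrite ler_pM ?powR_ge0 //; lra.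
  by rewrite mulrC divfK // gt_eqF.
have b2 : C * (m%:R / sq n) <= eps / 3.
  rewrite (@le_trans _ _ ((C + 1) * (eps / 3 / (C + 1)))) //.
    by rewrite ler_pM ?divr_ge0 ?powR_ge0 //; lra.
  by rewrite mulrC divfK // gt_eqF.
rewrite mulrDr distrC => b3.
have := ler_distD (cos a * \int[P]_t e m (sp m t))
  (cos a * \int[P]_t expR (- (V t * (b ^+ 2 * kap) / 2))) (\int[P]_t cos (a + b * limit_fluct n t)).
lra.
Unshelve. all: by end_near. Qed.

Lemma limit_fluct_cvg (f : R -> R) : bcont f ->
  \int[P]_t f (limit_fluct n t) @[n --> \oo] --> \int[L]_x f x.
Proof.
apply: (@levy_cvg _ (fun n f => \int[P]_t f (limit_fluct n t)) (fun f => \int[L]_x f x)).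
- by move=> n; exact: is_mean_rv (measurable_limit_fluct n).
- exact: (is_mean_rv L (Z := fun x => x) (@measurable_id _ _ _)).
- move=> a b; have -> : \int[L]_x cos (a + b * x) =
      cos a * \int[P]_t expR (- (V t * (b ^+ 2 * kap) / 2)).
    transitivity (\int[P]_t (cos a * expR (- (V t * (b ^+ 2 * kap) / 2)))).
      by rewrite /Rintegral LE.
    apply: RintegralZl => //.
    apply: (@integrable_bounded _ _ _ _ _ 1).
      apply: measurableT_comp => //; apply: measurableT_comp => //.
      by apply: measurable_funM => //; apply: measurable_funM.
    move=> t; rewrite ger0_norm ?expR_ge0 // -[leRHS](@expR0 R) ler_expR oppr_le0.
    by rewrite divr_ge0 // mulr_ge0 // kap_ge0.
  exact: limit_fluct_cos.
- move=> e e0; have [C [C0 hC]] := limit_fluct_tight.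
  (* Tightness of the limit law itself, by dominated convergence of the cutoffs to 0. *)
  have Lcut : \int[L]_x cutoff n.+1%:R x @[n --> \oo] --> \int[L]_x (0 : R).
    apply: (@Rintegral_dominated_cvg _ _ R L _ _ (fun=> 1)).
    + move=> n; apply: continuous_measurable_fun.
      by case: (@bcont_cutoff R n.+1%:R (ltr0Sn _ _)).
    + exact: measurable_cst.
    + apply: aeW => x; apply/cvgrPdist_le => eps eps0; near=> n.
      rewrite sub0r normrN ger0_norm ?cutoff_ge0 // /cutoff ge_min; apply/orP; left.
      rewrite ler_pdivrMr // mulrC -ler_pdivrMr //.
      rewrite (@le_trans _ _ n%:R) ?ler_nat //; near: n; exact: nbhs_infty_ger.
    + exact: finite_measure_integrable_cst.
    + by move=> n x; rewrite ger0_norm ?cutoff_ge0 // /cutoff ge_min lexx orbT.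
  rewrite Rintegral_cst // mul0r in Lcut.
  move/cvgrPdist_le : Lcut => /(_ _ e0) Lcut.
  near \oo => n.
  exists n.+1%:R => //; split.
    have : `|0 - \int[L]_x cutoff n.+1%:R x| <= e by near: n.
    by rewrite sub0r normrN; apply: le_trans; exact: ler_norm.
  move=> k k0; rewrite (le_trans (hC k n.+1%:R k0 _)) //.
  rewrite ler_pdivrMr // mulrC -ler_pdivrMr //.
  rewrite (@le_trans _ _ n%:R) ?ler_nat //; near: n; exact: nbhs_infty_ger.
Unshelve. all: by end_near. Qed.

End path_limit.

(** * The limiting conditional variance *)

Section average_limit.
Context d (T : measurableType d) (R : realType) (P : probability T R).
Context (mu : R) (sp : nat -> T -> state) (W : T -> R).
Context (cvgW : {ae P, forall t, pos1 n (sp n t) / growth mu n @[n --> \oo] --> W t}).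

Lemma average_cvg0 : mu < 1 ->
  {ae P, forall t, 1 - (avg1 m (sp m t) : R) ^+ 2 @[m --> \oo] --> (1 : R)}.
Proof.
move=> mu_lt1; apply: filterS cvgW => t ct.
have c0 : avg1 m (sp m t) @[m --> \oo] --> (0 : R).
  have d0 : 0 < 1 - mu by lra.
  have c : pos1 n (sp n t) / growth mu n * n%:R `^ (- (1 - mu)) @[n --> \oo] --> W t * 0.
    exact: cvgM ct (powRN_cvg0 d0).
  move: c; rewrite mulr0; apply: cvg_trans.
  apply: near_eq_cvg; near=> m.
  have m0 : m%:R != 0 :> R by rewrite pnatr_eq0 -lt0n; near: m; exact: nbhs_infty_gt.
  rewrite /avg1 /growth -mulrA; congr (_ * _).
  rewrite -powRN -powRD; last by rewrite m0 implybT.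
  by rewrite (_ : - mu + - (1 - mu) = - 1) ?powR_inv1 //; lra.
have : 1 - (avg1 m (sp m t) : R) * avg1 m (sp m t) @[m --> \oo] --> 1 - 0 * (0 : R).
  by apply: cvgB; [exact: cvg_cst|exact: cvgM].
by rewrite mulr0 subr0.
Unshelve. all: by end_near. Qed.

Lemma average_cvg_limit : mu = 1 ->
  {ae P, forall t, 1 - (avg1 m (sp m t) : R) ^+ 2 @[m --> \oo] --> 1 - W t ^+ 2}.
Proof.
move=> mu1; apply: filterS cvgW => t ct.
have c0 : avg1 m (sp m t) @[m --> \oo] --> W t.
  move: ct; apply: cvg_trans; apply: near_eq_cvg; apply: nearW => m.
  by rewrite /avg1 /growth mu1 powRr1.
have : 1 - (avg1 m (sp m t) : R) * avg1 m (sp m t) @[m --> \oo] --> 1 - W t * W t.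
  by apply: cvgB; [exact: cvg_cst|exact: cvgM].
by [].
Qed.

Lemma average_limit_le1 : mu = 1 -> {ae P, forall t, 0 <= 1 - W t ^+ 2}.
Proof.
move=> mu1; apply: filterS (average_cvg_limit mu1) => t ct.
have := ler_cvg_to (cvg_cst (0 : R)) ct; apply; apply: nearW => m.
by have /andP[] := @avg1_var_itv R m (sp m t).
Qed.

End average_limit.

Lemma ae_eq_integral_full d (T : measurableType d) (R : realType) (P : probability T R)
    (f g : T -> R) : measurable_fun setT f -> measurable_fun setT g ->
  {ae P, forall t, f t = g t} -> (\int[P]_t (f t)%:E = \int[P]_t (g t)%:E)%E.
Proof.
move=> mf mg fg; apply: ae_eq_integral => //; try exact/measurable_EFinP.
by apply: filterS fg => t e _; rewrite e.
Qed.

(** The two inverses add up to 4 mu / (4 mu^2 - 1), and (a1 / mu)^2 = a1 / a2. *)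
Lemma normal_varianceE (R : rcfType) (a1 a2 : R) : 0 < a1 * a2 -> 4 * a1 * a2 - 1 != 0 ->
  let mu := Num.sqrt (a1 * a2) in
  (1 + (a1 / mu) ^+ 2) * (((2 * mu + 1)^-1 + (2 * mu - 1)^-1) / 4) =
  (1 + a1 / a2) * mu / (4 * a1 * a2 - 1).
Proof.
move=> a0 mu4 mu.
have muE : mu ^+ 2 = a1 * a2 by rewrite sqr_sqrtr // ltW.
have a2n0 : a2 != 0 by move: a0; apply: contraTneq => ->; rewrite mulr0 ltxx.
have a1n0 : a1 != 0 by move: a0; apply: contraTneq => ->; rewrite mul0r ltxx.
have : (2 * mu + 1) * (2 * mu - 1) != 0.
  by rewrite (_ : _ * _ = 4 * a1 * a2 - 1) // -mulrA -muE; ring.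
rewrite mulf_eq0 negb_or => /andP[p0 m0].
have -> : (a1 / mu) ^+ 2 = a1 / a2 by rewrite exprMn exprVn muE; field; rewrite a2n0 a1n0.
have -> : 4 * a1 * a2 - 1 = (2 * mu + 1) * (2 * mu - 1) by rewrite -mulrA -muE; ring.
by field; rewrite a2n0 p0 m0.
Qed.

Theorem theorem1p3 {d} (T : measurableType d) (R : realType) (P : probability T R)
  (p1 p2 : R) (xi1 xi2 u1 u2 : nat -> T -> nat) (x1 x2 : R)
  (X1 X2 : nat -> T -> R) (W : T -> R) :
  (* memory parameters *)
  0 <= p1 <= 1 -> 0 <= p2 <= 1 ->
  (* the driving variables are random variables *)
  (forall i k, elephant_valid i ->
     measurable (elephant_family xi1 xi2 u1 u2 i @^-1` [set k])) ->
  (* xi^(i)_n ~ Bernoulli(p_i), n >= 2 *)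
  (forall n, (2 <= n)%N ->
     P [set t | xi1 n t = 1%N] = p1%:E /\ P [set t | xi1 n t = 0%N] = (1 - p1)%:E) ->
  (forall n, (2 <= n)%N ->
     P [set t | xi2 n t = 1%N] = p2%:E /\ P [set t | xi2 n t = 0%N] = (1 - p2)%:E) ->
  (* u^(i)_n uniform on {1, ..., n}, n >= 1 *)
  (forall n k, (1 <= n)%N -> (1 <= k <= n)%N ->
     P [set t | u1 n t = k] = (n%:R^-1)%:E) ->
  (forall n k, (1 <= n)%N -> (1 <= k <= n)%N ->
     P [set t | u2 n t = k] = (n%:R^-1)%:E) ->
  (* all families mutually independent *)
  mutually_independent_nat P elephant_valid (elephant_family xi1 xi2 u1 u2) ->
  (* initial steps in {-1, 1} *)
  (x1 = 1 \/ x1 = -1) -> (x2 = 1 \/ x2 = -1) ->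
  (forall t, X1 1%N t = x1) -> (forall t, X2 1%N t = x2) ->
  (* the recursion of the two-elephant walk *)
  (forall n t, (1 <= n)%N ->
     X1 n.+1 t = (xi1 n.+1 t)%:R * X2 (u2 n t) t - (1 - (xi1 n.+1 t)%:R) * X2 (u2 n t) t) ->
  (forall n t, (1 <= n)%N ->
     X2 n.+1 t = (xi2 n.+1 t)%:R * X1 (u1 n t) t - (1 - (xi2 n.+1 t)%:R) * X1 (u1 n t) t) ->
  let a1 := 2 * p1 - 1 in
  let a2 := 2 * p2 - 1 in
  0 < a1 * a2 ->
  (a1 = 1 -> a2 = 1 -> x1 != x2) ->
  (a1 = -1 -> a2 = -1 -> x1 = x2) ->
  let lam := Num.sg a2 * Num.sqrt (a1 * a2) in
  (* W is the almost sure limit of S^(1)_n / n^|lam| *)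
  measurable_fun setT W ->
  {ae P, forall t, (fun n => partial_sum X1 n t / n%:R `^ `|lam|) @ \oo --> W t} ->
  let Y := fun n t => n%:R `^ (`|lam| - 2^-1) * (partial_sum X1 n t / n%:R `^ `|lam| - W t) in
  (2^-1 < `|lam| < 1 ->
     cvg_in_distribution P Y
       (normal_prob 0 (Num.sqrt ((1 + a1 / a2) * Num.sqrt (a1 * a2) / (4 * a1 * a2 - 1))))) /\
  (`|lam| = 1 ->
     exists L : borel_law R,
       (forall s : R, (\int[L]_x (cos (s * x))%:E)%E =
                      (\int[P]_t (expR (- ((1 - W t ^+ 2) * s ^+ 2 / 3)))%:E)%E) /\
       (forall s : R, (\int[L]_x (sin (s * x))%:E)%E = 0%E) /\
       cvg_in_distribution P Y L).
Proof.
move=> p1_01 p2_01 mY Pxi1 Pxi2 Pu1 Pu2 indep x1_pm x2_pm X11 X21 X1S X2S a1 a2 a12_gt0 _ _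
  lam mW cvgXW Y.
pose mu : R := Num.sqrt (a1 * a2).
have mu_gt0 : 0 < mu by rewrite sqrtr_gt0.
have mu_sqr : mu ^+ 2 = a1 * a2 by rewrite sqr_sqrtr // ltW.
have a2_neq0 : a2 != 0 by move: a12_gt0; apply: contraTneq => ->; rewrite mulr0 ltxx.
have lamE : `|lam| = mu.
  by rewrite normrM normr_sg a2_neq0 mul1r ger0_norm // ltW.
have a1_le1 : `|a1| <= 1 by rewrite ler_norml /a1; move: p1_01; lra.
have a2_le1 : `|a2| <= 1 by rewrite ler_norml /a2; move: p2_01; lra.
have mu_le1 : mu <= 1.
  rewrite -(@ler_pXn2r _ 2) ?nnegrE ?(ltW mu_gt0) // mu_sqr expr1n.
  by rewrite (le_trans (ler_norm _)) // normrM mulr_ile1.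
(* The common sign of a1 and a2 is carried by [rho], so mu = [|lam|] serves both signs of [lam]. *)
pose rho := a1 / mu.
have a1E : a1 = rho * mu by rewrite /rho divfK ?gt_eqF.
have a2E : rho * a2 = mu.
  by rewrite /rho mulrAC -mu_sqr expr2 mulfK ?gt_eqF.
pose start := elephant_start x1 x2.
pose sp := sample_path xi1 xi2 u1 u2 x1 x2.
pose D := good_set xi1 xi2 u1 u2.
have mD : measurable D := measurable_good_set mY Pxi1 Pxi2 Pu1 Pu2.
have PD : P (~` D) = 0%E := good_set_full mY Pxi1 Pxi2 Pu1 Pu2.
have sp_law := sample_path_law x1 x2 mY Pxi1 Pxi2 Pu1 Pu2 indep.
have sp_pos n N t : (n <= N)%N -> pos1 n (sp N t) = pos1 n (sp n t) :> R.
  exact: pos1_walk_path.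
have spE n t : D t -> partial_sum X1 n t = pos1 n (sp n t).
  exact: (partial_sum_sample_path x1_pm x2_pm X11 X21 X1S X2S).
have aeD : {ae P, forall t, D t}.
  by exists (~` D); split => //; exact: measurableC.
have cvgW : {ae P, forall t, pos1 n (sp n t) / growth mu n @[n --> \oo] --> W t}.
  move: aeD cvgXW; apply: filterS2 => t Dt; rewrite lamE.
  by under eq_fun do rewrite spE //.
have cvg_law (V : T -> R) (L : borel_law R) : 2^-1 < mu -> measurable_fun setT V ->
    (forall t, 0 <= V t) ->
    {ae P, forall t, 1 - (avg1 m (sp m t) : R) ^+ 2 @[m --> \oo] --> V t} ->
    (forall a b : R, (\int[L]_x (cos (a + b * x))%:E = \int[P]_t (cos a *
       expR (- (V t * (b ^+ 2 *
        ((1 + rho ^+ 2) * (((2 * mu + 1)^-1 + (2 * mu - 1)^-1) / 4))) / 2)))%:E)%E) ->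
    cvg_in_distribution P Y L.
  move=> mu_gt mV V_ge0 cvgV LE f cf Mf; have bf : bcont f by [].
  (* [Y n] agrees with the measurable [limit_fluct] only on [D], hence the comparison of integrals
     without measurability of [Y n]. *)
  have EY n : (\int[P]_t (f (Y n t))%:E = (\int[P]_t f (limit_fluct mu sp W n t))%:E)%E.
    have mL := measurable_limit_fluct mu sp_law mW n.
    rewrite -(EFin_Rintegral_bcont P bf mL).
    apply: (eq_integral_full mD PD) => t Dt.
    by rewrite /Y /limit_fluct lamE spE.
  under eq_fun do rewrite EY.
  rewrite (@EFin_Rintegral_bcont _ _ _ L f (fun x => x) bf (@measurable_id _ _ _)).
  apply: cvg_EFin; first exact: nearW.
  exact: (limit_fluct_cvg a1_le1 a2_le1 mu_gt mu_le1 a1E a2E sp_law sp_pos mW mV V_ge0 cvgW cvgV LE bf).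
rewrite lamE; split=> [/andP[mu_gt mu_lt1]|mu1].
- have mu2 : 0 < 4 * a1 * a2 - 1.
    by rewrite -mulrA -mu_sqr expr2; nra.
  set s2 := (1 + a1 / a2) * _ / _.
  have kapE : (1 + rho ^+ 2) * (((2 * mu + 1)^-1 + (2 * mu - 1)^-1) / 4) = s2.
    exact: normal_varianceE a12_gt0 (lt0r_neq0 mu2).
  have s2_gt0 : 0 < s2.
    rewrite divr_gt0 // mulr_gt0 // addr_gt0 //.
    rewrite (_ : a1 / a2 = a1 * a2 / a2 ^+ 2); last by field.
    by rewrite divr_gt0 // exprn_even_gt0.
  apply: (cvg_law (fun=> 1)) => //; first exact: (average_cvg0 cvgW mu_lt1).
  move=> a b; rewrite normal_cf ?gt_eqF ?sqrtr_gt0 // sqr_sqrtr ?(ltW s2_gt0) //.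
  rewrite integral_cst // [X in (_ * X)%E](_ : _ = 1%E) ?mule1; last exact: probability_setT.
  rewrite kapE mul1r.
  by rewrite (mulrC s2).
- have mu_gt : 2^-1 < mu by rewrite mu1; lra.
  (* 1 - W^2 is nonnegative only almost surely, whereas [cvg_law] asks for it at every point. *)
  pose V t : R := Num.max (1 - W t ^+ 2) 0.
  have mV : measurable_fun setT V.
    apply: measurable_maxr => //; apply: measurable_funB => //.
    exact: measurable_funX.
  have V_ge0 t : 0 <= V t by rewrite /V le_max lexx orbT.
  have VE : {ae P, forall t, V t = 1 - W t ^+ 2}.
    by apply: filterS (average_limit_le1 cvgW mu1) => t h; rewrite /V max_l.
  have cvgV : {ae P, forall t, 1 - (avg1 m (sp m t) : R) ^+ 2 @[m --> \oo] --> V t}.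
    move: VE (average_cvg_limit cvgW mu1); apply: filterS2 => t ->; exact.
  have rho2 : rho ^+ 2 = 1.
    have a11 : a1 * a2 = 1 by rewrite -mu_sqr mu1 expr1n.
    have r2 : rho = a1 by rewrite /rho mu1 divr1.
    have s1 : a1 ^+ 2 <= 1 by rewrite -real_normK ?num_real // expr_le1.
    have s2 : a2 ^+ 2 <= 1 by rewrite -real_normK ?num_real // expr_le1.
    have s12 : a1 ^+ 2 * a2 ^+ 2 = 1 by rewrite -exprMn a11 expr1n.
    have := sqr_ge0 a1; rewrite r2; nra.
  (* The value of (1 + rho^2) (1 / (2 mu + 1) + 1 / (2 mu - 1)) / 4 at rho^2 = mu = 1. *)
  pose kap : R := 2 / 3.
  pose sg t : R := Num.sqrt (kap * V t).
  have msg : measurable_fun setT sg.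
    apply: (@measurableT_comp _ _ _ _ _ _ (Num.sqrt : R -> R)).
      exact: (continuous_measurable_fun (@sqrt_continuous R)).
    exact: measurable_funM.
  have sgE t : sg t ^+ 2 = kap * V t by rewrite sqr_sqrtr // mulr_ge0 // /kap; lra.
  have [L LE] := normal_mixture P msg.
  have LV a b : (\int[L]_x (cos (a + b * x))%:E =
      \int[P]_t (cos a * expR (- (V t * (b ^+ 2 * kap) / 2)))%:E)%E.
    rewrite LE; apply: eq_integral => t _; rewrite sgE.
    by congr (_ * expR (- _))%:E; ring.
  exists L; split; [|split].
  + move=> s; have := LV 0 s; under eq_integral do rewrite add0r.
    move=> ->; apply: ae_eq_integral_full.
    * apply: measurable_funM => //; apply: measurableT_comp => //; apply: measurableT_comp => //.
      by apply: measurable_funM => //; apply: measurable_funM.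
    * apply: measurableT_comp => //; apply: measurableT_comp => //.
      apply: measurable_funM => //; apply: measurable_funM => //; apply: measurable_funB => //.
      exact: measurable_funX.
    * apply: filterS VE => t ->; rewrite cos0 mul1r /kap; congr (expR (- _)).
      by field.
  (* At phase - pi / 2 the cosine becomes sin (s x), and the factor cos (- pi / 2) kills the
     right-hand side. *)
  + move=> s; have := LV (- (pi / 2)) s; rewrite cosN cos_pihalf.
    under [in RHS]eq_integral do rewrite mul0r.
    rewrite integral0 => <-; apply: eq_integral => x _; congr _%:E.
    by rewrite addrC -[s * x - _]opprB cosN cosB cos_pihalf sin_pihalf; ring.
  + apply: (cvg_law V) => // a b; rewrite LV; apply: eq_integral => t _.
    rewrite rho2 mu1 /kap; congr (_ * expR (- _))%:E; by field.
Qed.
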